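(* Let $\Omega\subset\mathbb{C}^2$ be a bounded pseudoconvex domain with smooth boundary, and let $\delta$ be an arbitrary defining function of $\Omega$. Let $\Sigma\subset\partial\Omega$ denote the set of Levi-flat points of $\partial\Omega$. Suppose there is a real-valued smooth function $u$, defined on a neighborhood of $\Sigma$ in $\partial\Omega$, which solves $$L(u)=-\frac{\mathrm{Hess}_\delta(L,N)}{\|\nabla\delta\|}\quad\text{on }\Sigma,$$ where $L$ is the normalized holomorphic tangential vector field and $N$ the normalized complex normal vector field of $\partial\Omega$. Then the Diederich--Fornæss index of $\Omega$ is $1$.
   Context: Coordinates on $\mathbb{C}^2$ are $(z,w)$. A defining function of a bounded domain $\Omega$ with smooth boundary is a smooth real-valued function $\rho$ on a neighborhood of $\overline\Omega$ with $\Omega=\{\rho<0\}$, $\partial\Omega=\{\rho=0\}$ and $\nabla\rho\ne0$ on $\partial\Omega$. $\|\nabla\delta\|$ is the norm of the (Euclidean) gradient of $\delta$. For a smooth function $f$ and $(1,0)$ vectors $Z=Z_1\frac{\partial}{\partial z}+Z_2\frac{\partial}{\partial w}$, $W=W_1\frac{\partial}{\partial z}+W_2\frac{\partial}{\partial w}$, the complex Hessian is $\mathrm{Hess}_f(Z,W)=Z(\overline W f)-(\nabla_Z\overline W)f=\sum_{j,k=1}^2\frac{\partial^2 f}{\partial z_j\partial\bar z_k}Z_j\overline{W_k}$, where $(z_1,z_2)=(z,w)$ and $\nabla$ is the flat connection. Given a defining function $\rho$, on $\partial\Omega$ put $$L=\frac{1}{\sqrt{|\rho_z|^2+|\rho_w|^2}}\Big(\rho_w\frac{\partial}{\partial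 z}-\rho_z\frac{\partial}{\partial w}\Big),\qquad N=\frac{1}{\sqrt{|\rho_z|^2+|\rho_w|^2}}\Big(\rho_{\bar z}\frac{\partial}{\partial z}+\rho_{\bar w}\frac{\partial}{\partial w}\Big);$$ on $\partial\Omega$ these do not depend on the choice of $\rho$ (one may take $\rho=\delta$). A point of $\partial\Omega$ is Levi-flat if the Levi form $\mathrm{Hess}_\rho(L,L)$ vanishes there. A number $0<\tau<1$ is a Diederich--Fornæss exponent of $\Omega$ if there is a defining function $\rho$ of $\Omega$ such that $-(-\rho)^{\tau}$ is plurisubharmonic on $\Omega$. The Diederich--Fornæss index of $\Omega$ is the supremum of all such $\tau$ over all defining functions of $\Omega$. *)

(* Defs.v *)
From HB Require Import structures.
From mathcomp Require Import all_boot all_order all_algebra.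
From mathcomp Require Import all_classical all_reals all_analysis.
From mathcomp Require Import complex.

Set Implicit Arguments.
Unset Strict Implicit.
Unset Printing Implicit Defensive.

Import Order.TTheory GRing.Theory Num.Theory.
Import numFieldNormedType.Exports.

Local Open Scope classical_set_scope.
Local Open Scope ring_scope.
Local Open Scope complex_scope.

(* C^2 as the real space R^4: the coordinates of a point are
   (x_0, x_1, y_0, y_1), and z = x_0 + i y_0, w = x_1 + i y_1.
   The sup norm on row vectors gives the usual topology and the usual
   bounded sets. *)
Notation C2 R := 'rV[R]_(2 + 2).

Section Calculus.
Variable R : realType.
Implicit Types (U M : set (C2 R)) (f : C2 R -> R) (F : C2 R -> R[i]).
Implicit Types (Z W : 'rV[R[i]]_2) (p q : C2 R).

Definition xdir (j : 'I_2) : 'I_(2 + 2) := lshift 2 j.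
Definition ydir (j : 'I_2) : 'I_(2 + 2) := rshift 2 j.

Definition C2_of Z : C2 R :=
  row_mx (map_mx (@complex.Re R) Z) (map_mx (@complex.Im R) Z).

Definition basis (i : 'I_(2 + 2)) : C2 R := delta_mx 0 i.

Definition partial (i : 'I_(2 + 2)) f : C2 R -> R :=
  fun p => 'D_(basis i) f p.

(* For U open, this is the class C^k on U; nothing is required of the values
   of f outside U. *)
Fixpoint Ck_on (k : nat) U f : Prop :=
  (forall p, U p -> {for p, continuous f}) /\
  if k is k'.+1 then
    forall i, (forall p, U p -> derivable f p (basis i)) /\
              Ck_on k' U (partial i f)
  else True.

Definition smooth_on U f : Prop := forall k, Ck_on k U f.

Definition grad f p : C2 R := \row_i partial i f p.

(* The library norm of a row vector is the sup norm. *)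
Definition eucl_norm (v : C2 R) : R := Num.sqrt (\sum_i v 0 i ^+ 2).

Definition cpartial (i : 'I_(2 + 2)) F p : R[i] :=
  partial i (fun q => complex.Re (F q)) p +i*
  partial i (fun q => complex.Im (F q)) p.

Definition dz (j : 'I_2) F : C2 R -> R[i] :=
  fun p => (cpartial (xdir j) F p - (0 +i* 1) * cpartial (ydir j) F p) / 2.

Definition dzbar (j : 'I_2) F : C2 R -> R[i] :=
  fun p => (cpartial (xdir j) F p + (0 +i* 1) * cpartial (ydir j) F p) / 2.

Definition toC f : C2 R -> R[i] := fun p => (f p)%:C.

(* The (1,0) vector Z_0 d/dz + Z_1 d/dw at p applied to f. *)
Definition vect_app Z f p : R[i] := \sum_j Z 0 j * dz j (toC f) p.

Definition hess f Z W p : R[i] :=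
  \sum_j \sum_k dz j (dzbar k (toC f)) p * Z 0 j * (W 0 k)^*.

Definition dnorm f p : R[i] :=
  sqrtC (`|dz 0 (toC f) p| ^+ 2 + `|dz 1 (toC f) p| ^+ 2).

Definition Lvect f p : 'rV[R[i]]_2 :=
  (dnorm f p)^-1 *:
    \row_j (if j == 0 then dz 1 (toC f) p else - dz 0 (toC f) p).

Definition Nvect f p : 'rV[R[i]]_2 :=
  (dnorm f p)^-1 *: \row_j dzbar j (toC f) p.

(* Functions on a subset M of C^2 (below, an open piece of the boundary) are
   total functions of which only the values on M matter; smoothness on M means
   that there are smooth local extensions to open sets of C^2. *)
Definition local_extension M (u : C2 R -> R) p (v : C2 R -> R) : Prop :=
  exists U, [/\ open U, U p, smooth_on U v &
                forall q, U q -> M q -> v q = u q].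

Definition smooth_along M (u : C2 R -> R) : Prop :=
  forall p, M p -> exists v, local_extension M u p v.

(* Z(u)(p) = c for u smooth on M: for Z tangent to M at p the value does not
   depend on the local extension used to compute it. *)
Definition vect_app_along M Z (u : C2 R -> R) p (c : R[i]) : Prop :=
  forall v, local_extension M u p v -> vect_app Z v p = c.

(* Real-valued case of the usual notion: upper semicontinuity and the
   sub-mean-value inequality on every closed disc a + {|zeta| <= 1} b
   of a complex line contained in U. *)
Definition psh_on U f : Prop :=
  (forall a, U a -> forall c : R, f a < c -> \forall x \near a, f x < c) /\
  (forall (a : C2 R) (b : 'rV[R[i]]_2),
     (forall zeta : R[i], `|zeta| <= 1 -> U (a + C2_of (zeta *: b))) ->
     ((f a)%:E <= ((2 * pi)^-1)%:E *
        \int[lebesgue_measure]_(t in `[0%R, (2 * pi)%R])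
          (f (a + C2_of ((cos t +i* sin t) *: b)))%:E)%E).

End Calculus.

Section Domains.
Variable R : realType.
Implicit Types (Omega : set (C2 R)) (rho : C2 R -> R).

Definition bdry Omega : set (C2 R) := closure Omega `\` interior Omega.

Definition bounded_domain Omega : Prop :=
  [/\ Omega !=set0, open Omega, connected Omega & bounded_set Omega].

Definition defining_function Omega rho : Prop :=
  exists U, [/\ open U, closure Omega `<=` U & smooth_on U rho] /\
    [/\ Omega = [set p | U p /\ rho p < 0],
        bdry Omega = [set p | U p /\ rho p = 0] &
        forall p, bdry Omega p -> grad rho p != 0].

Definition smooth_bdry Omega : Prop := exists rho, defining_function Omega rho.

Definition levi_form rho (p : C2 R) : R[i] :=
  hess rho (Lvect rho p) (Lvect rho p) p.

(* The sign of the Levi form does not depend on the defining function; in R[i],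
   0 <= c means that c is real and nonnegative. *)
Definition levi_pseudoconvex Omega : Prop :=
  forall rho, defining_function Omega rho ->
    forall p, bdry Omega p -> 0 <= levi_form rho p.

Definition levi_flat Omega rho : set (C2 R) :=
  [set p | bdry Omega p /\ levi_form rho p = 0].

Definition DF_exponent Omega (tau : R) : Prop :=
  0 < tau < 1 /\
  exists rho, defining_function Omega rho /\
    psh_on Omega (fun p => - ((- rho p) `^ tau)).

(* Exponents are < 1, so this is a genuine supremum unless there is no exponent,
   in which case it is 0. *)
Definition DF_index Omega : R := sup [set tau | DF_exponent Omega tau].

End Domains.

(* Main.v *)
(* Replacing delta by r = delta exp(2 u) kills the mixed term Hess_r(L, N) at
   all Levi-flat points.  There the normal derivative of the Levi form of r
   equals the derivative of Hess_r(L, N) along conj L, so that the Levi form on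
   the hypersurfaces inside Omega is bounded below by lambda r, with lambda
   controlled by that derivative.  Hence, with
     psi = K |Hess_r(L, N)|^2 + e |z|^2,  e small and K large,
   the function s = r exp(- psi) satisfies
     (- s) Hess_s(Z, Z) + k |Z s|^2 >= 0,  k = (1 - tau) / 8,
   inside Omega near every boundary point; at strictly pseudoconvex points this
   holds for every psi.  By compactness it holds on {- c < s < 0} for some
   c > 0.  With E(x) = exp(- 1 / x) for x > 0 and E = 0 elsewhere,
   rho = E(s + c) - E(c) is a defining function; - (- rho)^tau is constant where
   s <= - c, and the inequality makes it plurisubharmonic elsewhere. *)

Require Import Defs.
From HB Require Import structures.
From mathcomp Require Import all_boot all_order all_algebra.
From mathcomp Require Import all_classical all_reals all_analysis.
From mathcomp Require Import complex ring lra.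
Import Order.TTheory GRing.Theory Num.Theory.
Import numFieldNormedType.Exports.
Local Open Scope classical_set_scope.
Local Open Scope ring_scope.
Local Open Scope complex_scope.

Set Implicit Arguments.
Unset Strict Implicit.
Unset Printing Implicit Defensive.

(** * Smooth functions on R^4 *)

(** Pseudoconvexity controls the Levi form on the boundary only; just inside, near a flat point, it
    may be negative of the order of d = - r. In the frame L, N the form to be made nonnegative has
    entries d (levi + d tang), d cross and k g^2 + O(d), with g = [grad2 r]. At a flat point the LL
    entry and the squared off-diagonal entry are both of order d^2, so shrinking the neighborhood
    gains nothing: the weight must raise [tang] without raising [cross]. The square K |h|^2 with h =
    [mixed r] does so. Where h = 0 its gradient vanishes, while its Hessian on L dominates the
    square of the derivative of h along conj L, and the possible negativity of the Levi form is
    linear in that derivative. The summand e |z|^2 supplies the remaining margin.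

    The estimate holds near the boundary, whereas an exponent requires plurisubharmonicity on all of
    [Omega]; this is why the outer function is constant farther inside. Flattening costs part of the
    convexity of the power, and the divisor 8 in k pays for it ([flat_convexity]).

    In the algebraic identities conjugates are independent unknowns, which makes them polynomial
    identities. *)

Lemma differentiable_expansion (R : realType) (V : normedModType R) (f : V -> R)
    (L : {linear V -> R}) p : continuous L ->
  (forall e : R, 0 < e -> \forall v \near (0 : V),
     `|f (p + v) - f p - L v| <= e * `|v|) ->
  differentiable f p /\ 'd f p = L :> (V -> R).
Proof.
move=> cL H; have E : f \o shift p = cst (f p) + L +o_ 0 id.
  apply/eqaddoP => e e0; have := H e e0.
  apply: filterS => v /=; rewrite !fctE /= opprD addrA.
  by rewrite [v + p]addrC.
have dE : 'd f p = L :> (V -> R) by exact: diff_unique.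
by split=> //; apply/diff_locallyP; rewrite dE.
Qed.

Section RealCalculus.
Variable R : realType.
Implicit Types (U V : set (C2 R)) (f g : C2 R -> R) (p q v : C2 R).

Lemma is_derive_line f p v (t : R) :
  derivable f (p + t *: v) v ->
  is_derive t 1 (fun s => f (p + s *: v)) ('D_v f (p + t *: v)).
Proof.
move=> df; have E : (fun h : R => h^-1 *: (((fun s => f (p + s *: v)) \o shift t)
    (h *: 1) - f (p + t *: v))) =
    (fun h : R => h^-1 *: ((f \o shift (p + t *: v)) (h *: v) - f (p + t *: v))).
  apply/funext => h /=; congr (_ *: (f _ - _)).
  by rewrite [h%:A]mulr1 scalerDl addrCA addrA addrC addrA.
by split; rewrite /derivable /derive E.
Qed.

Definition C1on U f := forall p, U p -> forall i,
  derivable f p (Defs.basis R i) /\ {for p, continuous (partial i f)}.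

Lemma norm_coord v i : `|v 0 i| <= `|v|.
Proof.
rewrite [in leRHS]/Num.Def.normr /= mx_normrE.
exact: (le_bigmax _ _ (ord0, i)).
Qed.

Lemma norm_le_coord v (e : R) : 0 <= e -> (forall i, `|v 0 i| <= e) -> `|v| <= e.
Proof.
move=> e0 ve; rewrite [in leLHS]/Num.Def.normr /= mx_normrE.
apply: bigmax_le => /=; last by move=> [i j] _; rewrite ord1.
exact: e0.
Qed.

Let trunc v (k : nat) : C2 R := \row_i (if (i < k)%N then v 0 i else 0).

Let truncS v (k : 'I_(2 + 2)) : trunc v k.+1 = trunc v k + v 0 k *: Defs.basis R k.
Proof.
apply/rowP => i; rewrite !mxE eqxx /= ltnS leq_eqVlt val_eqE.
have [->|ne] := eqVneq i k; first by rewrite ltnn add0r mulr1.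
by rewrite /= mulr0 addr0.
Qed.

(* Telescoping along the coordinate axes, with the mean value theorem on each
   step. *)
Lemma C1_expansion U f p : open U -> C1on U f -> U p ->
  forall e : R, 0 < e -> \forall v \near (0 : C2 R),
    `|f (p + v) - f p - \sum_i v 0 i * partial i f p| <= e * `|v|.
Proof.
move=> oU cf Up e e0.
(* A quarter of the tolerance for each of the four coordinate steps. *)
have e4 : 0 < e / 4 by rewrite divr_gt0.
have near_p : \forall q \near p, U q /\ forall i, `|partial i f p - partial i f q| <= e / 4.
  have H : \forall q \near p, forall i, `|partial i f p - partial i f q| <= e / 4.
    have := @filter_forall _ _
      (fun i q => `|partial i f p - partial i f q| <= e / 4) (nbhs p) _.
    apply => i.
    by have [_ /cvgrPdist_le] := cf p Up i; exact.
  near=> q; split; last by near: q.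
  by near: q; exact: open_nbhs_nbhs.
case/nbhs_ballP: near_p => d /= d0 Hd.
apply/nbhs_ballP; exists d => //= v; rewrite -ball_normE /= sub0r normrN => vd.
have inb (w : C2 R) : `|w| <= `|v| -> U (p + w) /\ forall i, `|partial i f p - partial i f (p + w)| <= e / 4.
  move=> wv; apply: Hd; rewrite -ball_normE /= opprD addrA subrr sub0r normrN.
  exact: le_lt_trans wv vd.
have step (k : 'I_(2 + 2)) :
    `|f (p + trunc v k.+1) - f (p + trunc v k) - v 0 k * partial k f p| <= e / 4 * `|v|.
  set q := p + trunc v k.
  have seg (s : R) : `|s| <= `|v 0 k| -> U (q + s *: Defs.basis R k) /\
      `|partial k f p - partial k f (q + s *: Defs.basis R k)| <= e / 4.
    move=> sv; have [] := inb (trunc v k + s *: Defs.basis R k).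
      apply: norm_le_coord => // j; rewrite !mxE eqxx /=.
      have [jk|jk] := eqVneq j k.
        by rewrite jk ltnn add0r mulr1 (le_trans sv) ?norm_coord.
      by rewrite mulr0 addr0; case: ifP => _; rewrite ?normr0 ?norm_coord.
    by rewrite addrA => ? /(_ k).
  have -> : p + trunc v k.+1 = q + v 0 k *: Defs.basis R k by rewrite truncS addrA.
  have dq (s : R) : `|s| <= `|v 0 k| ->
     is_derive s 1 (fun s : R => f (q + s *: Defs.basis R k)) (partial k f (q + s *: Defs.basis R k)).
    by move=> /seg[Uq _]; apply: is_derive_line; have [] := cf _ Uq k.
  have fq : f q = f (q + 0 *: Defs.basis R k) by rewrite scale0r addr0.
  (* The mean value theorem runs over an oriented interval, so the sign of the coordinate decides
     which end comes first. *)
  have [v0|v0] := leP 0 (v 0 k).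
    have [||c] := @MVT_segment R (fun s : R => f (q + s *: Defs.basis R k))
      (fun s : R => partial k f (q + s *: Defs.basis R k)) 0 (v 0 k) v0.
    - move=> x; rewrite in_itv /= => /andP[x0 xv]; apply: dq.
      by rewrite !ger0_norm // ltW.
    - apply: derivable_within_continuous => x; rewrite in_itv /= => /andP[x0 xv].
      by have [|//] := dq x; rewrite !ger0_norm.
    rewrite in_itv /= => /andP[c0 cv]; rewrite subr0 fq => ->.
    rewrite mulrC -mulrBr normrM mulrC ler_pM // ?norm_coord // distrC.
    by have [|//] := seg c; rewrite !ger0_norm.
  have [||c] := @MVT_segment R (fun s : R => f (q + s *: Defs.basis R k))
    (fun s : R => partial k f (q + s *: Defs.basis R k)) (v 0 k) 0 (ltW v0).
  - move=> x; rewrite in_itv /= => /andP[x0 xv]; apply: dq.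
    by rewrite !ler0_norm ?lerN2 // ltW.
  - apply: derivable_within_continuous => x; rewrite in_itv /= => /andP[x0 xv].
    by have [|//] := dq x; rewrite !ler0_norm ?lerN2 // ltW.
  rewrite in_itv /= => /andP[c0 cv]; rewrite sub0r fq => E.
  rewrite -[f _ - f _]opprB E mulrN opprK mulrC -mulrBr normrM mulrC ler_pM // ?norm_coord // distrC.
  by have [|//] := seg c; rewrite !ler0_norm ?lerN2 // ltW.
have -> : f (p + v) - f p = \sum_(k < 2 + 2) (f (p + trunc v k.+1) - f (p + trunc v k)).
  rewrite -(big_mkord xpredT (fun k => f (p + trunc v k.+1) - f (p + trunc v k))).
  rewrite (telescope_sumr (fun k => f (p + trunc v k))) //; congr (f _ - f _).
    by congr (_ + _); apply/rowP => i; rewrite mxE ltn_ord.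
  by rewrite -[LHS]addr0; congr (_ + _); apply/rowP => i; rewrite !mxE.
rewrite -sumrB; apply: le_trans (ler_norm_sum _ _ _) _.
apply: (le_trans (ler_sum _ (fun k _ => step k))).
rewrite sumr_const card_ord -mulr_natr; lra.
Unshelve. all: by end_near. Qed.

(** The differential as an explicit sum: for fixed [v] it is again smooth in [p], by closure under
    sums and products ([smooth_on_dmap]), and can be differentiated once more. *)
Definition dmap f p v : R := \sum_i v 0 i * partial i f p.

Let dmap_linear f p : linear (dmap f p : C2 R -> R).
Proof.
move=> a u v; rewrite /dmap scaler_sumr -big_split /=.
by apply: eq_bigr => i _; rewrite !mxE mulrDl -mulrA.
Qed.

Let dmap_continuous f p : continuous (dmap f p).
Proof.
apply: continuous_big => [|i _ v]; first exact: add_continuous.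
by apply: (@cvgM _ _ (nbhs v) _ (fun w : C2 R => w 0 i) (cst (partial i f p)));
  [exact: coord_continuous|exact: cvg_cst].
Qed.

Lemma C1_differentiable U f p : open U -> C1on U f -> U p ->
  differentiable f p /\ 'd f p = dmap f p :> (C2 R -> R).
Proof.
move=> oU cf Up.
pose L : {linear C2 R -> R} :=
  HB.pack (dmap f p) (GRing.isLinear.Build _ _ _ _ _ (@dmap_linear f p)).
have cL : continuous L by exact: dmap_continuous.
by apply: (@differentiable_expansion _ _ f L p) => // e e0; exact: (C1_expansion oU cf Up e0).
Qed.

Lemma Ck_onS k U f : Ck_on k.+1 U f -> Ck_on k U f.
Proof.
elim: k f => [|k IH] f [cf df]; first by split.
by split=> // i; have [d /IH] := df i.
Qed.

Lemma Ck_on_sub k U V f : V `<=` U -> Ck_on k U f -> Ck_on k V f.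
Proof.
move=> VU; elim: k f => [|k IH] f [cf df]; split => //.
- by move=> p /VU/cf.
- by move=> p /VU/cf.
- by move=> i; have [d /IH] := df i; split=> // p /VU; exact: d.
Qed.

Lemma eq_on_near U f g p : open U -> U p -> (forall q, U q -> f q = g q) ->
  \near p, f p = g p.
Proof.
move=> oU Up fg; have : \near p, U p by exact: open_nbhs_nbhs.
exact: filterS.
Qed.

Lemma eq_on_partial U f g : open U -> (forall q, U q -> f q = g q) ->
  forall i q, U q -> partial i f q = partial i g q.
Proof.
by move=> oU fg i q Uq; apply: near_eq_derive; exact: eq_on_near fg.
Qed.

Lemma eq_on_continuous U f g p : open U -> U p -> (forall q, U q -> f q = g q) ->
  {for p, continuous f} -> {for p, continuous g}.
Proof.
move=> oU Up fg cf; rewrite /prop_for /continuous_at -(fg p Up).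
exact: cvg_trans (near_eq_cvg (eq_on_near oU Up fg)) cf.
Qed.

Lemma eq_Ck_on k U f g : open U -> (forall q, U q -> f q = g q) ->
  Ck_on k U f -> Ck_on k U g.
Proof.
move=> oU; elim: k f g => [|k IH] f g fg [cf df]; split => //.
- by move=> p Up; exact: eq_on_continuous fg (cf p Up).
- by move=> p Up; exact: eq_on_continuous fg (cf p Up).
- move=> i; have [d dk] := df i; split.
    by move=> p Up; apply: near_eq_derivable (d p Up); exact: eq_on_near fg.
  exact: IH (eq_on_partial oU fg i) dk.
Qed.

Lemma Ck_on_C1 k U f : Ck_on k.+2 U f -> C1on U f.
Proof.
by move=> [cf df] p Up i; have [d [c _]] := df i; split; [exact: d|exact: c].
Qed.

Lemma Ck_onD k U f g : open U ->
  Ck_on k U f -> Ck_on k U g -> Ck_on k U (fun p => f p + g p).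
Proof.
move=> oU; elim: k f g => [|k IH] f g [cf df] [cg dg]; split => //.
- by move=> p Up; exact: (cvgD (cf p Up) (cg p Up)).
- by move=> p Up; exact: (cvgD (cf p Up) (cg p Up)).
- move=> i; have [d1 k1] := df i; have [d2 k2] := dg i; split.
    by move=> p Up; apply: derivableD; [exact: d1|exact: d2].
  apply: eq_Ck_on (IH _ _ k1 k2) => // p Up.
  by rewrite /partial deriveD //; [exact: d1|exact: d2].
Qed.

Lemma Ck_onM k U f g : open U ->
  Ck_on k U f -> Ck_on k U g -> Ck_on k U (fun p => f p * g p).
Proof.
move=> oU; elim: k f g => [|k IH] f g Cf Cg.
  by case: Cf Cg => [cf _] [cg _]; split=> // p Up; exact: (cvgM (cf p Up) (cg p Up)).
have Cf' := Ck_onS Cf; have Cg' := Ck_onS Cg.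
case: Cf => cf df; case: Cg => cg dg; split.
  by move=> p Up; exact: (cvgM (cf p Up) (cg p Up)).
move=> i; have [d1 k1] := df i; have [d2 k2] := dg i; split.
  by move=> p Up; apply: derivableM; [exact: d1|exact: d2].
apply: eq_Ck_on (Ck_onD oU (IH _ _ Cf' k2) (IH _ _ Cg' k1)) => // p Up.
by rewrite /partial deriveM //; [exact: d1|exact: d2].
Qed.

Lemma Ck_on_cst k U (c : R) : open U -> Ck_on k U (fun=> c).
Proof.
move=> oU; elim: k c => [|k IH] c; split=> //.
- by move=> p _; exact: cst_continuous.
- by move=> p _; exact: cst_continuous.
- move=> i; split; first by move=> p _; exact: derivable_cst.
  by apply: eq_Ck_on (IH 0) => // p _; rewrite /partial derive_cst.
Qed.

Lemma smooth_onD U f g : open U -> smooth_on U f -> smooth_on U g ->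
  smooth_on U (fun p => f p + g p).
Proof. by move=> oU sf sg k; exact: Ck_onD. Qed.

Lemma smooth_onM U f g : open U -> smooth_on U f -> smooth_on U g ->
  smooth_on U (fun p => f p * g p).
Proof. by move=> oU sf sg k; exact: Ck_onM. Qed.

Lemma smooth_on_cst U (c : R) : open U -> smooth_on U (fun=> c).
Proof. by move=> oU k; exact: Ck_on_cst. Qed.

Lemma eq_smooth_on U f g : open U -> (forall q, U q -> f q = g q) ->
  smooth_on U f -> smooth_on U g.
Proof. by move=> oU fg sf k; exact: eq_Ck_on (sf k). Qed.

Lemma smooth_onN U f : open U -> smooth_on U f -> smooth_on U (fun p => - f p).
Proof.
move=> oU sf; apply: eq_smooth_on (smooth_onM oU (smooth_on_cst (-1) oU) sf) => //.
by move=> p _; rewrite mulN1r.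
Qed.

Lemma smooth_onB U f g : open U -> smooth_on U f -> smooth_on U g ->
  smooth_on U (fun p => f p - g p).
Proof. by move=> oU sf sg; apply: smooth_onD => //; exact: smooth_onN. Qed.

Lemma smooth_on_sum U (I : Type) (s : seq I) (F : I -> C2 R -> R) : open U ->
  (forall i, smooth_on U (F i)) -> smooth_on U (fun p => \sum_(i <- s) F i p).
Proof.
move=> oU sF; elim: s => [|i s IH].
  by apply: eq_smooth_on (smooth_on_cst 0 oU) => // p _; rewrite big_nil.
apply: eq_smooth_on (smooth_onD oU (sF i) IH) => // p _.
by rewrite big_cons.
Qed.

Lemma smooth_on_sub U V f : V `<=` U -> smooth_on U f -> smooth_on V f.
Proof. by move=> VU sf k; exact: Ck_on_sub (sf k). Qed.

(** Continuity and derivability at a point already refer to full neighborhoods of it, so smoothness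
    glues along any cover. *)
Lemma smooth_on_local U f :
  (forall p, U p -> exists2 V, V p & smooth_on V f) -> smooth_on U f.
Proof.
move=> H k; have {}H p : U p -> exists2 V, V p & Ck_on k V f.
  by move=> /H[V Vp /(_ k)]; exists V.
elim: k f H => [|k IH] f H; split=> //.
- by move=> p /H[V Vp [cf _]]; exact: cf.
- by move=> p /H[V Vp [cf _]]; exact: cf.
- move=> i; split; first by move=> p /H[V Vp [_ /(_ i)[df _]]]; exact: df.
  by apply: IH => p /H[V Vp [_ /(_ i)[_ df]]]; exists V.
Qed.

Lemma smooth_on_partial U f i : smooth_on U f -> smooth_on U (partial i f).
Proof. by move=> sf k; have [_ /(_ i)[]] := sf k.+1. Qed.

Lemma smooth_on_continuous U f p : smooth_on U f -> U p -> {for p, continuous f}.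
Proof. by move=> sf Up; have [cf _] := sf 0%N; exact: cf. Qed.

Lemma smooth_on_C1 U f : smooth_on U f -> C1on U f.
Proof. by move=> sf; exact: Ck_on_C1 (sf 2%N). Qed.

Lemma smooth_on_differentiable U f p : open U -> smooth_on U f -> U p ->
  differentiable f p.
Proof. by move=> oU /smooth_on_C1 sf Up; have [] := C1_differentiable oU sf Up. Qed.

Lemma smooth_on_derive U f p v : open U -> smooth_on U f -> U p ->
  'D_v f p = dmap f p v.
Proof.
move=> oU sf Up; rewrite deriveE; last exact: smooth_on_differentiable sf Up.
by have [_ ->] := C1_differentiable oU (smooth_on_C1 sf) Up.
Qed.

Lemma smooth_on_is_derive U f p v : open U -> smooth_on U f -> U p ->
  is_derive p v f (dmap f p v).
Proof.
move=> oU sf Up; split; last exact: smooth_on_derive sf Up.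
by apply: diff_derivable; exact: smooth_on_differentiable sf Up.
Qed.

Lemma smooth_on_coord U (i : 'I_(2 + 2)) : open U -> smooth_on U (fun p => p 0 i).
Proof.
move=> oU; have dp v p : is_derive p v (fun p : C2 R => p 0 i) (v 0 i).
  have E : (fun h : R => h^-1 *: (((fun p : C2 R => p 0 i) \o shift p) (h *: v) - p 0 i))
     @ 0^' --> v 0 i.
    apply: cvg_trans (@cvg_cst _ (v 0 i) _ ((0:R)^') _); apply: near_eq_cvg; near=> h.
    rewrite /= !mxE addrK; apply/esym; rewrite /GRing.scale /= mulKf //.
    by near: h; exact: nbhs_dnbhs_neq.
  by split; [apply/cvg_ex; exists (v 0 i)|exact: cvg_lim E].
have pc : forall p, U p -> {for p, continuous (fun p : C2 R => p 0 i)}.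
  by move=> p _; exact: coord_continuous.
case=> [|k]; split=> // j; split; first by move=> p _; exact: ex_derive.
apply: eq_Ck_on (Ck_on_cst k (Defs.basis R j 0 i) oU) => // p _.
by rewrite /partial derive_val.
Unshelve. all: by end_near. Qed.

Lemma is_derive_comp_dmap U f p v (phi : R -> R) (d : R) :
  open U -> smooth_on U f -> U p -> is_derive (f p) 1 phi d ->
  is_derive p v (fun q => phi (f q)) (d * dmap f p v).
Proof.
move=> oU sf Up dphi; have dfp := smooth_on_differentiable oU sf Up.
have dphi' : differentiable phi (f p) by apply/derivable1_diffP.
have dc : differentiable (phi \o f) p by exact: differentiable_comp.
split; first exact: diff_derivable.
rewrite (_ : (fun q => phi (f q)) = phi \o f) // deriveE // diff_comp //=.
have [_ ->] := C1_differentiable oU (smooth_on_C1 sf) Up.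
by rewrite -[dmap f p v]mulr1 [LHS]linearZ /= -deriveE // derive_val mulr1 mulrC.
Qed.

(** Smoothness of a one-variable function, encoded by a family in which each derivative is a linear
    combination of two members. An induction over the whole family then gives smoothness of
    compositions. Two members are what [flat] requires; [D] is the range on which the derivatives
    exist. *)
Definition derive_closed (D : set R) (S : set (R -> R)) := forall phi, S phi ->
  exists phi1 phi2 (a b : R), [/\ S phi1, S phi2 &
    forall x, D x -> is_derive x 1 phi (a * phi1 x + b * phi2 x)].

Lemma smooth_on_comp D S U f (phi : R -> R) : open U -> derive_closed D S ->
  S phi -> smooth_on U f -> (forall p, U p -> D (f p)) ->
  smooth_on U (fun p => phi (f p)).
Proof.
move=> oU SD Sphi sf fD k.
have cphi psi : S psi -> forall p, U p -> {for p, continuous (fun q => psi (f q))}.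
  move=> /SD[p1 [p2 [a [b [_ _ dpsi]]]]] p Up.
  apply: (@continuous_comp _ _ _ f psi); first exact: smooth_on_continuous sf Up.
  apply: differentiable_continuous; apply/derivable1_diffP.
  by have [] := dpsi _ (fD _ Up).
elim: k phi Sphi => [|k IH] phi Sphi; first by split => //; exact: cphi.
split=> [|i]; first exact: cphi.
have [p1 [p2 [a [b [S1 S2 dphi]]]]] := SD _ Sphi.
have dc p : U p -> is_derive p (Defs.basis R i) (fun q => phi (f q))
    ((a * p1 (f p) + b * p2 (f p)) * partial i f p).
  move=> Up; have := is_derive_comp_dmap (Defs.basis R i) oU sf Up (dphi _ (fD _ Up)).
  by rewrite /partial (smooth_on_derive _ oU sf Up).
split; first by move=> p /dc[].
have s1 := Ck_onM oU (Ck_on_cst k a oU) (IH _ S1).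
have s2 := Ck_onM oU (Ck_on_cst k b oU) (IH _ S2).
have := Ck_onM oU (Ck_onD oU s1 s2) (smooth_on_partial i sf k).
by apply: eq_Ck_on => // p /dc[_ <-].
Qed.

Lemma dmapD f p u v : dmap f p (u + v) = dmap f p u + dmap f p v.
Proof. by rewrite -[u in LHS]scale1r (@dmap_linear f p 1 u v) scale1r. Qed.

Lemma dmapZ f p (a : R) v : dmap f p (a *: v) = a * dmap f p v.
Proof.
by rewrite /dmap mulr_sumr; apply: eq_bigr => i _; rewrite mxE mulrA.
Qed.

Lemma dmap_basis f p i : dmap f p (Defs.basis R i) = partial i f p.
Proof.
rewrite /dmap (bigD1 i) //= big1 ?addr0 => [|j ji].
  by rewrite mxE !eqxx mul1r.
by rewrite mxE (negPf ji) andbF mul0r.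
Qed.

Lemma norm_basis i : `|Defs.basis R i| <= 1.
Proof.
apply: norm_le_coord => // j; rewrite mxE.
by case: (_ && _); rewrite ?normr0 ?normr1.
Qed.

(** The mean value theorem in direction [i], applied to the increment in direction [j], leaves a
    difference of two values of [partial i f], which its first order expansion at [p] evaluates. *)
Lemma second_difference U f p i j : open U -> smooth_on U f -> U p ->
  forall e : R, 0 < e -> \forall s \near (0 : R)^'+,
   `|f (p + s *: Defs.basis R i + s *: Defs.basis R j) - f (p + s *: Defs.basis R i)
     - f (p + s *: Defs.basis R j) + f p - s ^+ 2 * partial j (partial i f) p| <= e * s ^+ 2.
Proof.
move=> oU sf Up e e0; set g := partial i f.
have sg : smooth_on U g by exact: smooth_on_partial.
(* The expansion is used at the displacements (c, s) and (c, 0) with c < s; the errors add up to e /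
   3 * (2 c + s), at most e s. *)
have e3 : 0 < e / 3 by rewrite divr_gt0.
have Ex := C1_expansion oU (smooth_on_C1 sg) Up e3.
have nU : \forall v \near (0 : C2 R), U (p + v).
  have : \forall q \near p, U q by exact: open_nbhs_nbhs.
  move=> /nbhs_ballP[d d0 Hd]; apply/nbhs_ballP; exists d => //= v.
  rewrite -ball_normE /= sub0r normrN => vd; apply: Hd.
  by rewrite -ball_normE /= opprD addrA subrr sub0r normrN.
have := (nbhs_ballP (0 : C2 R) _).1 (filterI Ex nU).
case=> d /= d0 Hd.
near=> s.
have s0 : 0 < s by near: s; exact: nbhs_right_gt.
have sd : s < d / 2 by near: s; apply: nbhs_right_lt; rewrite divr_gt0.
have small (t b : R) : 0 <= t <= s -> 0 <= b <= s ->
   `|t *: Defs.basis R i + b *: Defs.basis R j| <= t + b.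
  move=> /andP[t0 ts] /andP[b0 bs]; apply: le_trans (ler_normD _ _) _.
  by rewrite !normrZ !ger0_norm // lerD // ler_piMr // norm_basis.
have {}Hd (t b : R) : 0 <= t <= s -> 0 <= b <= s ->
   `|g (p + t *: Defs.basis R i + b *: Defs.basis R j) - g p
      - (t * partial i g p + b * partial j g p)| <= e / 3 * (t + b) /\
   U (p + t *: Defs.basis R i + b *: Defs.basis R j).
  move=> ts bs; have sm := small _ _ ts bs.
  have [|Ha Ub] := Hd (t *: Defs.basis R i + b *: Defs.basis R j).
    rewrite -ball_normE /= sub0r normrN (le_lt_trans sm) //.
    by move: ts bs => /andP[_ ?] /andP[_ ?]; lra.
  rewrite -[p + _ + _]addrA; split=> //; apply: le_trans (ler_wpM2l (ltW e3) sm).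
  by move: Ha; rewrite -/(dmap g p _) dmapD !dmapZ !dmap_basis.
pose G t := f (p + s *: Defs.basis R j + t *: Defs.basis R i) - f (p + t *: Defs.basis R i).
have ss : 0 <= s <= s by rewrite lexx ltW.
have zs : 0 <= (0 : R) <= s by rewrite lexx ltW.
have dG t : 0 <= t <= s -> is_derive t 1 G
   (g (p + t *: Defs.basis R i + s *: Defs.basis R j) - g (p + t *: Defs.basis R i)).
  move=> ts; have [_ U1] := Hd _ _ ts ss; have [_ U2] := Hd _ _ ts zs.
  rewrite scale0r addr0 in U2; rewrite addrAC in U1 *.
  have D1 := (smooth_on_C1 sf U1 i).1; have D2 := (smooth_on_C1 sf U2 i).1.
  exact: (is_deriveB (is_derive_line D1) (is_derive_line D2)).
have [||c] := @MVT R G (fun t =>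
    g (p + t *: Defs.basis R i + s *: Defs.basis R j) - g (p + t *: Defs.basis R i)) 0 s s0.
- by move=> t; rewrite in_itv /= => /andP[t0 ts]; apply: dG; rewrite !ltW.
- apply: derivable_within_continuous => t; rewrite in_itv /= => ts.
  by have [] := dG t ts.
rewrite in_itv /= subr0 => /andP[c0 cs].
rewrite /G !scale0r !addr0 => E.
have cs' : 0 <= c <= s by rewrite !ltW.
have [H1 _] := Hd _ _ cs' ss; have [H2 _] := Hd _ _ cs' zs.
rewrite scale0r addr0 mul0r !addr0 in H2.
rewrite [p + _ + _]addrAC (_ : _ + f p = f (p + s *: Defs.basis R j + s *: Defs.basis R i) -
     f (p + s *: Defs.basis R i) - (f (p + s *: Defs.basis R j) - f p)); last by ring.
rewrite E expr2 -mulrA [s * _]mulrC -mulrBl mulrA normrM (gtr0_norm s0) ler_pM2r //.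
move: H1 H2; set x1 := g (_ + _ + _); set x2 := g (_ + _).
move: (partial i g p) (partial j g p) (g p) x1 x2 => gi gj gp x1 x2 H1 H2.
rewrite (_ : _ - _ = (x1 - gp - (c * gi + s * gj)) - (x2 - gp - c * gi)); last by ring.
apply: le_trans (ler_normB _ _) _; apply: le_trans (lerD H1 H2) _.
have := mulr_ge0 (ltW e3) (ltW s0); have : e / 3 * c <= e / 3 * s by rewrite ler_pM2l // ltW.
lra.
Unshelve. all: by end_near. Qed.

(** Schwarz: the second difference with equal steps is symmetric in [i] and [j], and both mixed
    derivatives are its limit after division by s^2. *)
Lemma partialC U f p i j : open U -> smooth_on U f -> U p ->
  partial i (partial j f) p = partial j (partial i f) p.
Proof.
move=> oU sf Up; apply/eqP; rewrite -subr_eq0 -normr_eq0 eq_le normr_ge0 andbT; apply/ler_addgt0Pr => e e0; rewrite add0r.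
have e2 : 0 < e / 2 by rewrite divr_gt0.
have := filter_ex (filterI (filterI (second_difference i j oU sf Up e2)
  (second_difference j i oU sf Up e2)) (nbhs_right_gt (0 : R))).
case=> s [[H1 H2] s0'].
have s0 : 0 < s ^+ 2 by rewrite exprn_gt0.
rewrite -(ler_pM2r s0) -[X in _ * X <= _](gtr0_norm s0) -normrM.
set x := f (p + _ + _) in H1; have xE : f (p + s *: Defs.basis R j + s *: Defs.basis R i) = x.
  by rewrite addrAC.
rewrite xE in H2; move: H1 H2.
set a := f (p + _); set b := f (p + _); set d1 := partial j _ _; set d2 := partial i _ _.
move: x xE a b (f p) d1 d2 => x _ a b fp d1 d2 H1 H2.
rewrite (_ : (d2 - d1) * _ = (x - a - b + fp - s ^+ 2 * d1) -
   (x - b - a + fp - s ^+ 2 * d2)); last by ring.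
apply: le_trans (ler_normB _ _) _; apply: le_trans (lerD H1 H2) _; lra.
Qed.

End RealCalculus.

(** * Wirtinger derivatives *)

Section Wirtinger.
Variable R : realType.
Local Notation Re := (@complex.Re R).
Local Notation Im := (@complex.Im R).
Implicit Types (U : set (C2 R)) (f g : C2 R -> R) (F G : C2 R -> R[i]).
Implicit Types (p q : C2 R).

Lemma partialD U f g p i : open U -> smooth_on U f -> smooth_on U g -> U p ->
  partial i (fun q => f q + g q) p = partial i f p + partial i g p.
Proof.
by move=> oU /smooth_on_C1 sf /smooth_on_C1 sg Up; apply: deriveD; [exact: (sf p Up i).1|exact: (sg p Up i).1].
Qed.

Lemma partialM U f g p i : open U -> smooth_on U f -> smooth_on U g -> U p ->
  partial i (fun q => f q * g q) p = f p * partial i g p + g p * partial i f p.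
Proof.
by move=> oU /smooth_on_C1 sf /smooth_on_C1 sg Up; apply: deriveM; [exact: (sf p Up i).1|exact: (sg p Up i).1].
Qed.

Lemma partialN U f p i : open U -> smooth_on U f -> U p ->
  partial i (fun q => - f q) p = - partial i f p.
Proof.
by move=> oU /smooth_on_C1 sf Up; apply: deriveN; exact: (sf p Up i).1.
Qed.

Lemma cReM (a b : R[i]) : Re (a * b) = Re a * Re b - Im a * Im b.
Proof. by case: a; case: b. Qed.

Lemma cImM (a b : R[i]) : Im (a * b) = Re a * Im b + Im a * Re b.
Proof. by case: a; case: b. Qed.

Lemma cReD (a b : R[i]) : Re (a + b) = Re a + Re b.
Proof. by case: a; case: b. Qed.

Lemma cImD (a b : R[i]) : Im (a + b) = Im a + Im b.
Proof. by case: a; case: b. Qed.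

Lemma cReN (a : R[i]) : Re (- a) = - Re a.
Proof. by case: a. Qed.

Lemma cImN (a : R[i]) : Im (- a) = - Im a.
Proof. by case: a. Qed.

Lemma cReJ (a : R[i]) : Re (Num.conj a) = Re a.
Proof. by case: a. Qed.

Lemma cImJ (a : R[i]) : Im (Num.conj a) = - Im a.
Proof. by case: a. Qed.

Lemma eq_ReIm (a b : R[i]) : Re a = Re b -> Im a = Im b -> a = b.
Proof. by case: a => ? ?; case: b => ? ? /= -> ->. Qed.

Lemma conj_D (a b : R[i]) : Num.conj (a + b) = Num.conj a + Num.conj b.
Proof. exact: rmorphD. Qed.

Lemma conj_M (a b : R[i]) : Num.conj (a * b) = Num.conj a * Num.conj b.
Proof. exact: rmorphM. Qed.

Lemma conj_N (a : R[i]) : Num.conj (- a) = - Num.conj a.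
Proof. exact: rmorphN. Qed.

Lemma conj_K (a : R[i]) : Num.conj (Num.conj a) = a.
Proof. exact: conjCK. Qed.

Lemma conj_real (a : R) : Num.conj (a%:C : R[i]) = a%:C.
Proof. by apply: eq_ReIm => //=; rewrite oppr0. Qed.

Definition conj_simp := (conj_D, conj_M, conj_N, conj_K, conj_real).

Definition csmooth U F :=
  smooth_on U (fun p => Re (F p)) /\ smooth_on U (fun p => Im (F p)).

Lemma csmoothD U F G : open U -> csmooth U F -> csmooth U G ->
  csmooth U (fun p => F p + G p).
Proof.
move=> oU [fr fi] [gr gi]; split.
- by apply: eq_smooth_on (smooth_onD oU fr gr) => // q _; rewrite cReD.
- by apply: eq_smooth_on (smooth_onD oU fi gi) => // q _; rewrite cImD.
Qed.

Lemma csmoothN U F : open U -> csmooth U F -> csmooth U (fun p => - F p).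
Proof.
move=> oU [fr fi]; split.
- by apply: eq_smooth_on (smooth_onN oU fr) => // q _; rewrite cReN.
- by apply: eq_smooth_on (smooth_onN oU fi) => // q _; rewrite cImN.
Qed.

Lemma csmoothM U F G : open U -> csmooth U F -> csmooth U G ->
  csmooth U (fun p => F p * G p).
Proof.
move=> oU [fr fi] [gr gi]; split.
- apply: eq_smooth_on (smooth_onB oU (smooth_onM oU fr gr) (smooth_onM oU fi gi)) => // q _.
  by rewrite cReM.
- apply: eq_smooth_on (smooth_onD oU (smooth_onM oU fr gi) (smooth_onM oU fi gr)) => // q _.
  by rewrite cImM.
Qed.

Lemma csmoothJ U F : open U -> csmooth U F -> csmooth U (fun p => Num.conj (F p)).
Proof.
move=> oU [fr fi]; split.
- by apply: eq_smooth_on fr => // q _; rewrite cReJ.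
- by apply: eq_smooth_on (smooth_onN oU fi) => // q _; rewrite cImJ.
Qed.

Lemma csmooth_cst U (c : R[i]) : open U -> csmooth U (fun=> c).
Proof. by move=> oU; split; exact: smooth_on_cst. Qed.

Lemma csmooth_toC U f : open U -> smooth_on U f -> csmooth U (toC f).
Proof. by move=> oU sf; split => //=; exact: smooth_on_cst. Qed.

Lemma csmooth_cpartial U F i : open U -> csmooth U F -> csmooth U (cpartial i F).
Proof. by move=> oU [fr fi]; split => /=; exact: smooth_on_partial. Qed.

Lemma eq_cpartial U F G i p : open U -> U p -> (forall q, U q -> F q = G q) ->
  cpartial i F p = cpartial i G p.
Proof.
move=> oU Up FG; rewrite /cpartial; congr (_ +i* _); apply: (eq_on_partial oU) => // q /FG ->; done.
Qed.

Lemma cpartialD U F G i p : open U -> csmooth U F -> csmooth U G -> U p ->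
  cpartial i (fun q => F q + G q) p = cpartial i F p + cpartial i G p.
Proof.
move=> oU [fr fi] [gr gi] Up; apply: eq_ReIm; rewrite ?cReD ?cImD /= -(partialD _ oU) //;
  by apply: (eq_on_partial oU) => // q _; rewrite ?cReD ?cImD.
Qed.

Lemma cpartialN U F i p : open U -> csmooth U F -> U p ->
  cpartial i (fun q => - F q) p = - cpartial i F p.
Proof.
move=> oU [fr fi] Up; apply: eq_ReIm; rewrite ?cReN ?cImN /= -(partialN _ oU) //;
  by apply: (eq_on_partial oU) => // q _; rewrite ?cReN ?cImN.
Qed.

Lemma cpartialJ U F i p : open U -> csmooth U F -> U p ->
  cpartial i (fun q => Num.conj (F q)) p = Num.conj (cpartial i F p).
Proof.
move=> oU [fr fi] Up; apply: eq_ReIm; rewrite ?cReJ ?cImJ /= -?(partialN _ oU fi) //;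
  by apply: (eq_on_partial oU) => // q _; rewrite ?cReJ ?cImJ.
Qed.

Lemma cpartialM U F G i p : open U -> csmooth U F -> csmooth U G -> U p ->
  cpartial i (fun q => F q * G q) p = F p * cpartial i G p + G p * cpartial i F p.
Proof.
move=> oU [fr fi] [gr gi] Up; apply: eq_ReIm; rewrite ?cReD ?cImD ?cReM ?cImM /=.
- transitivity (partial i (fun q => Re (F q) * Re (G q) + - (Im (F q) * Im (G q))) p).
    by apply: (eq_on_partial oU) => // q _; rewrite cReM.
  have s1 := smooth_onM oU fr gr; have s2 := smooth_onM oU fi gi.
  have s3 := smooth_onN oU s2.
  rewrite (partialD _ oU) // (partialN _ oU s2) // !(partialM _ oU) //; ring.
- transitivity (partial i (fun q => Re (F q) * Im (G q) + Im (F q) * Re (G q)) p).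
    by apply: (eq_on_partial oU) => // q _; rewrite cImM.
  have s1 := smooth_onM oU fr gi; have s2 := smooth_onM oU fi gr.
  rewrite (partialD _ oU) // !(partialM _ oU) //; ring.
Qed.

Lemma cpartial_cst (c : R[i]) i p : cpartial i (fun=> c) p = 0.
Proof. by rewrite /cpartial /partial !derive_cst. Qed.

Lemma cpartialC U F i j p : open U -> csmooth U F -> U p ->
  cpartial i (cpartial j F) p = cpartial j (cpartial i F) p.
Proof.
move=> oU [fr fi] Up; rewrite /cpartial /=.
by rewrite (partialC _ _ oU fr Up) (partialC _ _ oU fi Up).
Qed.

Let I : R[i] := 0 +i* 1.

Let dzE j F : dz j F = fun p => (cpartial (xdir j) F p + - I * cpartial (ydir j) F p) * 2^-1.
Proof. by apply/funext => p; rewrite /dz mulNr. Qed.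

Let dzbarE j F : dzbar j F = fun p => (cpartial (xdir j) F p + I * cpartial (ydir j) F p) * 2^-1.
Proof. by []. Qed.

Let csmooth_lin U F G (a b : R[i]) : open U -> csmooth U F -> csmooth U G ->
  csmooth U (fun p => (F p + a * G p) * b).
Proof.
move=> oU sF sG; have saG := csmoothM oU (csmooth_cst a oU) sG.
exact: (csmoothM oU (csmoothD oU sF saG) (csmooth_cst b oU)).
Qed.

Lemma csmooth_dz U F j : open U -> csmooth U F -> csmooth U (dz j F).
Proof.
move=> oU sF; rewrite dzE.
exact: (csmooth_lin _ _ oU (csmooth_cpartial _ oU sF) (csmooth_cpartial _ oU sF)).
Qed.

Lemma csmooth_dzbar U F j : open U -> csmooth U F -> csmooth U (dzbar j F).
Proof.
move=> oU sF; rewrite dzbarE.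
exact: (csmooth_lin _ _ oU (csmooth_cpartial _ oU sF) (csmooth_cpartial _ oU sF)).
Qed.

Lemma eq_dz U F G j p : open U -> U p -> (forall q, U q -> F q = G q) ->
  dz j F p = dz j G p.
Proof. by move=> oU Up FG; rewrite /dz !(eq_cpartial _ oU Up FG). Qed.

Lemma eq_dzbar U F G j p : open U -> U p -> (forall q, U q -> F q = G q) ->
  dzbar j F p = dzbar j G p.
Proof. by move=> oU Up FG; rewrite /dzbar !(eq_cpartial _ oU Up FG). Qed.

Lemma dzD U F G j p : open U -> csmooth U F -> csmooth U G -> U p ->
  dz j (fun q => F q + G q) p = dz j F p + dz j G p.
Proof. move=> oU sF sG Up; rewrite /dz !(cpartialD _ oU sF sG Up) -/I.
move: (cpartial (xdir j) F p) (cpartial (ydir j) F p) (cpartial (xdir j) G p) (cpartial (ydir j) G p) (F p) (G p) => *; ring. Qed.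

Lemma dzbarD U F G j p : open U -> csmooth U F -> csmooth U G -> U p ->
  dzbar j (fun q => F q + G q) p = dzbar j F p + dzbar j G p.
Proof. move=> oU sF sG Up; rewrite /dzbar !(cpartialD _ oU sF sG Up) -/I.
move: (cpartial (xdir j) F p) (cpartial (ydir j) F p) (cpartial (xdir j) G p) (cpartial (ydir j) G p) (F p) (G p) => *; ring. Qed.

Lemma dzN U F j p : open U -> csmooth U F -> U p ->
  dz j (fun q => - F q) p = - dz j F p.
Proof. move=> oU sF Up; rewrite /dz !(cpartialN _ oU sF Up) -/I.
move: (cpartial (xdir j) F p) (cpartial (ydir j) F p) => *; ring. Qed.

Lemma dzbarN U F j p : open U -> csmooth U F -> U p ->
  dzbar j (fun q => - F q) p = - dzbar j F p.
Proof. move=> oU sF Up; rewrite /dzbar !(cpartialN _ oU sF Up) -/I.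
move: (cpartial (xdir j) F p) (cpartial (ydir j) F p) => *; ring. Qed.

Lemma dzM U F G j p : open U -> csmooth U F -> csmooth U G -> U p ->
  dz j (fun q => F q * G q) p = F p * dz j G p + G p * dz j F p.
Proof. move=> oU sF sG Up; rewrite /dz !(cpartialM _ oU sF sG Up) -/I.
move: (cpartial (xdir j) F p) (cpartial (ydir j) F p) (cpartial (xdir j) G p) (cpartial (ydir j) G p) (F p) (G p) => *; ring. Qed.

Lemma dzbarM U F G j p : open U -> csmooth U F -> csmooth U G -> U p ->
  dzbar j (fun q => F q * G q) p = F p * dzbar j G p + G p * dzbar j F p.
Proof. move=> oU sF sG Up; rewrite /dzbar !(cpartialM _ oU sF sG Up) -/I.
move: (cpartial (xdir j) F p) (cpartial (ydir j) F p) (cpartial (xdir j) G p) (cpartial (ydir j) G p) (F p) (G p) => *; ring. Qed.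

Lemma dz_cst (c : R[i]) j p : dz j (fun=> c) p = 0.
Proof. by rewrite /dz !cpartial_cst mulr0 subr0 mul0r. Qed.

Lemma dzbar_cst (c : R[i]) j p : dzbar j (fun=> c) p = 0.
Proof. by rewrite /dzbar !cpartial_cst mulr0 addr0 mul0r. Qed.

Let conjI : Num.conj I = - I.
Proof. by apply: eq_ReIm => //=; rewrite oppr0. Qed.

Let conj2 : Num.conj (2^-1 : R[i]) = 2^-1.
Proof. by rewrite fmorphV rmorph_nat. Qed.

Lemma dzJ U F j p : open U -> csmooth U F -> U p ->
  dz j (fun q => Num.conj (F q)) p = Num.conj (dzbar j F p).
Proof.
move=> oU sF Up; rewrite /dz /dzbar !(cpartialJ _ oU sF Up) -/I.
by rewrite !conj_simp conjI conj2 mulNr.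
Qed.

Lemma dzbarJ U F j p : open U -> csmooth U F -> U p ->
  dzbar j (fun q => Num.conj (F q)) p = Num.conj (dz j F p).
Proof.
move=> oU sF Up; rewrite /dz /dzbar !(cpartialJ _ oU sF Up) -/I.
by rewrite !conj_simp conjI conj2 mulNr opprK.
Qed.

Let cpartial_lin U F G (a b : R[i]) i p : open U -> csmooth U F -> csmooth U G -> U p ->
  cpartial i (fun q => (F q + a * G q) * b) p = (cpartial i F p + a * cpartial i G p) * b.
Proof.
move=> oU sF sG Up; have sa := csmooth_cst a oU; have sb := csmooth_cst b oU.
have saG := csmoothM oU sa sG.
rewrite (cpartialM _ oU (csmoothD oU sF saG) sb Up) cpartial_cst mulr0 add0r.
by rewrite (cpartialD _ oU sF saG Up) (cpartialM _ oU sa sG Up) cpartial_cst mulr0 addr0 mulrC.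
Qed.

Lemma dz_dzbarC U F j k p : open U -> csmooth U F -> U p ->
  dz j (dzbar k F) p = dzbar k (dz j F) p.
Proof.
move=> oU sF Up; have sc i := csmooth_cpartial i oU sF.
have E1 i := cpartial_lin I 2^-1 i oU (sc (xdir k)) (sc (ydir k)) Up.
have E2 i := cpartial_lin (- I) 2^-1 i oU (sc (xdir j)) (sc (ydir j)) Up.
rewrite -dzbarE in E1; rewrite -dzE in E2.
rewrite [LHS]/dz [RHS]/dzbar (E1 (xdir j)) (E1 (ydir j)) (E2 (xdir k)) (E2 (ydir k)) -/I.
have C a b := cpartialC a b oU sF Up.
rewrite (C (ydir k) (xdir j)) (C (ydir k) (ydir j)) (C (xdir k) (xdir j)) (C (xdir k) (ydir j)).
move: (cpartial (xdir j) _ p) (cpartial (xdir j) _ p) (cpartial (ydir j) _ p) (cpartial (ydir j) _ p).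
by move=> *; ring.
Qed.

Lemma dzbar_dzbarC U F j k p : open U -> csmooth U F -> U p ->
  dzbar j (dzbar k F) p = dzbar k (dzbar j F) p.
Proof.
move=> oU sF Up; have sc i := csmooth_cpartial i oU sF.
have E1 i := cpartial_lin I 2^-1 i oU (sc (xdir k)) (sc (ydir k)) Up.
have E2 i := cpartial_lin I 2^-1 i oU (sc (xdir j)) (sc (ydir j)) Up.
rewrite -dzbarE in E1; rewrite -dzbarE in E2.
rewrite [LHS]/dzbar [RHS]/dzbar (E1 (xdir j)) (E1 (ydir j)) (E2 (xdir k)) (E2 (ydir k)) -/I.
have C a b := cpartialC a b oU sF Up.
rewrite (C (ydir k) (xdir j)) (C (ydir k) (ydir j)) (C (xdir k) (xdir j)) (C (xdir k) (ydir j)).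
move: (cpartial (xdir j) _ p) (cpartial (xdir j) _ p) (cpartial (ydir j) _ p) (cpartial (ydir j) _ p).
by move=> *; ring.
Qed.

Lemma dz_toC_conj f j p : Num.conj (dz j (toC f) p) = dzbar j (toC f) p.
Proof.
have H i : Num.conj (cpartial i (toC f) p) = cpartial i (toC f) p.
  by apply: eq_ReIm => //=; rewrite /partial derive_cst oppr0.
by rewrite /dz /dzbar !conj_simp !H conjI conj2 mulNr opprK.
Qed.

End Wirtinger.

(** * The sub-mean-value inequality *)

Lemma is_derive_curve (R : realType) (U : set (C2 R)) (f : C2 R -> R) (a A B : C2 R)
    (x y : R -> R) (dx dy s : R) :
  open U -> smooth_on U f -> U (a + x s *: A + y s *: B) ->
  is_derive s 1 x dx -> is_derive s 1 y dy ->
  is_derive s 1 (fun s => f (a + x s *: A + y s *: B))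
   (dx * dmap f (a + x s *: A + y s *: B) A + dy * dmap f (a + x s *: A + y s *: B) B).
Proof.
move=> oU sf Us dxs dys.
have Dx : differentiable x s by apply/derivable1_diffP.
have Dy : differentiable y s by apply/derivable1_diffP.
have dscale (u : R -> R) (C : C2 R) du : differentiable u s -> is_derive s 1 u du ->
    is_derive s 1 (fun s => u s *: C) (du *: C).
  move=> Du dus; have DC : differentiable (fun s => u s *: C) s by exact: differentiableZl.
  split; first by apply: diff_derivable; exact: DC.
  by rewrite deriveE // diffZl // -deriveE // derive_val.
pose g : R -> C2 R := (cst a + (fun s => x s *: A)) + (fun s => y s *: B).
have dg : is_derive s 1 g (0 + dx *: A + dy *: B).
  exact: (is_deriveD (is_deriveD (is_derive_cst a s 1) (dscale _ A _ Dx dxs)) (dscale _ B _ Dy dys)).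
have Dg : differentiable g s by apply/derivable1_diffP; case: dg.
have [Df Ef] := C1_differentiable oU (smooth_on_C1 sf) Us.
have Dc : differentiable (f \o g) s by apply: differentiable_comp.
split; first by apply: diff_derivable; exact: Dc.
rewrite -[LHS]/('D_1 (f \o g) s) deriveE // diff_comp //= -[g s]/(a + x s *: A + y s *: B) Ef.
by rewrite -deriveE // derive_val add0r dmapD !dmapZ.
Qed.

(** * Integrals depending on a parameter *)

Section UnderIntegral.
Variable R : realType.
Implicit Types (G H : R -> R -> R).

Definition cont2 G := continuous (fun z : R * R => G z.1 z.2).

Lemma cont2D G H : cont2 G -> cont2 H -> cont2 (fun s t => G s t + H s t).
Proof. by move=> cG cH z; exact: (cvgD (cG z) (cH z)). Qed.

Lemma cont2M G H : cont2 G -> cont2 H -> cont2 (fun s t => G s t * H s t).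
Proof. by move=> cG cH z; exact: (cvgM (cG z) (cH z)). Qed.

Lemma cont2N G : cont2 G -> cont2 (fun s t => - G s t).
Proof. by move=> cG z; exact: (cvgN (cG z)). Qed.

Lemma cont2_fst (g : R -> R) : continuous g -> cont2 (fun s _ => g s).
Proof. by move=> cg z; apply: continuous_comp; [exact: cvg_fst|exact: cg]. Qed.

Lemma cont2_snd (g : R -> R) : continuous g -> cont2 (fun _ t => g t).
Proof. by move=> cg z; apply: continuous_comp; [exact: cvg_snd|exact: cg]. Qed.

Lemma cont2_smooth (U : set (C2 R)) (f : C2 R -> R) (a A B : C2 R) (x y : R -> R -> R) :
  smooth_on U f -> (forall s t, U (a + x s t *: A + y s t *: B)) ->
  cont2 x -> cont2 y -> cont2 (fun s t => f (a + x s t *: A + y s t *: B)).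
Proof.
move=> sf Ux cx cy z.
apply: (@continuous_comp _ _ _ (fun z : R * R => a + x z.1 z.2 *: A + y z.1 z.2 *: B) f).
  apply: cvgD; last exact: (cvgZr_tmp (cy z)).
  by apply: cvgD; [exact: cvg_cst|exact: (cvgZr_tmp (cx z))].
exact: smooth_on_continuous sf (Ux _ _).
Qed.

Lemma cont2_sect G s : cont2 G -> continuous (G s).
Proof.
move=> cG t; apply: (@continuous_comp _ _ _ (fun t => (s, t)) (fun z : R * R => G z.1 z.2)).
  exact: (cvg_pair (@cvg_cst _ s _ (nbhs t) _) (@cvg_id _ (nbhs t))).
exact: cG.
Qed.

Lemma cont2_integrable G s (T : R) : cont2 G ->
  (@lebesgue_measure R).-integrable `[0, T] (EFin \o G s).
Proof.
move=> cG; apply: continuous_compact_integrable; first exact: segment_compact.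
by apply: continuous_subspaceT; exact: cont2_sect.
Qed.

Definition intg (T : R) G (s : R) : R := \int[lebesgue_measure]_(t in `[0%R, T]) G s t.

Lemma cont2_bounded G (u v T : R) : cont2 G -> u <= v -> 0 <= T ->
  exists2 C : R, 0 <= C & forall s t, `[u, v]%classic s -> `[0, T]%classic t -> `|G s t| <= C.
Proof.
move=> cG uv T0.
have K : compact (`[u, v]%classic `*` `[0, T]%classic : set (R * R)).
  by apply: compact_setX; exact: segment_compact.
have [||[s0 t0] _ H] := @compact_EVT_max _ R (fun z : R * R => `|G z.1 z.2|) _ _ K.
- by exists (u, 0); split => /=; rewrite in_itv /= lexx ?uv ?T0.
- apply: continuous_subspaceT => z.
  by apply: continuous_comp; [exact: cG|exact: norm_continuous].
exists `|G s0 t0| => // s t us vt; apply: (H (s, t)).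
by apply/mem_set; split.
Qed.

Lemma is_derive_intg (T : R) G Gs : 0 <= T -> cont2 G -> cont2 Gs ->
  (forall s t : R, is_derive s 1 (G^~ t) (Gs s t)) ->
  forall s : R, is_derive s 1 (intg T G) (intg T Gs s).
Proof.
move=> T0 cG cGs dG s.
(* On the compact rectangle over [s - 1, s + 1] the derivative is bounded, and a constant is an
   integrable majorant on [0, T]. *)
have [|C C0 HC] := cont2_bounded cGs (_ : s - 1 <= s + 1) T0.
  by rewrite lerBlDr -addrA lerDl addr_ge0.
have Is : `]s - 1, s + 1[%classic s by rewrite /= in_itv /= ltrBlDr ltrDl ltr01.
pose mu := @lebesgue_measure R.
have intG x : `]s - 1, s + 1[%classic x -> mu.-integrable `[0, T] (EFin \o G x).
  by move=> _; exact: cont2_integrable.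
have derG x y : `]s - 1, s + 1[%classic x -> `[0, T]%classic y -> derivable (G ^~ y) x 1.
  by [].
have mI : measurable (`[0, T]%classic : set (measurableTypeR R)) by [].
have intC : mu.-integrable `[0, T] (EFin \o (fun=> C)).
  exact: (@cont2_integrable (fun _ _ => C) 0 T (@cst_continuous _ _ _)).
have pE : partial1of2 G = Gs.
  by apply/funext => x; apply/funext => t; rewrite partial1of2E derive_val.
have bG x y : `]s - 1, s + 1[%classic x -> `[0, T]%classic y -> `|partial1of2 G x y| <= C.
  by rewrite pE => xs; apply: HC; move: xs; exact: subset_itv_oo_cc.
have H := @cvg_differentiation_under_integral R _ _ mu G `[0, T] mI s (s - 1) (s + 1) Is
  intG derG (fun=> C) (fun=> C0) intC bG.
rewrite pE in H.
have E : (fun h => h^-1 *: ((intg T G \o shift s) (h *: 1) - intg T G s)) =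
  (fun h => h^-1 *: (intg T G (h + s) - intg T G s)).
  by apply/funext => h /=; rewrite [h%:A]mulr1.
split; rewrite /derivable /derive E; last exact: cvg_lim H.
by apply/cvg_ex; exists (intg T Gs s).
Qed.

Lemma intg_derive (T : R) G m (s : R) : 0 < T -> cont2 G -> cont2 m ->
  (forall t : R, is_derive t 1 (m s) (G s t)) -> intg T G s = m s T - m s 0.
Proof.
move=> T0 cG cm dm; rewrite /intg /Rintegral.
rewrite (@continuous_FTC2 _ (G s) (m s)) //.
- by apply: continuous_subspaceT; exact: cont2_sect.
- by split=> [t _||]; [|apply/cvg_at_right_filter; exact: cont2_sect
    |apply/cvg_at_left_filter; exact: cont2_sect].
- by move=> t _; rewrite derive1E derive_val.
Qed.

Lemma intgD T G H s : cont2 G -> cont2 H ->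
  intg T (fun s t => G s t + H s t) s = intg T G s + intg T H s.
Proof. by move=> cG cH; rewrite /intg RintegralD //; exact: cont2_integrable. Qed.

Lemma intgZ T (g : R -> R) G s : cont2 G ->
  intg T (fun s t => g s * G s t) s = g s * intg T G s.
Proof. by move=> cG; rewrite /intg RintegralZl //; exact: cont2_integrable. Qed.

Lemma intg_ge0 T G s : (forall t, 0 <= G s t) -> 0 <= intg T G s.
Proof. by move=> G0; apply: Rintegral_ge0. Qed.

Lemma eq_intg T G H s : (forall t, G s t = H s t) -> intg T G s = intg T H s.
Proof. by move=> GH; apply: eq_Rintegral => t _. Qed.

End UnderIntegral.

Lemma smooth_on_dmap (R : realType) (U : set (C2 R)) (f : C2 R -> R) (v : C2 R) :
  open U -> smooth_on U f -> smooth_on U (fun p => dmap f p v).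
Proof.
move=> oU sf; apply: smooth_on_sum => // i.
by apply: smooth_onM (smooth_on_cst _ oU) _ => //; exact: smooth_on_partial.
Qed.

(** * Circle means of a function with nonnegative Laplacian on a disc *)

Section SubMean.
Variables (R : realType) (U : set (C2 R)) (f : C2 R -> R) (a A B : C2 R).
Hypotheses (oU : open U) (sf : smooth_on U f).
Hypothesis disc : forall x y : R, x ^+ 2 + y ^+ 2 <= 1 -> U (a + x *: A + y *: B).
Let fA p := dmap f p A.
Let fB p := dmap f p B.
Hypothesis lap_ge0 : forall p, U p -> 0 <= dmap fA p A + dmap fB p B.

Let sA : smooth_on U fA. Proof. exact: smooth_on_dmap. Qed.
Let sB : smooth_on U fB. Proof. exact: smooth_on_dmap. Qed.

(** Polar coordinates with radius sin s. Only the closed unit disc is known to lie in [U], and this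
    radius stays in it for every real s, so that everything below is continuous and differentiable
    in (s, t) on the whole plane. The centre is s = 0, the unit circle s = pi / 2. *)
Let x (s t : R) := sin s * cos t.
Let y (s t : R) := sin s * sin t.
Let c s t := a + x s t *: A + y s t *: B.

Let cU s t : U (c s t).
Proof.
apply: disc; rewrite /x /y !exprMn -mulrDr cos2Dsin2 mulr1.
by rewrite -(cos2Dsin2 s) lerDr sqr_ge0.
Qed.

Let cx : cont2 x.
Proof. exact: (cont2M (cont2_fst (@continuous_sin R)) (cont2_snd (@continuous_cos R))). Qed.
Let cy : cont2 y.
Proof. exact: (cont2M (cont2_fst (@continuous_sin R)) (cont2_snd (@continuous_sin R))). Qed.
Let cc g : smooth_on U g -> cont2 (fun s t => g (c s t)).
Proof. by move=> sg; exact: cont2_smooth sg cU cx cy. Qed.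

Let dsx (s t : R) : is_derive s 1 (x^~ t) (cos s * cos t).
Proof. rewrite /x; apply: is_derive_eq; rewrite ?scaler0 /GRing.scale /=; ring. Qed.
Let dsy (s t : R) : is_derive s 1 (y^~ t) (cos s * sin t).
Proof. rewrite /y; apply: is_derive_eq; rewrite ?scaler0 /GRing.scale /=; ring. Qed.
Let dtx (s t : R) : is_derive t 1 (x s) (- y s t).
Proof. rewrite /x /y; apply: is_derive_eq; rewrite ?scaler0 /GRing.scale /=; ring. Qed.
Let dty (s t : R) : is_derive t 1 (y s) (x s t).
Proof. rewrite /x /y; apply: is_derive_eq; rewrite ?scaler0 /GRing.scale /=; ring. Qed.

Let dsg g (s t : R) : smooth_on U g -> is_derive s 1 (fun s => g (c s t))
  (cos s * cos t * dmap g (c s t) A + cos s * sin t * dmap g (c s t) B).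
Proof.
move=> sg.
exact: (@is_derive_curve R U g a A B (x^~ t) (y^~ t) _ _ s oU sg (cU s t) (dsx s t) (dsy s t)).
Qed.

Let dtg g (s t : R) : smooth_on U g -> is_derive t 1 (fun t => g (c s t))
  (- y s t * dmap g (c s t) A + x s t * dmap g (c s t) B).
Proof.
move=> sg.
exact: (@is_derive_curve R U g a A B (x s) (y s) _ _ t oU sg (cU s t) (dtx s t) (dty s t)).
Qed.

Let fAA s t := dmap fA (c s t) A.
Let fAB s t := dmap fA (c s t) B.
Let fBA s t := dmap fB (c s t) A.
Let fBB s t := dmap fB (c s t) B.
(** With radius q = sin s, [n] is q times the radial derivative of [f], [ks] its derivative in s and
    [m] its angular derivative; [ns] is the s-derivative of [n], and [mt] the t-derivative of
    [m]. *)
Let n s t := x s t * fA (c s t) + y s t * fB (c s t).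
Let ks s t := cos s * cos t * fA (c s t) + cos s * sin t * fB (c s t).
Let m s t := - y s t * fA (c s t) + x s t * fB (c s t).
Let ns s t := (cos s * cos t * fA (c s t) + x s t * (cos s * cos t * fAA s t + cos s * sin t * fAB s t))
  + (cos s * sin t * fB (c s t) + y s t * (cos s * cos t * fBA s t + cos s * sin t * fBB s t)).
Let mt s t := (- x s t * fA (c s t) - y s t * (- y s t * fAA s t + x s t * fAB s t))
  + (- y s t * fB (c s t) + x s t * (- y s t * fBA s t + x s t * fBB s t)).

Let dn (s t : R) : is_derive s 1 (n^~ t) (ns s t).
Proof.
have H := is_deriveD (is_deriveM (dsx s t) (dsg s t sA)) (is_deriveM (dsy s t) (dsg s t sB)).
by apply: (is_derive_eq H); rewrite /ns /fAA /fAB /fBA /fBB /GRing.scale /=; ring.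
Qed.

Let dm (s t : R) : is_derive t 1 (m s) (mt s t).
Proof.
have H := is_deriveD (is_deriveM (is_deriveN (dty s t)) (dtg s t sA))
  (is_deriveM (dtx s t) (dtg s t sB)).
by apply: (is_derive_eq H); rewrite /mt /fAA /fAB /fBA /fBB /GRing.scale /= !fctE; ring.
Qed.

(** The polar form of the Laplacian, q d_q (q d_q f) = q^2 Lap f - d_t^2 f with q = sin s,
    multiplied by dq/ds = cos s. *)
Let polar_identity s t :
  sin s * ns s t = cos s * (sin s ^+ 2 * (fAA s t + fBB s t) - mt s t).
Proof.
have H : cos t ^+ 2 + sin t ^+ 2 = 1 := cos2Dsin2 t.
rewrite -[sin s ^+ 2]mulr1 -H /ns /mt /x /y.
move: (fA _) (fB _) (fAA s t) (fAB s t) (fBA s t) (fBB s t) (sin s) (cos s) (sin t) (cos t).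
by move=> *; ring.
Qed.

Let radial s t : sin s * ks s t = cos s * n s t.
Proof. by rewrite /ks /n /x /y; move: (fA _) (fB _) => *; ring. Qed.

Let cfA := cc sA.
Let cfB := cc sB.
Let cfAA := cc (smooth_on_dmap A oU sA).
Let cfAB := cc (smooth_on_dmap B oU sA).
Let cfBA := cc (smooth_on_dmap A oU sB).
Let cfBB := cc (smooth_on_dmap B oU sB).
Let csin := cont2_fst (@continuous_sin R).
Let ccos := cont2_fst (@continuous_cos R).
Let csin' := cont2_snd (@continuous_sin R).
Let ccos' := cont2_snd (@continuous_cos R).

Let cn : cont2 n.
Proof. exact: (cont2D (cont2M cx cfA) (cont2M cy cfB)). Qed.
Let cks : cont2 ks.
Proof.
exact: (cont2D (cont2M (cont2M ccos ccos') cfA) (cont2M (cont2M ccos csin') cfB)).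
Qed.
Let cm : cont2 m.
Proof. exact: (cont2D (cont2M (cont2N cy) cfA) (cont2M cx cfB)). Qed.
Let cg (g1 g2 : R -> R -> R) : cont2 g1 -> cont2 g2 ->
  cont2 (fun s t => cos s * cos t * g1 s t + cos s * sin t * g2 s t).
Proof.
move=> c1 c2.
exact: (cont2D (cont2M (cont2M ccos ccos') c1) (cont2M (cont2M ccos csin') c2)).
Qed.
Let ch (g1 g2 : R -> R -> R) : cont2 g1 -> cont2 g2 ->
  cont2 (fun s t => - y s t * g1 s t + x s t * g2 s t).
Proof. by move=> c1 c2; exact: (cont2D (cont2M (cont2N cy) c1) (cont2M cx c2)). Qed.
Let cns : cont2 ns.
Proof.
exact: (cont2D (cont2D (cont2M (cont2M ccos ccos') cfA) (cont2M cx (cg cfAA cfAB)))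
 (cont2D (cont2M (cont2M ccos csin') cfB) (cont2M cy (cg cfBA cfBB)))).
Qed.
Let cmt : cont2 mt.
Proof.
exact: (cont2D (cont2D (cont2M (cont2N cx) cfA) (cont2N (cont2M cy (ch cfAA cfAB))))
 (cont2D (cont2M (cont2N cy) cfB) (cont2M cx (ch cfBA cfBB)))).
Qed.

Let T : R := 2 * pi.
Let T0 : 0 < T. Proof. by rewrite mulr_gt0 ?pi_gt0. Qed.

Let int_mt s : intg T mt s = 0.
Proof.
rewrite (intg_derive T0 cmt cm (dm s)) /m /c /x /y /T mulr_natl.
by rewrite sin2pi cos2pi sin0 cos0 subrr.
Qed.

Let dN (s : R) : is_derive s 1 (intg T n) (intg T ns s).
Proof. exact: is_derive_intg (ltW T0) cn cns dn s. Qed.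

Let cLap : cont2 (fun s t => fAA s t + fBB s t).
Proof. exact: cont2D cfAA cfBB. Qed.

Let csin2 : cont2 (fun s _ : R => sin s ^+ 2).
Proof. exact: (cont2M csin csin). Qed.

Let cdiff : cont2 (fun s t => sin s ^+ 2 * (fAA s t + fBB s t) - mt s t).
Proof. exact: (cont2D (cont2M csin2 cLap) (cont2N cmt)). Qed.

Let sin_pos (s : R) : 0 < s -> s < pi / 2 -> 0 < sin s.
Proof. by move=> s0 s1; apply: sin_gt0_pihalf; rewrite s0. Qed.

Let cos_pos (s : R) : 0 < s -> s < pi / 2 -> 0 < cos s.
Proof.
move=> s0 s1; apply: cos_gt0_pihalf.
by rewrite s1 (lt_trans _ s0) // oppr_lt0 divr_gt0 ?pi_gt0.
Qed.

(** Integrating [polar_identity] over a period removes [mt], the derivative of a periodic function,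
    and leaves the integral of the Laplacian with positive factors. *)
Let dN_ge0 (s : R) : 0 < s < pi / 2 -> 0 <= intg T ns s.
Proof.
move=> /andP[s0 s1]; have ss := sin_pos s0 s1; have cs := cos_pos s0 s1.
have E : sin s * intg T ns s = cos s * intg T (fun s t => sin s ^+ 2 * (fAA s t + fBB s t)) s.
  rewrite -(intgZ _ sin _ cns).
  transitivity (intg T (fun s t => cos s * (sin s ^+ 2 * (fAA s t + fBB s t) - mt s t)) s).
    by apply: eq_intg => t; exact: polar_identity.
  rewrite (intgZ _ cos _ cdiff); congr (_ * _).
  rewrite (intgD _ _ (cont2M csin2 cLap) (cont2N cmt)).
  suff -> : intg T (fun s t => - mt s t) s = 0 by rewrite addr0.
  transitivity (intg T (fun s t => -1 * mt s t) s); first by apply: eq_intg => t; rewrite mulN1r.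
  by rewrite (intgZ _ (fun=> -1) _ cmt) int_mt mulr0.
rewrite -(pmulr_rge0 _ ss) E mulr_ge0 ?(ltW cs) //.
by apply: intg_ge0 => t; apply: mulr_ge0; [exact: sqr_ge0|exact: lap_ge0].
Qed.

(** At s = 0 the function [n] vanishes, and its integral over the circle increases by [dN_ge0]. *)
Let N_ge0 (s : R) : 0 <= s <= pi / 2 -> 0 <= intg T n s.
Proof.
move=> /andP[s0 s1].
have -> : 0 = intg T n 0.
  transitivity (intg T (fun s t : R => 0 * n s t) 0).
    by have /= := intgZ T (fun=> 0) 0 cn; rewrite mul0r => ->.
  by apply: eq_intg => t; rewrite mul0r /n /x /y sin0 !mul0r addr0.
have df z : z \in `]0, (pi / 2)[ -> derivable (intg T n) z 1 by case: (dN z).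
have dge z : z \in `]0, (pi / 2)[ -> 0 <= (intg T n)^`()%classic z.
  move=> z01; rewrite derive1E; have [_ ->] := dN z; apply: dN_ge0.
  by move: z01; rewrite in_itv.
apply: (ger0_derive1_le_cc df dge) => //.
- by apply: derivable_within_continuous => z _; case: (dN z).
- by rewrite in_itv /= lexx divr_ge0 ?pi_ge0.
- by rewrite in_itv /= s0.
Qed.

Let k s t := f (c s t).
Let ck : cont2 k. Proof. exact: cc sf. Qed.
Let dk (s t : R) : is_derive s 1 (k^~ t) (ks s t). Proof. exact: dsg sf. Qed.
Let dM (s : R) : is_derive s 1 (intg T k) (intg T ks s).
Proof. exact: is_derive_intg (ltW T0) ck cks dk s. Qed.

(** The integral of [f] over the circle at s has a derivative of the sign of the integral of [n], by
    [radial], so it increases from the centre to the unit circle. *)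
Lemma sub_mean_value : T * f a <= \int[lebesgue_measure]_(t in `[0, T])
  f (a + cos t *: A + sin t *: B).
Proof.
have -> : T * f a = intg T k 0.
  rewrite (@eq_intg _ T k (fun=> fun=> f a)); last first.
    by move=> t; rewrite /k /c /x /y sin0 !mul0r !scale0r !addr0.
  by rewrite /intg Rintegral_cst //= lebesgue_measure_itv /= lte_fin T0 oppr0 adde0 mulrC.
have -> : \int[lebesgue_measure]_(t in `[0, T]) f (a + cos t *: A + sin t *: B) = intg T k (pi / 2).
  by apply: eq_Rintegral => t _; rewrite /k /c /x /y sin_pihalf !mul1r.
have pi2 : 0 <= pi / 2 :> R by rewrite divr_ge0 ?pi_ge0.
have df z : z \in `]0, (pi / 2)[ -> derivable (intg T k) z 1 by case: (dM z).
have dge z : z \in `]0, (pi / 2)[ -> 0 <= (intg T k)^`()%classic z.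
  rewrite in_itv /= => /andP[z0 z1]; rewrite derive1E; have [_ ->] := dM z.
  rewrite -(pmulr_rge0 _ (sin_pos z0 z1)) -(intgZ _ sin _ cks).
  have -> : intg T (fun s t => sin s * ks s t) z = intg T (fun s t => cos s * n s t) z.
    by apply: eq_intg => t; exact: radial.
  rewrite (intgZ _ cos _ cn) mulr_ge0 ?(ltW (cos_pos z0 z1)) //.
  by apply: N_ge0; rewrite !ltW.
apply: (ger0_derive1_le_cc df dge) => //.
- by apply: derivable_within_continuous => z _; case: (dM z).
- by rewrite in_itv /= lexx.
- by rewrite in_itv /= lexx pi2.
Qed.

End SubMean.

(** * Complex Hessian and plurisubharmonicity *)

Section Psh.
Variable R : realType.
Local Notation Re := (@complex.Re R).
Local Notation Im := (@complex.Im R).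
Implicit Types (U : set (C2 R)) (f g : C2 R -> R) (F G : C2 R -> R[i]).
Implicit Types (p q : C2 R) (Z W : 'rV[R[i]]_2).

Lemma sum_ord2 (V : nmodType) (F : 'I_2 -> V) : \sum_j F j = F 0 + F 1.
Proof.
rewrite !big_ord_recl big_ord0 addr0; congr (F _ + F _); exact/val_inj.
Qed.

Lemma vect_appE Z f p : vect_app Z f p = Z 0 0 * dz 0 (toC f) p + Z 0 1 * dz 1 (toC f) p.
Proof. by rewrite /vect_app sum_ord2. Qed.

Lemma hessE f Z W p : hess f Z W p =
  dz 0 (dzbar 0 (toC f)) p * Z 0 0 * Num.conj (W 0 0) + dz 0 (dzbar 1 (toC f)) p * Z 0 0 * Num.conj (W 0 1)
  + (dz 1 (dzbar 0 (toC f)) p * Z 0 1 * Num.conj (W 0 0) + dz 1 (dzbar 1 (toC f)) p * Z 0 1 * Num.conj (W 0 1)).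
Proof. by rewrite /hess sum_ord2; congr (_ + _); exact: sum_ord2. Qed.

Lemma dz_lin U F G (a b : R[i]) j p : open U -> csmooth U F -> csmooth U G -> U p ->
  dz j (fun q => a * F q + b * G q) p = a * dz j F p + b * dz j G p.
Proof.
move=> oU sF sG Up; have sa := csmooth_cst a oU; have sb := csmooth_cst b oU.
rewrite (dzD _ oU (csmoothM oU sa sF) (csmoothM oU sb sG) Up).
rewrite (dzM _ oU sa sF Up) (dzM _ oU sb sG Up) !dz_cst.
by move: (dz j F p) (dz j G p) => x y; rewrite !mulr0 !addr0.
Qed.

Lemma dz_toC_coord f j p : dz j (toC f) p =
  (partial (xdir j) f p / 2) +i* (- (partial (ydir j) f p / 2)).
Proof.
rewrite /dz /cpartial /toC /= /partial !derive_cst.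
rewrite (_ : (2 : R[i])^-1 = (2 : R)^-1%:C); last by rewrite fmorphV /= rmorph_nat.
move: ('D_ _ f p) ('D_ _ f p) => x y.
by apply: eq_ReIm; rewrite ?cReM ?cImM ?cReD ?cImD ?cReN ?cImN ?cReM ?cImM /=; ring.
Qed.

#[local] Opaque Defs.dz Defs.dzbar.
(** The real direction underlying Z acts as Z + conj Z, and on a real function the second summand
    gives the conjugate of the first. *)
Lemma dmap_C2_of f p Z : dmap f p (C2_of Z) = 2 * Re (vect_app Z f p).
Proof.
rewrite vect_appE dz_toC_coord dz_toC_coord /dmap big_split_ord /= sum_ord2 sum_ord2.
rewrite /C2_of !row_mxEl !row_mxEr !mxE /xdir /ydir.
move: (partial _ f p) (partial _ f p) (partial _ f p) (partial _ f p) => a b c d.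
by rewrite cReD !cReM /=; field.
Qed.

Let laplacian_alg (I a b c d g0 g1 z w : R[i]) : I * I = -1 ->
  2 * Re (z * (1 * g0 + 1 * (Num.conj z * a + Num.conj w * b)) + w * (1 * g1 + 1 * (Num.conj z * c + Num.conj w * d))) +
  2 * Re (I * z * (I * g0 + - I * (Num.conj z * a + Num.conj w * b)) + I * w * (I * g1 + - I * (Num.conj z * c + Num.conj w * d))) =
  4 * Re (a * z * Num.conj z + b * z * Num.conj w + (c * w * Num.conj z + d * w * Num.conj w)).
Proof.
move: (Num.conj z) (Num.conj w) => z' w' II.
set X := (X in 2 * Re X + _); set Y := (X in _ + 2 * Re X); set T := (X in 4 * Re X).
have -> : Y = - (z * (g0 - (z' * a + w' * b)) + w * (g1 - (z' * c + w' * d))).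
  transitivity ((I * I) * (z * (g0 - (z' * a + w' * b)) + w * (g1 - (z' * c + w' * d)))).
    by rewrite /Y; ring.
  by rewrite II mulN1r.
have E : X + - (z * (g0 - (z' * a + w' * b)) + w * (g1 - (z' * c + w' * d))) = T + T.
  by rewrite /X /T; ring.
by rewrite -mulrDr -cReD E cReD; ring.
Qed.

(** Along Z and i Z the real derivatives are G + conj G and i G - i conj G with G = Z f.
    Differentiating again and adding cancels the pure second derivatives, because i^2 = -1, and
    doubles the mixed ones. *)
Lemma laplacian_hess U f p Z : open U -> smooth_on U f -> U p ->
  dmap (fun q => dmap f q (C2_of Z)) p (C2_of Z) +
  dmap (fun q => dmap f q (C2_of ((0 +i* 1) *: Z))) p (C2_of ((0 +i* 1) *: Z)) =
  4 * Re (hess f Z Z p).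
Proof.
move=> oU sf Up; set I : R[i] := 0 +i* 1.
have sF := csmooth_toC oU sf.
pose G q := Z 0 0 * dz 0 (toC f) q + Z 0 1 * dz 1 (toC f) q.
pose H q := Num.conj (Z 0 0) * dzbar 0 (toC f) q + Num.conj (Z 0 1) * dzbar 1 (toC f) q.
have sc (a b : R[i]) F1 F2 : csmooth U F1 -> csmooth U F2 -> csmooth U (fun q => a * F1 q + b * F2 q).
  move=> s1 s2.
  exact: (csmoothD oU (csmoothM oU (csmooth_cst a oU) s1) (csmoothM oU (csmooth_cst b oU) s2)).
have sG : csmooth U G by exact: sc (csmooth_dz 0 oU sF) (csmooth_dz 1 oU sF).
have sH : csmooth U H by exact: sc (csmooth_dzbar 0 oU sF) (csmooth_dzbar 1 oU sF).
have HE q : Num.conj (G q) = H q.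
  rewrite /G /H -2!dz_toC_conj; move: (dz 0 _ q) (dz 1 _ q) (Z 0 0) (Z 0 1) => a b c d.
  by rewrite !conj_simp.
have EA : toC (fun q => dmap f q (C2_of Z)) = fun q => 1 * G q + 1 * H q.
  apply/funext => q; rewrite /toC dmap_C2_of vect_appE -/(G q) -HE !mul1r.
  by move: (G q) => g; rewrite addcJ rmorphM /= rmorph_nat.
have EB : toC (fun q => dmap f q (C2_of (I *: Z))) = fun q => I * G q + - I * H q.
  apply/funext => q; rewrite /toC dmap_C2_of vect_appE !mxE -!mulrA -mulrDr -/(G q) -HE.
  move: (G q) => g.
  apply: eq_ReIm; rewrite ?cReD ?cImD !(cReM, cImM, cReN, cImN, cReJ, cImJ) /=; ring.
have DH j : dz j H p = Num.conj (Z 0 0) * dz j (dzbar 0 (toC f)) p + Num.conj (Z 0 1) * dz j (dzbar 1 (toC f)) p.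
  exact: (dz_lin _ _ _ oU (csmooth_dzbar 0 oU sF) (csmooth_dzbar 1 oU sF) Up).
have II : I * I = -1 by apply: eq_ReIm; rewrite ?cReM ?cImM ?cReN ?cImN /=; ring.
rewrite !dmap_C2_of !vect_appE EA EB !mxE hessE.
clear EA EB HE; clearbody I G H.
rewrite !(dz_lin _ _ _ oU sG sH Up) (DH 0) (DH 1).
exact: laplacian_alg II.
Qed.

Lemma C2_ofD (Z W : 'rV[R[i]]_2) : C2_of (Z + W) = C2_of Z + C2_of W.
Proof.
rewrite /C2_of add_row_mx; congr row_mx; apply/rowP => j; rewrite !mxE;
 by [exact: cReD|exact: cImD].
Qed.

Lemma C2_ofZ (a : R) (Z : 'rV[R[i]]_2) : C2_of (a%:C *: Z) = a *: C2_of Z.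
Proof.
rewrite /C2_of scale_row_mx; congr row_mx; apply/rowP => j; rewrite !mxE.
  by rewrite cReM /= mul0r subr0.
by rewrite cImM /= mul0r addr0.
Qed.

Lemma C2_of_scale (x y : R) (Z : 'rV[R[i]]_2) :
  C2_of ((x +i* y) *: Z) = x *: C2_of Z + y *: C2_of ((0 +i* 1) *: Z).
Proof.
rewrite -!C2_ofZ scalerA -C2_ofD -scalerDl; congr (C2_of (_ *: _)).
by apply: eq_ReIm; rewrite ?cReD ?cImD ?cReM ?cImM /=; ring.
Qed.

Lemma hess_ge0_psh U f : open U -> smooth_on U f ->
  (forall p, U p -> forall Z, 0 <= Re (hess f Z Z p)) -> psh_on U f.
Proof.
move=> oU sf H; split=> [a Ua c fc|a b disc].
  have cf : f x @[x --> a] --> f a := smooth_on_continuous sf Ua.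
  by have := @cvgr_lt _ _ _ _ _ _ cf c fc; apply.
pose A := C2_of b; pose B := C2_of ((0 +i* 1) *: b).
have disc' (x y : R) : x ^+ 2 + y ^+ 2 <= 1 -> U (a + x *: A + y *: B).
  move=> xy; rewrite -addrA -C2_of_scale; apply: disc.
  rewrite normc_def /= -[leRHS]/(1%:C) lecR -sqrtr1 ler_sqrt //.
have lap p : U p -> 0 <= dmap (fun q => dmap f q A) p A + dmap (fun q => dmap f q B) p B.
  by move=> Up; rewrite (laplacian_hess _ oU sf Up) mulr_ge0 // H.
have M := sub_mean_value oU sf disc' lap.
pose G (s t : R) := f (a + cos t *: A + sin t *: B).
have E : (\int[lebesgue_measure]_(t in `[0%R, (2 * pi)%R])
    (f (a + C2_of ((cos t +i* sin t) *: b)))%:E)%E = (intg (2 * pi) G 0)%:E.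
  rewrite /intg /Rintegral fineK.
    by apply: eq_integral => t _; rewrite C2_of_scale addrA.
  apply: integrable_fin_num => //; apply: (@cont2_integrable R G 0).
  apply: cont2_smooth sf _ (cont2_snd (@continuous_cos R)) (cont2_snd (@continuous_sin R)) => _ t.
  by apply: disc'; rewrite cos2Dsin2.
rewrite E -EFinM lee_fin ler_pdivlMl ?mulr_gt0 ?pi_gt0 //.
Qed.

End Psh.

(** * The flat functions x^-k exp(-1/x) *)

Section FlatFunction.
Variable R : realType.
Implicit Types (x y c : R) (k : nat).

Definition flat k x : R := if 0 < x then x^-1 ^+ k * expR (- x^-1) else 0.

Lemma flat_gt0 k x : 0 < x -> 0 < flat k x.
Proof. by move=> x0; rewrite /flat x0 mulr_gt0 ?expR_gt0 // exprn_gt0 // invr_gt0. Qed.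

Lemma flat_le0 k x : x <= 0 -> flat k x = 0.
Proof. by move=> x0; rewrite /flat ltNge x0. Qed.

Lemma flat_ge0 k x : 0 <= flat k x.
Proof. by have [/flat_le0->|/flat_gt0/ltW] := leP x 0. Qed.

Lemma flatS k x : 0 < x -> flat k.+1 x = x^-1 * flat k x.
Proof. by move=> x0; rewrite /flat x0 exprS mulrA. Qed.

(** With u = 1 / x, the single term u^(k+2) / (k+2)! of the exponential series already beats u^k by
    a factor x^2. The quadratic bound gives the derivative 0 at the origin. *)
Lemma flat_bound k x : `|flat k x| <= (k.+2)`!%:R * x ^+ 2.
Proof.
have [x0|x0] := leP x 0.
  by rewrite flat_le0 // normr0 mulr_ge0 // sqr_ge0.
rewrite ger0_norm ?flat_ge0 //.
have u0 : 0 < x^-1 by rewrite invr_gt0.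
have := expR_ge1Dxn k.+1 (ltW u0); set u := x^-1 => H.
rewrite /flat x0 -/u expRN -(ler_pM2r (expR_gt0 u)) -mulrA mulVf ?gt_eqF ?expR_gt0 // mulr1.
have {}H : u ^+ k.+2 / (k.+2)`!%:R <= expR u by apply: le_trans H; rewrite lerDr.
rewrite ler_pdivrMr ?ltr0n ?fact_gt0 // in H.
have -> : u ^+ k = x ^+ 2 * u ^+ k.+2.
  by rewrite -[k.+2]addn2 exprD mulrCA -exprMn divff ?gt_eqF // expr1n mulr1.
by rewrite -[leRHS]mulrA [leRHS]mulrCA ler_pM2l ?exprn_gt0 // mulrC.
Qed.

Lemma is_derive_invr x : x != 0 -> is_derive x 1 (fun y : R => y^-1) (- x^-1 ^+ 2).
Proof.
move=> x0; split; first exact: (@derivableV _ _ id).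
by rewrite (@deriveV _ _ id) // derive_id /GRing.scale /= mulr1 exprVn.
Qed.

Lemma is_derive_invrX k x : x != 0 ->
  is_derive x 1 (fun y : R => y^-1 ^+ k) (- k%:R * x^-1 ^+ k.+1).
Proof.
move=> x0; have H := is_deriveX k (is_derive_invr x0).
have -> : (fun y : R => y^-1 ^+ k) = (fun y : R => y^-1) ^+ k.
  by apply/funext => y; rewrite exprfctE.
apply: (is_derive_eq H); rewrite /GRing.scale /=.
case: (k) => [|n]; first by rewrite mulr0n !mul0r oppr0 mul0r.
by rewrite -mulr_natl !exprS; move: (x^-1) (x^-1 ^+ n) => u v; ring.
Qed.

Lemma is_derive_flat k x :
  is_derive x 1 (flat k) (- k%:R * flat k.+1 x + 1 * flat k.+2 x).
Proof.
have [x0|x0|x0] := ltgtP x 0.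
- rewrite !flat_le0 ?ltW // !mulr0 addr0.
  apply: (@near_eq_is_derive _ _ _ (cst 0)).
  near=> y; rewrite flat_le0 // ltW //; near: y; exact: lt_nbhsl.
- pose f y : R := y^-1 ^+ k * expR (- y^-1).
  apply: (@near_eq_is_derive _ _ _ f).
    near=> y; have y0 : 0 < y by near: y; exact: lt_nbhsr.
    by rewrite /f /flat y0.
  have xn0 : x != 0 by rewrite gt_eqF.
  have dk := is_derive_invrX k xn0.
  have dV := is_derive_invr xn0.
  have de : is_derive x 1 (fun y : R => expR (- y^-1)) (x^-1 ^+ 2 * expR (- x^-1)).
    have dN := is_deriveN dV; rewrite opprK in dN.
    by apply: (is_derive_eq (is_derive1_comp (is_derive_expR _) dN)); rewrite /GRing.scale /=; ring.
  apply: (is_derive_eq (is_deriveM dk de)); rewrite /flat x0 /GRing.scale /=.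
  by rewrite !exprS; move: (x^-1) (expR _) => u v; ring.
- rewrite x0 !flat_le0 // !mulr0 addr0.
  have H : (fun h : R => h^-1 *: ((flat k \o shift 0) (h *: 1) - flat k 0)) @ 0^' --> (0 : R).
    apply: norm_cvg0; set C := (k.+2)`!%:R : R.
    have C0 : 0 <= C by rewrite ler0n.
    apply: (@squeeze_cvgr _ _ _ _ (cst 0) (fun h : R => C * `|h|)).
    + near=> h; rewrite normr_ge0 /= [flat k 0]flat_le0 // subr0 addr0 [h%:A]mulr1.
      rewrite normrM normfV; have h0 : h != 0 by near: h; exact: nbhs_dnbhs_neq.
      rewrite mulrC ler_pdivrMr ?normr_gt0 // -mulrA -normrM -expr2 normrX.
      by apply: le_trans (flat_bound k h) _; rewrite -/C -real_normK ?num_real.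
    + exact: cvg_cst.
    + have E : `|h| @[h --> (0 : R)^'] --> `|0 : R|.
        by apply: cvg_norm; exact: cvg_within.
      rewrite normr0 in E; rewrite -[X in _ --> X](mulr0 C).
      exact: (cvgM (@cvg_cst _ C _ _ _) E).
  by split; [apply/cvg_ex; exists 0|exact: cvg_lim H].
Unshelve. all: by end_near. Qed.

Lemma flat_derive_closed : derive_closed setT (fun phi => exists k, phi = flat k).
Proof.
move=> phi [k ->]; exists (flat k.+1), (flat k.+2), (- k%:R), 1; split; [by exists k.+1|by exists k.+2|].
by move=> x _; exact: is_derive_flat.
Qed.

Lemma expR_derive_closed : derive_closed setT (fun phi => phi = @expR R).
Proof.
move=> phi ->; exists expR, expR, 1, 0; split=> // x _.
by rewrite mul0r addr0 mul1r; exact: is_derive_expR.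
Qed.

Lemma inv_derive_closed : derive_closed [set x : R | x != 0]
  (fun phi => exists k, phi = fun x => x^-1 ^+ k.+1).
Proof.
move=> phi [k ->].
exists (fun x => x^-1 ^+ k.+2), (fun x => x^-1 ^+ k.+2), (- k.+1%:R), 0.
split; [by exists k.+1|by exists k.+1|] => x /= x0; rewrite mul0r addr0.
exact: is_derive_invrX.
Qed.

Lemma powR_derive_closed : derive_closed [set x : R | 0 < x]
  (fun phi => exists a : R, phi = fun x => x `^ a).
Proof.
move=> phi [a ->]; exists (fun x => x `^ (a - 1)), (fun x => x `^ (a - 1)), a, 0.
split; [by exists (a - 1)|by exists (a - 1)|] => x x0; rewrite mul0r addr0.
exact: is_derive1_powR.
Qed.

(** With u = 1 / x the derivative is u (u - 2) times [flat 2 x], nonnegative for 0 < x <= 1 / 2. *)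
Lemma flat2_le x y : 0 < x -> x <= y -> y <= 2^-1 -> flat 2 x <= flat 2 y.
Proof.
move=> x0 xy y2.
have d z : derivable (flat 2) z 1 by case: (is_derive_flat 2 z).
apply: (@ger0_derive1_le_cc R (flat 2) x y) => //.
- move=> z; rewrite in_itv /= => /andP[xz zy].
  have z0 : 0 < z := lt_trans x0 xz.
  rewrite derive1E; have [_ ->] := is_derive_flat 2 z.
  rewrite !flatS // mul1r -mulrDl mulr_ge0 ?mulr_ge0 ?flat_ge0 ?invr_ge0 ?(ltW z0) //.
  rewrite addrC subr_ge0 -[leLHS]invrK lef_pV2 ?posrE ?invr_gt0 //.
  by apply: le_trans y2; exact: ltW.
- by apply: derivable_within_continuous => z _.
- by rewrite in_itv /= lexx.
- by rewrite in_itv /= xy lexx.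
Qed.

Lemma flat0_lt x c : x < c -> 0 < c -> flat 0 x < flat 0 c.
Proof.
move=> xc c0; have [x0|x0] := leP x 0; first by rewrite flat_le0 // flat_gt0.
rewrite /flat x0 c0 !expr0 !mul1r ltr_expR ltrN2 ltf_pV2 //.
Qed.

(* Convexity of [flat 0] near 0 beats the loss of the constant in the exponent. *)
Lemma flat_convexity (kappa : R) c x : 0 < kappa -> kappa <= 1 -> c <= 4^-1 ->
  0 < x -> x < c ->
  kappa / 8 * (flat 0 c - flat 0 x) * flat 2 x <=
  (c - x) * (kappa * flat 2 x ^+ 2 + (flat 0 c - flat 0 x) * (flat 4 x - 2 * flat 3 x)).
Proof.
move=> k0 k1 c4 x0 xc; have c0 : 0 < c := lt_trans x0 xc.
have cx0 : 0 < c - x by rewrite subr_gt0.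
have [xi /andP[xxi xic] E] : exists2 xi, x < xi < c & flat 0 c - flat 0 x = flat 2 xi * (c - x).
  have [||xi xi0 E] := @MVT R (flat 0) (flat 2) x c xc.
  - by move=> z _; apply: is_derive_eq (is_derive_flat 0 z) _; rewrite oppr0 mul0r add0r mul1r.
  - by apply: derivable_within_continuous => z _; case: (is_derive_flat 0 z).
  by exists xi => //; move: xi0; rewrite in_itv.
have xi0 : 0 < xi := lt_trans x0 xxi.
have Fxi : flat 2 xi <= flat 2 c by apply: flat2_le; rewrite ?(ltW xic) //; lra.
have F0 := flat_gt0 2 xi0; have Fx := flat_gt0 2 x0; have Fc := flat_gt0 2 c0.
set u := x^-1; set v := c^-1.
have u0 : 0 < u by rewrite invr_gt0.
have v0 : 0 < v by rewrite invr_gt0.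
have vc : v * c = 1 by rewrite mulVf // gt_eqF.
have ux : u * x = 1 by rewrite mulVf // gt_eqF.
have v4 : 4 <= v by rewrite -[leLHS]invrK lef_pV2 ?posrE ?invr_gt0.
have uv : v < u by rewrite ltf_pV2.
have -> : flat 4 x - 2 * flat 3 x = flat 2 x * (u * (u - 2)) by rewrite !flatS // -/u; ring.
have W0 : 0 < flat 0 c - flat 0 x by rewrite E mulr_gt0.
rewrite (_ : (c - x) * _ = ((c - x) * (kappa * flat 2 x) + (flat 0 c - flat 0 x) * ((c - x) * (u * (u - 2)))) * flat 2 x); last by ring.
rewrite ler_pM2r //.
(* Close to c, [flat 2] varies by a factor of at most 2, so the term with kappa suffices. Farther
   away the other term does, since (c - x) u (u - 2) is then at least 1 / 8. *)
have [small|big] := leP (c - x) (c ^+ 2 / 4).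
  have ratio : flat 2 c <= 2 * flat 2 x.
    rewrite /flat x0 c0 -/u -/v.
    have uv2 : u - v <= 2^-1.
      have -> : u - v = (c - x) * (u * v).
        transitivity (u * (v * c) - v * (u * x)); last by ring.
        by rewrite vc ux !mulr1.
      apply: (le_trans (ler_wpM2r (ltW (mulr_gt0 u0 v0)) small)).
      have -> : c ^+ 2 / 4 * (u * v) = c * u / 4 * (v * c) by ring.
      have : c * u <= 2 * x * u by rewrite ler_pM2r //; nra.
      by rewrite vc -mulrA [x * u]mulrC ux; lra.
    have ee : expR (- v) <= 2 * expR (- u).
      have -> : - u = - v + (v - u) by ring.
      rewrite expRD mulrCA ler_pMr ?expR_gt0 //.
      by have := expR_ge1Dx (v - u); lra.
    rewrite mulrCA; apply: ler_pM => //; rewrite ?expR_ge0 ?exprn_ge0 ?(ltW v0) //.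
    by rewrite lerXn2r ?nnegrE ?ltW.
  have A : kappa / 8 * (flat 0 c - flat 0 x) <= (c - x) * (kappa * flat 2 x).
    rewrite E mulrA mulrC ler_pM2l //.
    have := ler_wpM2l (ltW k0) Fxi; have := ler_wpM2l (ltW k0) ratio.
    by have := mulr_gt0 k0 F0; lra.
  apply: le_trans A _; rewrite lerDl mulr_ge0 ?(ltW W0) // mulr_ge0 ?(ltW cx0) // mulr_ge0 ?(ltW u0) //; lra.
(* Since u > v >= 4, u - 2 is at least v / 2; with c - x > c^2 / 4 and v c = 1 the product is at
   least 1 / 8, the origin of the constant. *)
have B : kappa / 8 <= (c - x) * (u * (u - 2)).
  have B1 : v * (v / 2) <= u * (u - 2) by apply: ler_pM; rewrite ?(ltW v0) ?(ltW uv) //; lra.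
  have B2 : c ^+ 2 / 4 * (v * (v / 2)) <= (c - x) * (u * (u - 2)).
    by apply: ler_pM; rewrite ?(ltW big) // mulr_ge0 ?(ltW v0) ?exprn_ge0 ?(ltW c0) //; lra.
  apply: le_trans B2; have -> : c ^+ 2 / 4 * (v * (v / 2)) = (v * c) ^+ 2 / 8 by field.
  by rewrite vc; lra.
rewrite [kappa / 8 * _]mulrC; apply: (le_trans (ler_wpM2l (ltW W0) B)).
by rewrite lerDr mulr_ge0 ?(ltW cx0) // mulr_ge0 // ltW.
Qed.

End FlatFunction.

(** * Levi form and mixed Hessian *)

Section ComplexAlgebra.
Variable R : realType.
Local Notation Re := (@complex.Re R).
Local Notation Im := (@complex.Im R).
Local Notation conj := (@Num.conj _ : R[i] -> R[i]).

Definition nsq (z : R[i]) : R := Re z ^+ 2 + Im z ^+ 2.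

Lemma nsqE z : z * conj z = (nsq z)%:C.
Proof. by apply: eq_ReIm; rewrite ?cReM ?cImM ?cReJ ?cImJ /nsq /=; ring. Qed.

Lemma nsq_ge0 z : 0 <= nsq z.
Proof. by rewrite addr_ge0 ?sqr_ge0. Qed.

Lemma Re_real (x : R) z : Re (x%:C * z) = x * Re z.
Proof. by rewrite cReM /= mul0r subr0. Qed.

Lemma nsqM z w : nsq (z * w) = nsq z * nsq w.
Proof. by rewrite /nsq cReM cImM; ring. Qed.

Lemma nsq_real (x : R) : nsq (x%:C) = x ^+ 2.
Proof. by rewrite /nsq /= expr0n addr0. Qed.

(** Completing the square in the frame L, N: with g = |a|^2, the vector g Z has the coordinates z0
    c1 - z1 c0 along L and z0 a0 + z1 a1 along N. The letters c, y and [gb] stand for the conjugates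
    of a, z and [ga]. *)
Let form_identity (m00 m01 m10 m11 a0 a1 c0 c1 z0 z1 y0 y1 al be ga gb g : R[i]) :
  m00 * a1 * c1 - m01 * a1 * c0 - m10 * a0 * c1 + m11 * a0 * c0 = al ->
  m00 * c0 * a0 + m01 * c0 * a1 + m10 * c1 * a0 + m11 * c1 * a1 = be ->
  m00 * a1 * a0 + m01 * a1 * a1 - m10 * a0 * a0 - m11 * a0 * a1 = ga ->
  m00 * c0 * c1 - m01 * c0 * c0 + m10 * c1 * c1 - m11 * c1 * c0 = gb ->
  a0 * c0 + a1 * c1 = g ->
  al * (g * g * (m00 * z0 * y0 + m01 * z0 * y1 + m10 * z1 * y0 + m11 * z1 * y1)) =
  (al * (z0 * c1 - z1 * c0) + gb * (z0 * a0 + z1 * a1)) *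
  (al * (y0 * a1 - y1 * a0) + ga * (y0 * c0 + y1 * c1)) +
  (al * be - ga * gb) * ((z0 * a0 + z1 * a1) * (y0 * c0 + y1 * c1)).
Proof.
move=> E1 E2 E3 E4 E5.
transitivity (al * ((z0 * c1 - z1 * c0) * (y0 * a1 - y1 * a0) * al + (z0 * c1 - z1 * c0) * (y0 * c0 + y1 * c1) * ga
 + (z0 * a0 + z1 * a1) * (y0 * a1 - y1 * a0) * gb + (z0 * a0 + z1 * a1) * (y0 * c0 + y1 * c1) * be)).
  by rewrite -E1 -E2 -E3 -E4 -E5; ring.
by ring.
Qed.

(* In the orthogonal frame [L = (a1, -a0)], [N = (conj a0, conj a1)] the form
   is a 2 x 2 hermitian matrix with nonnegative determinant. *)
Lemma hermitian_pos (m00 m01 m10 m11 a0 a1 z0 z1 ga : R[i]) (al be : R) :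
  conj m00 = m00 -> conj m01 = m10 -> conj m11 = m11 ->
  m00 * a1 * conj a1 - m01 * a1 * conj a0 - m10 * a0 * conj a1 + m11 * a0 * conj a0 = al%:C ->
  m00 * conj a0 * a0 + m01 * conj a0 * a1 + m10 * conj a1 * a0 + m11 * conj a1 * a1 = be%:C ->
  m00 * a1 * a0 + m01 * a1 * a1 - m10 * a0 * a0 - m11 * a0 * a1 = ga ->
  0 < nsq a0 + nsq a1 -> 0 < al -> nsq ga <= al * be ->
  0 <= Re (m00 * z0 * conj z0 + m01 * z0 * conj z1 + m10 * z1 * conj z0 + m11 * z1 * conj z1).
Proof.
move=> h00 h01 h11 E1 E2 E3 g0 al0 det.
have h10 : conj m10 = m01 by rewrite -h01 conj_K.
have E4 : m00 * conj a0 * conj a1 - m01 * conj a0 * conj a0 + m10 * conj a1 * conj a1 - m11 * conj a1 * conj a0 = conj ga.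
  by rewrite -E3 !conj_simp h00 h01 h10 h11; move: (conj a0) (conj a1) => x y; ring.
have E5 : a0 * conj a0 + a1 * conj a1 = (nsq a0 + nsq a1)%:C.
  by rewrite !nsqE -rmorphD.
have F := form_identity z0 z1 (conj z0) (conj z1) E1 E2 E3 E4 E5.
set T := (X in Re X); set g := nsq a0 + nsq a1 in g0 E5 F *.
suff : 0 <= al * (g * g * Re T).
  by rewrite pmulr_rge0 // pmulr_rge0 // mulr_gt0.
have -> : al * (g * g * Re T) = Re (al%:C * (g%:C * g%:C * T)).
  by rewrite Re_real -[in RHS]mulrA !Re_real; ring.
rewrite F.
set w := al%:C * (z0 * conj a1 - z1 * conj a0) + conj ga * (z0 * a0 + z1 * a1).
have -> : al%:C * (conj z0 * a1 - conj z1 * a0) + ga * (conj z0 * conj a0 + conj z1 * conj a1) = conj w.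
  by rewrite /w !conj_simp.
have -> : conj z0 * conj a0 + conj z1 * conj a1 = conj (z0 * a0 + z1 * a1) by rewrite !conj_simp.
rewrite !nsqE -rmorphM -rmorphB -rmorphM -rmorphD /=.
by rewrite addr_ge0 ?nsq_ge0 // mulr_ge0 ?nsq_ge0 // subr_ge0.
Qed.

(** The algebra of [levi_transport]. Here a and c are the first derivatives in z and conj z, b the
    complex Hessian, e the second derivatives in conj z, and t the third derivatives with the
    holomorphic index first. [DA0], [DA1] and [Dh0], [Dh1] are the conj z derivatives of [levi] and
    [mixed], expanded by the product rule. *)
Lemma transport_identity (b00 b01 b10 b11 a0 a1 c0 c1 t000 t001 t011 t100 t101 t111 e00 e01 e11 : R[i]) :
  let DA0 := ((t000 * a1 + b00 * b10) * c1 + b00 * a1 * e01) - ((t001 * a1 + b01 * b10) * c0 + b01 * a1 * e00)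
    - ((t100 * a0 + b10 * b00) * c1 + b10 * a0 * e01) + ((t101 * a0 + b11 * b00) * c0 + b11 * a0 * e00) in
  let DA1 := ((t001 * a1 + b00 * b11) * c1 + b00 * a1 * e11) - ((t011 * a1 + b01 * b11) * c0 + b01 * a1 * e01)
    - ((t101 * a0 + b10 * b01) * c1 + b10 * a0 * e11) + ((t111 * a0 + b11 * b01) * c0 + b11 * a0 * e01) in
  let Dh0 := ((t000 * a1 + b00 * b10) * a0 + b00 * a1 * b00) + ((t001 * a1 + b01 * b10) * a1 + b01 * a1 * b10)
    - ((t100 * a0 + b10 * b00) * a0 + b10 * a0 * b00) - ((t101 * a0 + b11 * b00) * a1 + b11 * a0 * b10) in
  let Dh1 := ((t001 * a1 + b00 * b11) * a0 + b00 * a1 * b01) + ((t011 * a1 + b01 * b11) * a1 + b01 * a1 * b11)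
    - ((t101 * a0 + b10 * b01) * a0 + b10 * a0 * b01) - ((t111 * a0 + b11 * b01) * a1 + b11 * a0 * b11) in
  b00 * a1 - b10 * a0 = 0 -> b01 * a1 - b11 * a0 = 0 ->
  b00 * c1 - b01 * c0 = 0 -> b10 * c1 - b11 * c0 = 0 ->
  a0 * DA0 + a1 * DA1 = c1 * Dh0 - c0 * Dh1.
Proof.
move=> DA0 DA1 Dh0 Dh1 u0 u1 w0 w1; apply/eqP; rewrite -subr_eq0; apply/eqP.
(* The difference lies in the ideal generated by the four expressions assumed to vanish; these are
   explicit cofactors. *)
transitivity ((b00 * a1 - b10 * a0) * (a0 * e01 + a1 * e11 - (b00 * c1 - b01 * c0))
  + (b01 * a1 - b11 * a0) * (- a0 * e00 - a1 * e01 - (b10 * c1 - b11 * c0))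
  + (b00 * c1 - b01 * c0) * (2 * (a0 * b10 + a1 * b11))
  + (b10 * c1 - b11 * c0) * - (2 * (a0 * b00 + a1 * b01))); last first.
  by rewrite u0 u1 w0 w1 !mul0r !addr0.
by rewrite /DA0 /DA1 /Dh0 /Dh1; ring.
Qed.

End ComplexAlgebra.

(** * Derivatives of the Levi form and of the mixed term *)

Section Jets.
Variables (R : realType) (U : set (C2 R)).
Hypothesis oU : open U.
Local Notation Re := (@complex.Re R).
Local Notation conj := (@Num.conj _ : R[i] -> R[i]).
Implicit Types (f r : C2 R -> R) (F G : C2 R -> R[i]) (p q : C2 R).

(** The fields L and N without the normalizing factor: [levi] and [mixed] become polynomials in the
    derivatives of [r], smooth wherever [r] is, and differ from the normalized quantities only by
    the factor [grad2 r]. *)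
Definition Lfield r p : 'rV[R[i]]_2 :=
  \row_j (if j == 0 then dz 1 (toC r) p else - dz 0 (toC r) p).

Definition Nfield r p : 'rV[R[i]]_2 := \row_j dzbar j (toC r) p.

Definition levi r p : R[i] := hess r (Lfield r p) (Lfield r p) p.

Definition mixed r p : R[i] := hess r (Lfield r p) (Nfield r p) p.

Definition grad2 r p : R := nsq (dz 0 (toC r) p) + nsq (dz 1 (toC r) p).

Let levi_alg (b00 b01 b10 b11 a0 a1 c0 c1 : R[i]) : conj a0 = c0 -> conj a1 = c1 ->
  b00 * a1 * conj a1 + b01 * a1 * conj (- a0) + (b10 * - a0 * conj a1 + b11 * - a0 * conj (- a0)) =
  b00 * a1 * c1 - b01 * a1 * c0 - b10 * a0 * c1 + b11 * a0 * c0.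
Proof. by move=> <- <-; rewrite !conj_simp; move: (conj a0) (conj a1) => x y; ring. Qed.

Lemma leviE r : levi r = fun p =>
  dz 0 (dzbar 0 (toC r)) p * dz 1 (toC r) p * dzbar 1 (toC r) p
  - dz 0 (dzbar 1 (toC r)) p * dz 1 (toC r) p * dzbar 0 (toC r) p
  - dz 1 (dzbar 0 (toC r)) p * dz 0 (toC r) p * dzbar 1 (toC r) p
  + dz 1 (dzbar 1 (toC r)) p * dz 0 (toC r) p * dzbar 0 (toC r) p.
Proof.
apply/funext => p; rewrite /levi hessE !mxE /=.
exact: levi_alg (dz_toC_conj _ _ _) (dz_toC_conj _ _ _).
Qed.

Let mixed_alg (b00 b01 b10 b11 a0 a1 c0 c1 : R[i]) : conj c0 = a0 -> conj c1 = a1 ->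
  b00 * a1 * conj c0 + b01 * a1 * conj c1 + (b10 * - a0 * conj c0 + b11 * - a0 * conj c1) =
  b00 * a1 * a0 + b01 * a1 * a1 - b10 * a0 * a0 - b11 * a0 * a1.
Proof. by move=> -> ->; ring. Qed.

Lemma dzbar_toC_conj f j p : conj (dzbar j (toC f) p) = dz j (toC f) p.
Proof. by rewrite -dz_toC_conj; exact: conj_K. Qed.

Lemma mixedE r : mixed r = fun p =>
  dz 0 (dzbar 0 (toC r)) p * dz 1 (toC r) p * dz 0 (toC r) p
  + dz 0 (dzbar 1 (toC r)) p * dz 1 (toC r) p * dz 1 (toC r) p
  - dz 1 (dzbar 0 (toC r)) p * dz 0 (toC r) p * dz 0 (toC r) p
  - dz 1 (dzbar 1 (toC r)) p * dz 0 (toC r) p * dz 1 (toC r) p.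
Proof.
apply/funext => p; rewrite /mixed hessE !mxE /=.
exact: mixed_alg (dzbar_toC_conj _ _ _) (dzbar_toC_conj _ _ _).
Qed.

Lemma hess_conj r j k p : smooth_on U r -> U p ->
  conj (dz j (dzbar k (toC r)) p) = dz k (dzbar j (toC r)) p.
Proof.
move=> sr Up; have sF := csmooth_toC oU sr.
rewrite -(dzbarJ j oU (csmooth_dzbar k oU sF) Up).
transitivity (dzbar j (dz k (toC r)) p).
  by apply: (eq_dzbar j oU Up) => q Uq; exact: dzbar_toC_conj.
by rewrite (dz_dzbarC k j oU sF Up).
Qed.

(** Smoothness is carried along with the value of the derivative, so that the product rule can be
    applied to long expressions by composing proof terms. *)
Definition is_dzbar l p F d := csmooth U F /\ dzbar l F p = d.

Lemma is_dzbarM l p F G d e : U p -> is_dzbar l p F d -> is_dzbar l p G e ->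
  is_dzbar l p (fun q => F q * G q) (d * G p + F p * e).
Proof.
move=> Up [sF <-] [sG <-]; split; first exact: csmoothM.
by rewrite (dzbarM l oU sF sG Up) addrC mulrC.
Qed.

Lemma is_dzbarD l p F G d e : U p -> is_dzbar l p F d -> is_dzbar l p G e ->
  is_dzbar l p (fun q => F q + G q) (d + e).
Proof.
move=> Up [sF <-] [sG <-]; split; first exact: csmoothD.
by rewrite (dzbarD l oU sF sG Up).
Qed.

Lemma is_dzbarB l p F G d e : U p -> is_dzbar l p F d -> is_dzbar l p G e ->
  is_dzbar l p (fun q => F q - G q) (d - e).
Proof.
move=> Up dF [sG <-]; apply: is_dzbarD => //; split; first exact: csmoothN.
by rewrite (dzbarN l oU sG Up).
Qed.

Section JetsAt.
Variables (r : C2 R -> R) (sr : smooth_on U r).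
Let sF := csmooth_toC oU sr.

Let sa j := csmooth_dz j oU sF.
Let sc j := csmooth_dzbar j oU sF.
Let sb j k := csmooth_dz j oU (sc k).

Let Da p (Up : U p) l j : is_dzbar l p (dz j (toC r)) (dz j (dzbar l (toC r)) p).
Proof. by split; [exact: sa|rewrite (dz_dzbarC j l oU sF Up)]. Qed.

Let Dc p l j : is_dzbar l p (dzbar j (toC r)) (dzbar l (dzbar j (toC r)) p).
Proof. by split; [exact: sc|]. Qed.

Let Db p l j k : is_dzbar l p (dz j (dzbar k (toC r))) (dzbar l (dz j (dzbar k (toC r))) p).
Proof. by split; [exact: sb|]. Qed.

Let t_sym p (Up : U p) l j k :
  dzbar l (dz j (dzbar k (toC r))) p = dzbar k (dz j (dzbar l (toC r))) p.
Proof.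
rewrite -(dz_dzbarC j l oU (sc k) Up) -(dz_dzbarC j k oU (sc l) Up).
apply: (eq_dz j oU Up) => q Uq; exact: (dzbar_dzbarC l k oU sF Uq).
Qed.

Lemma csmooth_levi : csmooth U (levi r).
Proof.
rewrite leviE; have M F G H sF sG sH := csmoothM oU (@csmoothM _ U F G oU sF sG) (sH : csmooth U H).
exact: (csmoothD oU (csmoothD oU (csmoothD oU (M _ _ _ (sb 0 0) (sa 1) (sc 1))
  (csmoothN oU (M _ _ _ (sb 0 1) (sa 1) (sc 0)))) (csmoothN oU (M _ _ _ (sb 1 0) (sa 0) (sc 1))))
  (M _ _ _ (sb 1 1) (sa 0) (sc 0))).
Qed.

Lemma csmooth_mixed : csmooth U (mixed r).
Proof.
rewrite mixedE; have M F G H sF sG sH := csmoothM oU (@csmoothM _ U F G oU sF sG) (sH : csmooth U H).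
exact: (csmoothD oU (csmoothD oU (csmoothD oU (M _ _ _ (sb 0 0) (sa 1) (sa 0))
  (M _ _ _ (sb 0 1) (sa 1) (sa 1))) (csmoothN oU (M _ _ _ (sb 1 0) (sa 0) (sa 0))))
  (csmoothN oU (M _ _ _ (sb 1 1) (sa 0) (sa 1)))).
Qed.

(** Variants with two conjugate indices interchanged: equal higher derivatives reached in different
    orders must become the same unknown in [transport_identity]. *)
Let DbS p (Up : U p) l j k :
  is_dzbar l p (dz j (dzbar k (toC r))) (dzbar k (dz j (dzbar l (toC r))) p).
Proof. by split; [exact: sb|exact: t_sym]. Qed.

Let DcS p (Up : U p) l j : is_dzbar l p (dzbar j (toC r)) (dzbar j (dzbar l (toC r)) p).
Proof. by split; [exact: sc|exact: (dzbar_dzbarC l j oU sF Up)]. Qed.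

(** [levi] and [mixed] are the values of the conjugate linear form [hess r L _] on L and N. These
    span, so if both values vanish then so does the form. *)
Let null_alg (b00 b01 b10 b11 a0 a1 c0 c1 g : R[i]) : a0 * c0 + a1 * c1 = g -> g != 0 ->
  b00 * a1 * c1 - b01 * a1 * c0 - b10 * a0 * c1 + b11 * a0 * c0 = 0 ->
  b00 * a1 * a0 + b01 * a1 * a1 - b10 * a0 * a0 - b11 * a0 * a1 = 0 ->
  b00 * a1 - b10 * a0 = 0 /\ b01 * a1 - b11 * a0 = 0.
Proof.
move=> gE g0 A0 h0; split; apply: (mulIf g0); rewrite mul0r -gE.
- transitivity (c0 * (b00 * a1 * a0 + b01 * a1 * a1 - b10 * a0 * a0 - b11 * a0 * a1) +
    a1 * (b00 * a1 * c1 - b01 * a1 * c0 - b10 * a0 * c1 + b11 * a0 * c0)); first by ring.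
  by rewrite A0 h0 !mulr0 addr0.
- transitivity (c1 * (b00 * a1 * a0 + b01 * a1 * a1 - b10 * a0 * a0 - b11 * a0 * a1) -
    a0 * (b00 * a1 * c1 - b01 * a1 * c0 - b10 * a0 * c1 + b11 * a0 * c0)); first by ring.
  by rewrite A0 h0 !mulr0 subr0.
Qed.

Let null_conj (b00 b01 b10 b11 a0 a1 c0 c1 : R[i]) : conj a0 = c0 -> conj a1 = c1 ->
  conj b00 = b00 -> conj b01 = b10 -> conj b11 = b11 ->
  b00 * a1 - b10 * a0 = 0 -> b01 * a1 - b11 * a0 = 0 ->
  b00 * c1 - b01 * c0 = 0 /\ b10 * c1 - b11 * c0 = 0.
Proof.
move=> <- <- h00 <- h11 u0 u1; split.
- have : conj (b00 * a1 - conj b01 * a0) = 0 by rewrite u0; exact: rmorph0.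
  by rewrite !conj_simp h00.
- have : conj (b01 * a1 - b11 * a0) = 0 by rewrite u1; exact: rmorph0.
  by rewrite !conj_simp h11.
Qed.

Lemma grad2E p : dz 0 (toC r) p * dzbar 0 (toC r) p + dz 1 (toC r) p * dzbar 1 (toC r) p
  = (grad2 r p)%:C.
Proof.
by rewrite -(dz_toC_conj r 0 p) -(dz_toC_conj r 1 p) /grad2; move: (dz 0 _ p) (dz 1 _ p) => a b;
  rewrite !nsqE -rmorphD.
Qed.

(* On the null set of the Levi form the normal derivative of [levi] is the
   derivative of [mixed] along [conj L]: their third order terms coincide, and
   all other terms contain a factor [hess r L _] or its conjugate. *)
Lemma levi_transport p : U p -> 0 < grad2 r p -> levi r p = 0 -> mixed r p = 0 ->
  dz 0 (toC r) p * dzbar 0 (levi r) p + dz 1 (toC r) p * dzbar 1 (levi r) p =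
  dzbar 1 (toC r) p * dzbar 0 (mixed r) p - dzbar 0 (toC r) p * dzbar 1 (mixed r) p.
Proof.
move=> Up g0; rewrite leviE mixedE => A0 h0.
have gn0 : (grad2 r p)%:C != 0 :> R[i].
  by apply/eqP => /(congr1 Re) /= E; rewrite E ltxx in g0.
have [u0 u1] := null_alg (grad2E p) gn0 A0 h0.
have [w0 w1] := null_conj (dz_toC_conj r 0 p) (dz_toC_conj r 1 p)
  (hess_conj 0 0 sr Up) (hess_conj 0 1 sr Up) (hess_conj 1 1 sr Up) u0 u1.
have M l F G H (d e m : R[i]) dF dG dH := @is_dzbarM l p _ H _ m Up (@is_dzbarM l p F G d e Up dF dG) dH.
have DA0 := is_dzbarD Up (is_dzbarB Up (is_dzbarB Up (M 0 _ _ _ _ _ _ (Db p 0 0 0) (Da Up 0 1) (Dc p 0 1))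
  (M 0 _ _ _ _ _ _ (DbS Up 0 0 1) (Da Up 0 1) (Dc p 0 0)))
  (M 0 _ _ _ _ _ _ (Db p 0 1 0) (Da Up 0 0) (Dc p 0 1)))
  (M 0 _ _ _ _ _ _ (DbS Up 0 1 1) (Da Up 0 0) (Dc p 0 0)).
have DA1 := is_dzbarD Up (is_dzbarB Up (is_dzbarB Up (M 1 _ _ _ _ _ _ (Db p 1 0 0) (Da Up 1 1) (Dc p 1 1))
  (M 1 _ _ _ _ _ _ (Db p 1 0 1) (Da Up 1 1) (DcS Up 1 0)))
  (M 1 _ _ _ _ _ _ (Db p 1 1 0) (Da Up 1 0) (Dc p 1 1)))
  (M 1 _ _ _ _ _ _ (Db p 1 1 1) (Da Up 1 0) (DcS Up 1 0)).
have Dh0 := is_dzbarB Up (is_dzbarB Up (is_dzbarD Up (M 0 _ _ _ _ _ _ (Db p 0 0 0) (Da Up 0 1) (Da Up 0 0))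
  (M 0 _ _ _ _ _ _ (DbS Up 0 0 1) (Da Up 0 1) (Da Up 0 1)))
  (M 0 _ _ _ _ _ _ (Db p 0 1 0) (Da Up 0 0) (Da Up 0 0)))
  (M 0 _ _ _ _ _ _ (DbS Up 0 1 1) (Da Up 0 0) (Da Up 0 1)).
have Dh1 := is_dzbarB Up (is_dzbarB Up (is_dzbarD Up (M 1 _ _ _ _ _ _ (Db p 1 0 0) (Da Up 1 1) (Da Up 1 0))
  (M 1 _ _ _ _ _ _ (Db p 1 0 1) (Da Up 1 1) (Da Up 1 1)))
  (M 1 _ _ _ _ _ _ (Db p 1 1 0) (Da Up 1 0) (Da Up 1 0)))
  (M 1 _ _ _ _ _ _ (Db p 1 1 1) (Da Up 1 0) (Da Up 1 1)).
rewrite (DA0.2) (DA1.2) (Dh0.2) (Dh1.2).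
exact: transport_identity u0 u1 w0 w1.
Qed.

End JetsAt.
End Jets.

(** * Positivity near the boundary *)

Section OneSided.
Variables (R : realType) (U : set (C2 R)).
Hypothesis oU : open U.
Implicit Types (f r : C2 R -> R) (p : C2 R).

Lemma smooth_near_gt f p (c : R) : smooth_on U f -> U p -> c < f p ->
  \forall q \near p, c < f q.
Proof.
move=> sf Up fc; have cf : f x @[x --> p] --> f p := smooth_on_continuous sf Up.
by have := @cvgr_gt _ _ _ _ _ _ cf c fc; apply.
Qed.

Lemma smooth_near_lt f p (c : R) : smooth_on U f -> U p -> f p < c ->
  \forall q \near p, f q < c.
Proof.
move=> sf Up fc; have cf : f x @[x --> p] --> f p := smooth_on_continuous sf Up.
by have := @cvgr_lt _ _ _ _ _ _ cf c fc; apply.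
Qed.

(* Follow the direction n from p to the zero set of r, along which
   [f - lam * r] decreases. *)
Lemma one_sided_bound f r p0 n (lam : R) : smooth_on U f -> smooth_on U r ->
  U p0 -> r p0 = 0 -> (forall p, U p -> r p = 0 -> 0 <= f p) ->
  0 < dmap r p0 n -> dmap f p0 n < lam * dmap r p0 n ->
  \forall p \near p0, r p < 0 -> lam * r p <= f p.
Proof.
move=> sf sr Up0 rp0 f0 dr df.
pose w p := f p - lam * r p.
have sl : smooth_on U (fun p => lam * r p) by exact: smooth_onM (smooth_on_cst lam oU) sr.
have sw : smooth_on U w by exact: smooth_onB.
have dw : dmap w p0 n < 0.
  rewrite -(smooth_on_derive n oU sw Up0) deriveB; first last.
  - by case: (smooth_on_is_derive n oU sl Up0).
  - by case: (smooth_on_is_derive n oU sf Up0).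
  rewrite (smooth_on_derive n oU sf Up0) deriveZ; last by case: (smooth_on_is_derive n oU sr Up0).
  by rewrite (smooth_on_derive n oU sr Up0) subr_lt0.
set c0 := dmap r p0 n / 2.
have c00 : 0 < c0 by rewrite divr_gt0.
have nr : \forall q \near p0, c0 < dmap r q n.
  by apply: smooth_near_gt (smooth_on_dmap n oU sr) Up0 _; rewrite ltr_pdivrMr // ltr_pMr // ltr1n.
have nw : \forall q \near p0, dmap w q n < 0.
  exact: smooth_near_lt (smooth_on_dmap n oU sw) Up0 dw.
have nU : \forall q \near p0, U q by exact: open_nbhs_nbhs.
have [d /= d0 Hd] := (nbhs_ballP p0 _).1 (filterI nU (filterI nr nw)).
pose N := `|n| + 1.
have N0 : 0 < N by rewrite ltr_wpDl.
(* A path of this duration starting within d / 2 of [p0] stays in the ball of radius d, where the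
   derivatives along [n] keep their signs. *)
pose tau := d / (2 * N).
have tau0 : 0 < tau by rewrite divr_gt0 // mulr_gt0.
have path p t : `|p0 - p| < d / 2 -> 0 <= t <= tau ->
    [/\ U (p + t *: n), c0 < dmap r (p + t *: n) n & dmap w (p + t *: n) n < 0].
  move=> pd /andP[t0 tt]; have [|? []//] := Hd (p + t *: n).
  rewrite -ball_normE /= opprD addrA; apply: le_lt_trans (ler_normB _ _) _.
  rewrite normrZ (ger0_norm t0) [ltRHS](splitr d); apply: ltr_leD => //.
  have : t * `|n| <= tau * N by apply: ler_pM => //; rewrite lerDl.
  by rewrite /tau invfM mulrA mulfVK // gt_eqF.
have dpath g p t : smooth_on U g -> `|p0 - p| < d / 2 -> 0 <= t <= tau ->
    is_derive t 1 (fun t => g (p + t *: n)) (dmap g (p + t *: n) n).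
  move=> sg pd tt; have [Ut _ _] := path p t pd tt.
  have [D <-] := smooth_on_is_derive n oU sg Ut.
  exact: is_derive_line D.
have nb : \forall p \near p0, `|p0 - p| < d / 2.
  by apply/nbhs_ballP; exists (d / 2); rewrite /= ?divr_gt0 // => q; rewrite -ball_normE.
(* Along the path [r] grows at a rate above [c0], so from this height it becomes positive by the
   time [tau] and has a zero on the way. *)
have ns : \forall p \near p0, - (tau * c0) < r p.
  by apply: smooth_near_gt sr Up0 _; rewrite rp0 oppr_lt0 mulr_gt0.
near=> p => rp.
have pd : `|p0 - p| < d / 2 by near: p.
have rs : - (tau * c0) < r p by near: p.
pose rt t := r (p + t *: n); pose wt t := w (p + t *: n).
have rt0 : rt 0 = r p by rewrite /rt scale0r addr0.
have wt0 : wt 0 = w p by rewrite /wt scale0r addr0.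
have crt (a b : R) : 0 <= a -> b <= tau -> {within `[a, b], continuous rt}.
  move=> a0 bt; apply: derivable_within_continuous => t; rewrite in_itv /= => /andP[ta tb].
  by case: (dpath r p t sr pd _) => //; rewrite (le_trans a0 ta) (le_trans tb bt).
have [c + E] : exists2 c, c \in `]0, tau[ & rt tau - rt 0 = dmap r (p + c *: n) n * (tau - 0).
  apply: MVT tau0 _ (crt _ _ _ _) => // t; rewrite in_itv /= => /andP[ta tb].
  by apply: dpath; rewrite ?(ltW ta) ?(ltW tb).
rewrite in_itv /= => /andP[ca cb].
have ctau : 0 <= c <= tau by rewrite !ltW.
have [_ rc _] := path p c pd ctau.
have rtau : 0 < rt tau.
  move: E; rewrite subr0 rt0 => /(canRL (subrK _)) ->.
  have : tau * c0 < dmap r (p + c *: n) n * tau by rewrite mulrC ltr_pM2r.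
  by lra.
have [] := @IVT R rt 0 tau 0 (ltW tau0) (crt _ _ _ _) => //.
  by rewrite rt0 ge_min le_max (ltW rp) (ltW rtau) orbT.
move=> z; rewrite in_itv /= => /andP[z0 zt] rz.
have ztau : 0 <= z <= tau by rewrite z0.
have [Uz _ _] := path p z pd ztau.
have wz : wt z <= wt 0.
  have dwt t : 0 <= t <= z -> is_derive t 1 wt (dmap w (p + t *: n) n).
    by move=> /andP[t0 tz]; apply: dpath => //; rewrite t0 (le_trans tz zt).
  have [||y] := @MVT_segment R wt (fun t => dmap w (p + t *: n) n) 0 z z0.
  - by move=> t; rewrite in_itv /= => /andP[t0 tz]; apply: dwt; rewrite !ltW.
  - apply: derivable_within_continuous => t; rewrite in_itv /= => tz.
    by case: (dwt t tz).
  rewrite in_itv /= => /andP[y0 yz] E'.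
  have ytau : 0 <= y <= tau by rewrite y0 (le_trans yz zt).
  have [_ _ wy] := path p y pd ytau.
  by rewrite -subr_le0 E' mulr_le0_ge0 ?subr_ge0 // ltW.
have : 0 <= wt z by rewrite /wt /w [r _]rz mulr0 subr0 f0.
by rewrite -[lam * _ <= _]subr_ge0 -/(w p) -wt0 => wz0; exact: le_trans wz.
Unshelve. all: by end_near. Qed.

End OneSided.

Section HermitianFrame.
Variable R : realType.
Local Notation Re := (@complex.Re R).
Local Notation conj := (@Num.conj _ : R[i] -> R[i]).

Lemma real_of_conj (z : R[i]) : conj z = z -> z = (Re z)%:C.
Proof.
by move=> /(congr1 (@complex.Im R)) h; apply: eq_ReIm => //=; move: h; rewrite cImJ; lra.
Qed.

Lemma hermitian_pos_frame (m00 m01 m10 m11 a0 a1 x0 x1 z0 z1 al be ga : R[i]) :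
  conj m00 = m00 -> conj m01 = m10 -> conj m11 = m11 -> conj a0 = x0 -> conj a1 = x1 ->
  m00 * a1 * x1 - m01 * a1 * x0 - m10 * a0 * x1 + m11 * a0 * x0 = al ->
  m00 * x0 * a0 + m01 * x0 * a1 + m10 * x1 * a0 + m11 * x1 * a1 = be ->
  m00 * a1 * a0 + m01 * a1 * a1 - m10 * a0 * a0 - m11 * a0 * a1 = ga ->
  0 < nsq a0 + nsq a1 -> 0 < Re al -> nsq ga <= Re al * Re be ->
  0 <= Re (m00 * z0 * conj z0 + m01 * z0 * conj z1 + m10 * z1 * conj z0 + m11 * z1 * conj z1).
Proof.
move=> h00 h01 h11 h0 h1 E1 E2 E3; apply: hermitian_pos => //; rewrite ?h0 ?h1 ?E1 ?E2 //.
- apply: real_of_conj; rewrite -E1 -h0 -h1 -h01 !(conj_D, conj_N, conj_M, conj_K) h00 h11.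
  by move: (conj a0) (conj a1) (conj m01) => *; ring.
- apply: real_of_conj; rewrite -E2 -h0 -h1 -h01 !(conj_D, conj_N, conj_M, conj_K) h00 h11.
  by move: (conj a0) (conj a1) (conj m01) => *; ring.
Qed.

(** [A], [T], [N], [c2] stand for the Levi form, [tang], [norm_part] and the squared modulus of
    [cross]. The LL entry is at least d^2 eta and the NN entry at least k g^2 / 2, so the common
    factor d^2 cancels against the off-diagonal term. *)
Lemma determinant_bound (k g d A T N lam eta c2 : R) : 0 < k -> 0 < g -> 0 < d -> 0 < eta ->
  - (lam * d) <= A -> lam + eta < T -> c2 < eta * (k / 2 * g ^+ 2) ->
  0 < k / 2 * g ^+ 2 + d * N ->
  0 < d * (A + d * T) /\ d ^+ 2 * c2 <= d * (A + d * T) * (k * g ^+ 2 + d * N).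
Proof.
move=> k0 g0 d0 eta0 hA hT hc hN.
have G0 : 0 < k / 2 * g ^+ 2 by rewrite !mulr_gt0 ?exprn_gt0 ?invr_gt0.
have B : k / 2 * g ^+ 2 <= k * g ^+ 2 + d * N by lra.
move: (k / 2 * g ^+ 2) (k * g ^+ 2 + d * N) G0 B hc {hN k0 g0} => G S G0 GS hc.
have a1 : d * eta < A + d * T.
  by have := ltr_pM2l d0 (lam + eta) T; rewrite hT mulrDr [d * lam]mulrC; lra.
have a0 : 0 < A + d * T by apply: lt_trans a1; rewrite mulr_gt0.
split; first by rewrite mulr_gt0.
rewrite expr2 -!mulrA ler_pM2l //.
apply: (@le_trans _ _ (d * (eta * G))); first by rewrite ler_pM2l // ltW.
by rewrite mulrA; apply: ler_pM => //; rewrite ?ltW // mulr_gt0.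
Qed.

End HermitianFrame.

(** * The hermitian form of a weighted defining function *)

Section LocalPositivity.
Variables (R : realType) (U : set (C2 R)).
Hypothesis oU : open U.
Local Notation Re := (@complex.Re R).
Local Notation conj := (@Num.conj _ : R[i] -> R[i]).
Variables (r psi : C2 R -> R) (k : R).
Hypotheses (sr : smooth_on U r) (sp : smooth_on U psi).

Let sF := csmooth_toC oU sr.
Let sG := csmooth_toC oU sp.

Let a j := dz j (toC r).
Let x j := dzbar j (toC r).
Let b i j := dz i (dzbar j (toC r)).
Let c j := dz j (toC psi).
Let y j := dzbar j (toC psi).
Let e i j := dz i (dzbar j (toC psi)).
Let d p : R[i] := (- r p)%:C.

Let sa j : csmooth U (a j). Proof. exact: csmooth_dz. Qed.
Let sx j : csmooth U (x j). Proof. exact: csmooth_dzbar. Qed.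
Let sb i j : csmooth U (b i j). Proof. exact: csmooth_dz (sx j). Qed.
Let sc j : csmooth U (c j). Proof. exact: csmooth_dz. Qed.
Let sy j : csmooth U (y j). Proof. exact: csmooth_dzbar. Qed.
Let se i j : csmooth U (e i j). Proof. exact: csmooth_dz (sy j). Qed.
Let sd : csmooth U d. Proof. exact: (csmooth_toC oU (smooth_onN oU sr)). Qed.
Let ka : R[i] := k%:C.

Let conj_a j p : conj (a j p) = x j p. Proof. exact: dz_toC_conj. Qed.
Let conj_c j p : conj (c j p) = y j p. Proof. exact: dz_toC_conj. Qed.
Let conj_b i j p : U p -> conj (b i j p) = b j i p. Proof. exact: hess_conj. Qed.
Let conj_e i j p : U p -> conj (e i j p) = e j i p. Proof. exact: hess_conj. Qed.

(* The hermitian form [(- s) hess s Z Z + k |ds(Z)|^2] of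
   [s = r * exp (- psi)], up to the factor [exp (- 2 psi)]. *)
Definition weight_form i j p : R[i] :=
  d p * b i j p - (1 - ka) * d p * (a i p * y j p + c i p * x j p)
  + d p * d p * (e i j p - (1 - ka) * c i p * y j p) + ka * a i p * x j p.

(* The values of the form on the frame [Lfield], [Nfield] of [r] are
   [d * (levi + d * tang)], [k * grad2 ^+ 2 + d * norm_part], [d * cross],
   where [d = - r]. *)
Definition tang p : R[i] :=
  e 0 0 p * a 1 p * x 1 p - e 0 1 p * a 1 p * x 0 p - e 1 0 p * a 0 p * x 1 p + e 1 1 p * a 0 p * x 0 p
  - (1 - ka) * ((a 1 p * c 0 p - a 0 p * c 1 p) * (x 1 p * y 0 p - x 0 p * y 1 p)).

Definition norm_part p : R[i] :=
  b 0 0 p * x 0 p * a 0 p + b 0 1 p * x 0 p * a 1 p + b 1 0 p * x 1 p * a 0 p + b 1 1 p * x 1 p * a 1 p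
  - (1 - ka) * (a 0 p * x 0 p + a 1 p * x 1 p) *
     (x 0 p * c 0 p + x 1 p * c 1 p + (a 0 p * y 0 p + a 1 p * y 1 p))
  + d p * (e 0 0 p * x 0 p * a 0 p + e 0 1 p * x 0 p * a 1 p + e 1 0 p * x 1 p * a 0 p + e 1 1 p * x 1 p * a 1 p
    - (1 - ka) * ((x 0 p * c 0 p + x 1 p * c 1 p) * (a 0 p * y 0 p + a 1 p * y 1 p))).

Definition cross p : R[i] :=
  (b 0 0 p * a 1 p * a 0 p + b 0 1 p * a 1 p * a 1 p - b 1 0 p * a 0 p * a 0 p - b 1 1 p * a 0 p * a 1 p)
  - (1 - ka) * (a 0 p * x 0 p + a 1 p * x 1 p) * (a 1 p * c 0 p - a 0 p * c 1 p)
  + d p * (e 0 0 p * a 1 p * a 0 p + e 0 1 p * a 1 p * a 1 p - e 1 0 p * a 0 p * a 0 p - e 1 1 p * a 0 p * a 1 p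
    - (1 - ka) * ((a 1 p * c 0 p - a 0 p * c 1 p) * (a 0 p * y 0 p + a 1 p * y 1 p))).

Ltac csm := lazymatch goal with
  | |- csmooth _ (fun q => @?F q + - @?G q) => refine (csmoothD oU _ (csmoothN oU _)); csm
  | |- csmooth _ (fun q => @?F q + @?G q) => refine (csmoothD oU _ _); csm
  | |- csmooth _ (fun q => @?F q * @?G q) => refine (csmoothM oU _ _); csm
  | |- csmooth _ (a ?j) => exact (sa j)
  | |- csmooth _ (x ?j) => exact (sx j)
  | |- csmooth _ (b ?i ?j) => exact (sb i j)
  | |- csmooth _ (c ?j) => exact (sc j)
  | |- csmooth _ (y ?j) => exact (sy j)
  | |- csmooth _ (e ?i ?j) => exact (se i j)
  | |- csmooth _ d => exact sd
  | |- csmooth _ (fun q => ?k) => exact (csmooth_cst _ oU)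
  end.

Let s_tang : csmooth U tang.
Proof. rewrite /tang; csm. Qed.
Let s_norm : csmooth U norm_part.
Proof. rewrite /norm_part; csm. Qed.
Let s_cross : csmooth U cross.
Proof. rewrite /cross; csm. Qed.

Let frame_L (B00 B01 B10 B11 A0 A1 X0 X1 C0 C1 Y0 Y1 E00 E01 E10 E11 D K : R[i]) :
  (D * B00 - (1 - K) * D * (A0 * Y0 + C0 * X0) + D * D * (E00 - (1 - K) * C0 * Y0) + K * A0 * X0) * A1 * X1
  - (D * B01 - (1 - K) * D * (A0 * Y1 + C0 * X1) + D * D * (E01 - (1 - K) * C0 * Y1) + K * A0 * X1) * A1 * X0
  - (D * B10 - (1 - K) * D * (A1 * Y0 + C1 * X0) + D * D * (E10 - (1 - K) * C1 * Y0) + K * A1 * X0) * A0 * X1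
  + (D * B11 - (1 - K) * D * (A1 * Y1 + C1 * X1) + D * D * (E11 - (1 - K) * C1 * Y1) + K * A1 * X1) * A0 * X0
  = D * ((B00 * A1 * X1 - B01 * A1 * X0 - B10 * A0 * X1 + B11 * A0 * X0) +
     D * (E00 * A1 * X1 - E01 * A1 * X0 - E10 * A0 * X1 + E11 * A0 * X0
  - (1 - K) * ((A1 * C0 - A0 * C1) * (X1 * Y0 - X0 * Y1)))).
Proof. by ring. Qed.

Let frame_N (B00 B01 B10 B11 A0 A1 X0 X1 C0 C1 Y0 Y1 E00 E01 E10 E11 D K : R[i]) :
  (D * B00 - (1 - K) * D * (A0 * Y0 + C0 * X0) + D * D * (E00 - (1 - K) * C0 * Y0) + K * A0 * X0) * X0 * A0
  + (D * B01 - (1 - K) * D * (A0 * Y1 + C0 * X1) + D * D * (E01 - (1 - K) * C0 * Y1) + K * A0 * X1) * X0 * A1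
  + (D * B10 - (1 - K) * D * (A1 * Y0 + C1 * X0) + D * D * (E10 - (1 - K) * C1 * Y0) + K * A1 * X0) * X1 * A0
  + (D * B11 - (1 - K) * D * (A1 * Y1 + C1 * X1) + D * D * (E11 - (1 - K) * C1 * Y1) + K * A1 * X1) * X1 * A1
  = K * ((A0 * X0 + A1 * X1) * (A0 * X0 + A1 * X1)) + D * (
    B00 * X0 * A0 + B01 * X0 * A1 + B10 * X1 * A0 + B11 * X1 * A1
  - (1 - K) * (A0 * X0 + A1 * X1) *
     (X0 * C0 + X1 * C1 + (A0 * Y0 + A1 * Y1))
  + D * (E00 * X0 * A0 + E01 * X0 * A1 + E10 * X1 * A0 + E11 * X1 * A1
    - (1 - K) * ((X0 * C0 + X1 * C1) * (A0 * Y0 + A1 * Y1)))).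
Proof. by ring. Qed.

Let frame_LN (B00 B01 B10 B11 A0 A1 X0 X1 C0 C1 Y0 Y1 E00 E01 E10 E11 D K : R[i]) :
  (D * B00 - (1 - K) * D * (A0 * Y0 + C0 * X0) + D * D * (E00 - (1 - K) * C0 * Y0) + K * A0 * X0) * A1 * A0
  + (D * B01 - (1 - K) * D * (A0 * Y1 + C0 * X1) + D * D * (E01 - (1 - K) * C0 * Y1) + K * A0 * X1) * A1 * A1
  - (D * B10 - (1 - K) * D * (A1 * Y0 + C1 * X0) + D * D * (E10 - (1 - K) * C1 * Y0) + K * A1 * X0) * A0 * A0
  - (D * B11 - (1 - K) * D * (A1 * Y1 + C1 * X1) + D * D * (E11 - (1 - K) * C1 * Y1) + K * A1 * X1) * A0 * A1
  = D * ((B00 * A1 * A0 + B01 * A1 * A1 - B10 * A0 * A0 - B11 * A0 * A1)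
  - (1 - K) * (A0 * X0 + A1 * X1) * (A1 * C0 - A0 * C1)
  + D * (E00 * A1 * A0 + E01 * A1 * A1 - E10 * A0 * A0 - E11 * A0 * A1
    - (1 - K) * ((A1 * C0 - A0 * C1) * (A0 * Y0 + A1 * Y1)))).
Proof. by ring. Qed.

Let conj_entry (B B' E E' A X A' X' C Y C' Y' D K : R[i]) :
  conj B = B' -> conj E = E' -> conj A = X -> conj C = Y -> conj X' = A' -> conj Y' = C' ->
  conj D = D -> conj K = K ->
  conj (D * B - (1 - K) * D * (A * Y' + C * X') + D * D * (E - (1 - K) * C * Y') + K * A * X') =
  D * B' - (1 - K) * D * (A' * Y + C' * X) + D * D * (E' - (1 - K) * C' * Y) + K * A' * X.
Proof.
move=> hB hE hA hC hX hY hD hK.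
have h1 : conj 1 = 1 by exact: rmorph1.
by rewrite !(conj_D, conj_N, conj_M) h1 hB hE hA hC hX hY hD hK; ring.
Qed.

Let conj_d p : conj (d p) = d p. Proof. exact: conj_real. Qed.
Let conj_k : conj ka = ka. Proof. exact: conj_real. Qed.
Let conj_x j p : conj (x j p) = a j p. Proof. exact: dzbar_toC_conj. Qed.
Let conj_y j p : conj (y j p) = c j p. Proof. exact: dzbar_toC_conj. Qed.

Let form_conj i j p : U p -> conj (weight_form i j p) = weight_form j i p.
Proof.
move=> Up; exact: conj_entry (conj_b i j Up) (conj_e i j Up) (conj_a i p) (conj_c i p)
  (conj_x j p) (conj_y j p) (conj_d p) conj_k.
Qed.

(** The Levi form enters only through its lower bound [lam * r]; [tang] has to exceed [lam] by a
    margin [eta] that pays for [cross]. Half of the leading NN term is kept in reserve against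
    [norm_part], which carries a factor - r. The other conditions are strict at [p0] and persist
    nearby. *)
Lemma weight_form_pos p0 (lam eta : R) : 0 < k -> U p0 -> r p0 = 0 -> 0 < grad2 r p0 ->
  (\forall p \near p0, r p < 0 -> lam * r p <= Re (levi r p)) ->
  0 < eta -> lam + eta < Re (tang p0) ->
  nsq (cross p0) < eta * (k / 2 * grad2 r p0 ^+ 2) ->
  \forall p \near p0, r p < 0 -> forall z0 z1 : R[i],
   0 <= Re (weight_form 0 0 p * z0 * conj z0 + weight_form 0 1 p * z0 * conj z1
    + weight_form 1 0 p * z1 * conj z0 + weight_form 1 1 p * z1 * conj z1).
Proof.
move=> k0 Up0 rp0 g0 near_levi eta0 ht hc.
have sg : smooth_on U (grad2 r).
  have [sR _] : csmooth U (fun p => a 0 p * x 0 p + a 1 p * x 1 p) by csm.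
  by apply: eq_smooth_on sR => // q _; rewrite (grad2E r q).
have near_ht : \forall p \near p0, lam + eta < Re (tang p).
  exact: smooth_near_gt (s_tang.1) Up0 ht.
have near_hc : \forall p \near p0, 0 < eta * (k / 2 * grad2 r p ^+ 2) - nsq (cross p).
  pose H p := eta * (k / 2 * grad2 r p ^+ 2) - nsq (cross p).
  have sH : smooth_on U H.
    apply: smooth_onB => //.
      apply: smooth_onM (smooth_on_cst _ oU) _ => //; apply: smooth_onM (smooth_on_cst _ oU) _ => //.
      exact: smooth_onM.
    by case: s_cross => s1 s2; apply: smooth_onD => //; exact: smooth_onM.
  by apply: smooth_near_gt sH Up0 _; rewrite /H subr_gt0.
have near_hb : \forall p \near p0, 0 < k / 2 * grad2 r p ^+ 2 - r p * Re (norm_part p).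
  pose H p := k / 2 * grad2 r p ^+ 2 - r p * Re (norm_part p).
  have sH : smooth_on U H.
    apply: smooth_onB => //.
      apply: smooth_onM (smooth_on_cst _ oU) _ => //; exact: smooth_onM.
    by apply: smooth_onM => //; exact: s_norm.1.
  by apply: smooth_near_gt sH Up0 _; rewrite /H rp0 mul0r subr0 !mulr_gt0 ?exprn_gt0 ?invr_gt0.
have near_hg : \forall p \near p0, 0 < grad2 r p by exact: smooth_near_gt sg Up0 g0.
have nU : \forall q \near p0, U q by exact: open_nbhs_nbhs.
near=> p => rp z0 z1.
have Up : U p by near: p.
have h1 : lam * r p <= Re (levi r p) by move: rp; near: p.
have h2 : lam + eta < Re (tang p) by near: p.
have h3 : 0 < eta * (k / 2 * grad2 r p ^+ 2) - nsq (cross p) by near: p.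
have h4 : 0 < k / 2 * grad2 r p ^+ 2 - r p * Re (norm_part p) by near: p.
have h5 : 0 < grad2 r p by near: p.
have gE : a 0 p * x 0 p + a 1 p * x 1 p = (grad2 r p)%:C := grad2E r p.
set dd := - r p; have dd0 : 0 < dd by rewrite oppr_gt0.
have [] := @determinant_bound R k (grad2 r p) dd (Re (levi r p)) (Re (tang p)) (Re (norm_part p))
  lam eta (nsq (cross p)) k0 h5 dd0 eta0 _ h2 _ _.
- by rewrite /dd mulrN opprK.
- by rewrite -subr_gt0.
- by rewrite /dd mulNr.
move=> al0 det.
have lv : levi r p = b 0 0 p * a 1 p * x 1 p - b 0 1 p * a 1 p * x 0 p - b 1 0 p * a 0 p * x 1 p
  + b 1 1 p * a 0 p * x 0 p by rewrite leviE.
have ReL : Re (d p * (levi r p + d p * tang p)) = dd * (Re (levi r p) + dd * Re (tang p)).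
  by rewrite Re_real cReD Re_real.
have ReN : Re (ka * ((a 0 p * x 0 p + a 1 p * x 1 p) * (a 0 p * x 0 p + a 1 p * x 1 p)) + d p * norm_part p)
   = k * grad2 r p ^+ 2 + dd * Re (norm_part p).
  by rewrite gE -rmorphM cReD Re_real Re_real /= expr2.
have nsqLN : nsq (d p * cross p) = dd ^+ 2 * nsq (cross p) by rewrite nsqM nsq_real.
rewrite -ReL -ReN -nsqLN in al0 det; rewrite lv in al0 det.
exact: (hermitian_pos_frame z0 z1 (form_conj 0 0 Up) (form_conj 0 1 Up) (form_conj 1 1 Up)
  (conj_a 0 p) (conj_a 1 p) (frame_L _ _ _ _ _ _ _ _ _ _ _ _ _ _ _ _ _ _)
  (frame_N _ _ _ _ _ _ _ _ _ _ _ _ _ _ _ _ _ _)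
  (frame_LN _ _ _ _ _ _ _ _ _ _ _ _ _ _ _ _ _ _) h5 al0 det).
Unshelve. all: by end_near. Qed.

End LocalPositivity.

(** * Exponential weights and compositions *)

Section Composition.
Variables (R : realType) (U : set (C2 R)).
Hypothesis oU : open U.
Local Notation Re := (@complex.Re R).
Local Notation conj := (@Num.conj _ : R[i] -> R[i]).
Implicit Types (f g r : C2 R -> R) (p : C2 R) (Z : 'rV[R[i]]_2).

Lemma dz_comp f (phi : R -> R) (d : R) j p : smooth_on U f -> U p ->
  is_derive (f p) 1 phi d -> dz j (toC (fun q => phi (f q))) p = d%:C * dz j (toC f) p.
Proof.
move=> sf Up dphi; rewrite !dz_toC_coord.
have P i : partial i (fun q => phi (f q)) p = d * partial i f p.
  have [_ E] := is_derive_comp_dmap (Defs.basis R i) oU sf Up dphi.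
  by rewrite [LHS]E dmap_basis.
rewrite !P; move: (partial _ f p) (partial _ f p) => x y.
by apply: eq_ReIm; rewrite ?cReM ?cImM /=; ring.
Qed.

Lemma dzbar_comp f (phi : R -> R) (d : R) j p : smooth_on U f -> U p ->
  is_derive (f p) 1 phi d -> dzbar j (toC (fun q => phi (f q))) p = d%:C * dzbar j (toC f) p.
Proof.
move=> sf Up dphi; rewrite -!dz_toC_conj (dz_comp j sf Up dphi).
by rewrite conj_M conj_real.
Qed.

Lemma hess_comp f (phi phi1 phi2 : R -> R) j k p : smooth_on U f ->
  smooth_on U (fun q => phi1 (f q)) ->
  (forall q, U q -> is_derive (f q) 1 phi (phi1 (f q))) ->
  (forall q, U q -> is_derive (f q) 1 phi1 (phi2 (f q))) -> U p ->
  dz j (dzbar k (toC (fun q => phi (f q)))) p =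
  (phi1 (f p))%:C * dz j (dzbar k (toC f)) p + (phi2 (f p))%:C * dz j (toC f) p * dzbar k (toC f) p.
Proof.
move=> sf s1 d1 d2 Up.
have sF := csmooth_toC oU sf; have sF1 := csmooth_toC oU s1.
rewrite (@eq_dz R U _ (fun q => toC (fun q => phi1 (f q)) q * dzbar k (toC f) q) j p oU Up); last first.
  by move=> q Uq; exact: dzbar_comp (d1 _ Uq).
rewrite (dzM j oU sF1 (csmooth_dzbar k oU sF) Up) (dz_comp j sf Up (d2 _ Up)).
congr (_ + _); exact: mulrC.
Qed.

Let hess_alg (h00 h01 h10 h11 u w f00 f01 f10 f11 a0 a1 c0 c1 z0 z1 : R[i]) :
  conj a0 = c0 -> conj a1 = c1 ->
  h00 = u * f00 + w * a0 * c0 -> h01 = u * f01 + w * a0 * c1 ->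
  h10 = u * f10 + w * a1 * c0 -> h11 = u * f11 + w * a1 * c1 ->
  h00 * z0 * conj z0 + h01 * z0 * conj z1 + (h10 * z1 * conj z0 + h11 * z1 * conj z1) =
  u * (f00 * z0 * conj z0 + f01 * z0 * conj z1 + (f10 * z1 * conj z0 + f11 * z1 * conj z1)) +
  w * ((z0 * a0 + z1 * a1) * conj (z0 * a0 + z1 * a1)).
Proof.
move=> <- <- -> -> -> ->; rewrite !(conj_D, conj_M).
by move: (conj a0) (conj a1) (conj z0) (conj z1) => *; ring.
Qed.

Lemma hess_compE f (phi phi1 phi2 : R -> R) Z p : smooth_on U f ->
  smooth_on U (fun q => phi1 (f q)) ->
  (forall q, U q -> is_derive (f q) 1 phi (phi1 (f q))) ->
  (forall q, U q -> is_derive (f q) 1 phi1 (phi2 (f q))) -> U p ->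
  Re (hess (fun q => phi (f q)) Z Z p) =
  phi1 (f p) * Re (hess f Z Z p) + phi2 (f p) * nsq (vect_app Z f p).
Proof.
move=> sf s1 d1 d2 Up; have H j k := hess_comp j k sf s1 d1 d2 Up.
have A := hess_alg (Z 0 0) (Z 0 1) (dz_toC_conj f 0 p) (dz_toC_conj f 1 p)
  (H 0 0) (H 0 1) (H 1 0) (H 1 1).
by rewrite [in LHS]hessE A nsqE -rmorphM cReD Re_real -hessE vect_appE.
Qed.

Section Weight.
Variables (r psi : C2 R -> R).
Hypotheses (sr : smooth_on U r) (sp : smooth_on U psi).
Let sF := csmooth_toC oU sr.
Let sG := csmooth_toC oU sp.
Let w p := expR (- psi p).
Let sN : smooth_on U (fun p => - psi p) := smooth_onN oU sp.

Lemma smooth_on_weight : smooth_on U w.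
Proof. exact: (smooth_on_comp oU (@expR_derive_closed R)). Qed.

Let sw := smooth_on_weight.
Let sW := csmooth_toC oU sw.

Let dzN_psi j p (Up : U p) : dz j (toC (fun q => - psi q)) p = - dz j (toC psi) p.
Proof.
rewrite -(dzN j oU sG Up); apply: (eq_dz j oU Up) => q _.
by apply: eq_ReIm => //=; rewrite oppr0.
Qed.

Let dz_w j p (Up : U p) : dz j (toC w) p = - (w p)%:C * dz j (toC psi) p.
Proof.
rewrite (dz_comp j sN Up (is_derive_expR _)) (dzN_psi j Up).
by rewrite mulrN mulNr.
Qed.

Let dzbar_w j p (Up : U p) : dzbar j (toC w) p = - (w p)%:C * dzbar j (toC psi) p.
Proof.
by rewrite -!dz_toC_conj (dz_w j Up) conj_M conj_N conj_real.
Qed.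

Let s p := r p * w p.
Let ss : smooth_on U s := smooth_onM oU sr sw.

Let toC_s : toC s = fun p => toC r p * toC w p.
Proof. by apply/funext => p; rewrite /toC /s rmorphM. Qed.

Lemma dz_weight j p : U p -> dz j (toC s) p = (w p)%:C * (dz j (toC r) p - (r p)%:C * dz j (toC psi) p).
Proof.
move=> Up; rewrite toC_s (dzM j oU sF sW Up) (dz_w j Up) /toC.
by move: (dz j _ p) (dz j _ p) ((w p)%:C) ((r p)%:C) => *; ring.
Qed.

Lemma dzbar_weight j p : U p ->
  dzbar j (toC s) p = (w p)%:C * (dzbar j (toC r) p - (r p)%:C * dzbar j (toC psi) p).
Proof.
move=> Up; rewrite toC_s (dzbarM j oU sF sW Up) (dzbar_w j Up) /toC.
by move: (dzbar j _ p) (dzbar j _ p) ((w p)%:C) ((r p)%:C) => *; ring.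
Qed.

Lemma dz_dzbar_weight j k p : U p -> dz j (dzbar k (toC s)) p =
  (w p)%:C * (dz j (dzbar k (toC r)) p - dz j (toC r) p * dzbar k (toC psi) p
    - dz j (toC psi) p * dzbar k (toC r) p
    - (r p)%:C * dz j (dzbar k (toC psi)) p + (r p)%:C * dz j (toC psi) p * dzbar k (toC psi) p).
Proof.
move=> Up; have sx := csmooth_dzbar k oU sF; have sy := csmooth_dzbar k oU sG.
have sry := csmoothM oU sF sy.
rewrite (@eq_dz R U _ (fun q => toC w q * (dzbar k (toC r) q - toC r q * dzbar k (toC psi) q)) j p oU Up); last first.
  by move=> q Uq; exact: dzbar_weight.
rewrite (dzM j oU sW (csmoothD oU sx (csmoothN oU sry)) Up) (dz_w j Up).
rewrite (dzD j oU sx (csmoothN oU sry) Up) (dzN j oU sry Up) (dzM j oU sF sy Up).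
move: (dz j (toC r) p) (dz j (toC psi) p) (dz j (dzbar k (toC r)) p) (dz j (dzbar k (toC psi)) p)
  (dzbar k (toC r) p) (dzbar k (toC psi) p).
rewrite /toC; move: ((w p)%:C) ((r p)%:C) => *; ring.
Qed.

Let weight_alg (W K M00 M01 M10 M11 S00 S01 S10 S11 s0 s1 t0 t1 b00 b01 b10 b11 a0 a1 x0 x1
    c0 c1 y0 y1 e00 e01 e10 e11 q z0 z1 u0 u1 : R[i]) :
  M00 = - q * b00 - (1 - K) * - q * (a0 * y0 + c0 * x0) + - q * - q * (e00 - (1 - K) * c0 * y0) + K * a0 * x0 ->
  M01 = - q * b01 - (1 - K) * - q * (a0 * y1 + c0 * x1) + - q * - q * (e01 - (1 - K) * c0 * y1) + K * a0 * x1 ->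
  M10 = - q * b10 - (1 - K) * - q * (a1 * y0 + c1 * x0) + - q * - q * (e10 - (1 - K) * c1 * y0) + K * a1 * x0 ->
  M11 = - q * b11 - (1 - K) * - q * (a1 * y1 + c1 * x1) + - q * - q * (e11 - (1 - K) * c1 * y1) + K * a1 * x1 ->
  S00 = W * (b00 - a0 * y0 - c0 * x0 - q * e00 + q * c0 * y0) ->
  S01 = W * (b01 - a0 * y1 - c0 * x1 - q * e01 + q * c0 * y1) ->
  S10 = W * (b10 - a1 * y0 - c1 * x0 - q * e10 + q * c1 * y0) ->
  S11 = W * (b11 - a1 * y1 - c1 * x1 - q * e11 + q * c1 * y1) ->
  s0 = W * (a0 - q * c0) -> s1 = W * (a1 - q * c1) ->
  t0 = W * (x0 - q * y0) -> t1 = W * (x1 - q * y1) ->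
  W * (W * (M00 * z0 * u0 + M01 * z0 * u1 + M10 * z1 * u0 + M11 * z1 * u1)) =
  - (q * W) * (S00 * z0 * u0 + S01 * z0 * u1 + (S10 * z1 * u0 + S11 * z1 * u1)) +
  K * ((z0 * s0 + z1 * s1) * (u0 * t0 + u1 * t1)).
Proof. by move=> -> -> -> -> -> -> -> -> -> -> -> ->; ring. Qed.

Lemma weight_formE k Z p : U p ->
  w p ^+ 2 * Re (weight_form r psi k 0 0 p * Z 0 0 * conj (Z 0 0) + weight_form r psi k 0 1 p * Z 0 0 * conj (Z 0 1)
    + weight_form r psi k 1 0 p * Z 0 1 * conj (Z 0 0) + weight_form r psi k 1 1 p * Z 0 1 * conj (Z 0 1)) =
  - s p * Re (hess s Z Z p) + k * nsq (vect_app Z s p).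
Proof.
move=> Up; have nq : (- r p)%:C = - (r p)%:C :> R[i] by rewrite rmorphN.
have wf i j : weight_form r psi k i j p = - (r p)%:C * dz i (dzbar j (toC r)) p
  - (1 - k%:C) * - (r p)%:C * (dz i (toC r) p * dzbar j (toC psi) p + dz i (toC psi) p * dzbar j (toC r) p)
  + - (r p)%:C * - (r p)%:C * (dz i (dzbar j (toC psi)) p - (1 - k%:C) * dz i (toC psi) p * dzbar j (toC psi) p)
  + k%:C * dz i (toC r) p * dzbar j (toC r) p by rewrite /weight_form nq.
have A := weight_alg (Z 0 0) (Z 0 1) (conj (Z 0 0)) (conj (Z 0 1)) (wf 0 0) (wf 0 1) (wf 1 0) (wf 1 1)
  (dz_dzbar_weight 0 0 Up) (dz_dzbar_weight 0 1 Up) (dz_dzbar_weight 1 0 Up) (dz_dzbar_weight 1 1 Up)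
  (dz_weight 0 Up) (dz_weight 1 Up) (dzbar_weight 0 Up) (dzbar_weight 1 Up).
rewrite expr2 -mulrA -2!Re_real A hessE vect_appE.
have -> : conj (Z 0 0) * dzbar 0 (toC s) p + conj (Z 0 1) * dzbar 1 (toC s) p =
    conj (Z 0 0 * dz 0 (toC s) p + Z 0 1 * dz 1 (toC s) p).
  rewrite -(dz_toC_conj s 0 p) -(dz_toC_conj s 1 p).
  by move: (dz 0 _ p) (dz 1 _ p) (Z 0 0) (Z 0 1) => *; rewrite !(conj_D, conj_M).
rewrite -rmorphM -rmorphN nsqE -rmorphM cReD Re_real; reflexivity.
Qed.

End Weight.
End Composition.

(* The outer function [- (flat 0 c - flat 0 (t + c)) `^ tau]: it is locally
   constant for [t <= - c], and near 0 it is at least as convex as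
   [- (- t) `^ (1 - k)]. *)
Section OuterFunction.
Variables (R : realType) (tau c : R).
Hypotheses (tau0 : 0 < tau) (tau1 : tau < 1) (c0 : 0 < c) (c4 : c <= 4^-1).

Definition gap (t : R) : R := flat 0 c - flat 0 (t + c).
Definition outer (t : R) : R := - (gap t `^ tau).
Definition outer1 (t : R) : R := tau * (gap t `^ (tau - 1) * flat 2 (t + c)).
Definition outer2 (t : R) : R :=
  tau * (gap t `^ (tau - 2) * ((1 - tau) * flat 2 (t + c) ^+ 2 + gap t * (flat 4 (t + c) - 2 * flat 3 (t + c)))).

Lemma gap_gt0 t : t < 0 -> 0 < gap t.
Proof. by move=> t0; rewrite subr_gt0 flat0_lt // gtrDr. Qed.

Let flatD k (t : R) : is_derive t 1 (fun t => flat k (t + c)) (- k%:R * flat k.+1 (t + c) + flat k.+2 (t + c)).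
Proof.
have H : is_derive t 1 (fun t : R => t + c) 1.
  by apply: is_derive_eq; rewrite addr0.
have D := is_derive_flat k (t + c); rewrite mul1r in D.
by apply: (is_derive_eq (@is_derive1_comp R (flat k) (fun t => t + c) t _ _ D H)); rewrite mulr1.
Qed.

Lemma is_derive_gap (t : R) : is_derive t 1 gap (- flat 2 (t + c)).
Proof.
have D := is_deriveB (is_derive_cst (flat 0 c) t 1) (flatD 0 t).
by apply: (is_derive_eq D); rewrite oppr0 mul0r !add0r.
Qed.

Lemma is_derive_gap_powR (a t : R) : t < 0 ->
  is_derive t 1 (fun t => gap t `^ a) (- (a * gap t `^ (a - 1) * flat 2 (t + c))).
Proof.
move=> t0; have D := is_derive1_powR a (gap_gt0 t0).
by apply: (is_derive_eq (@is_derive1_comp R (fun x => x `^ a) gap t _ _ D (is_derive_gap t))); rewrite mulrN.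
Qed.

Lemma is_derive_outer (t : R) : t < 0 -> is_derive t 1 outer (outer1 t).
Proof.
move=> t0; apply: (is_derive_eq (is_deriveN (is_derive_gap_powR tau t0))).
by rewrite opprK /outer1 mulrA.
Qed.

Lemma is_derive_outer1 (t : R) : t < 0 -> is_derive t 1 outer1 (outer2 t).
Proof.
move=> t0; have D := is_deriveM (is_derive_gap_powR (tau - 1) t0) (flatD 2 t).
have E := is_deriveM (is_derive_cst tau t 1) D.
apply: (is_derive_eq E); rewrite /outer2 /GRing.scale /= mulr0 addr0.
have -> : tau - 1 - 1 = tau - 2 by ring.
have -> : gap t `^ (tau - 1) = gap t * gap t `^ (tau - 2).
  rewrite mulrC -[X in _ * X]powRr1 ?(ltW (gap_gt0 t0)) // -powRD ?(gt_eqF (gap_gt0 t0)) ?implybT //.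
  by congr (_ `^ _); ring.
by rewrite /GRing.scale /=; move: (powR (gap t) (tau - 2)) (gap t) (flat 2 (t + c)) (flat 3 (t + c)) (flat 4 (t + c)) => *; ring.
Qed.

Lemma outer1_ge0 t : 0 <= outer1 t.
Proof. by rewrite /outer1 mulr_ge0 ?(ltW tau0) // mulr_ge0 ?powR_ge0 ?flat_ge0. Qed.

(** After division by tau * gap^(tau - 2) this is [flat_convexity] at x = t + c with kappa = 1 -
    tau. *)
Lemma outer_convex t : t < 0 -> (1 - tau) / 8 * outer1 t <= - t * outer2 t.
Proof.
(* For t <= - c every [flat] factor is 0, and so are both sides. *)
move=> t0; have [x0|x0] := leP (t + c) 0.
  by rewrite /outer1 /outer2 !flat_le0 // expr0n !mulr0 subr0 !mulr0 addr0 !mulr0.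
have g0 := gap_gt0 t0.
have k0 : 0 < 1 - tau by rewrite subr_gt0.
have k1 : 1 - tau <= 1 by rewrite lerBlDr lerDl ltW.
have xc : t + c < c by rewrite gtrDr.
have := flat_convexity k0 k1 c4 x0 xc.
rewrite -/(gap t) (_ : c - (t + c) = - t); last by ring.
rewrite /outer1 /outer2.
have -> : gap t `^ (tau - 1) = gap t * gap t `^ (tau - 2).
  rewrite mulrC -[X in _ * X]powRr1 ?(ltW g0) // -powRD ?(gt_eqF g0) ?implybT //.
  by congr (_ `^ _); ring.
have p0 : 0 < tau * gap t `^ (tau - 2) by rewrite mulr_gt0 // powR_gt0.
rewrite -(ler_pM2l p0).
move: (powR (gap t) (tau - 2)) (gap t) (flat 2 (t + c)) (flat 3 (t + c)) (flat 4 (t + c)) => P G f2 f3 f4 H.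
by apply: (le_trans _ (le_trans H _)); rewrite le_eqVlt; apply/orP; left; apply/eqP; ring.
Qed.

End OuterFunction.

(** * Extension of functions smooth along a set *)

Section Extension.
Variable R : realType.
Implicit Types (p q : C2 R) (f g : C2 R -> R) (U M S : set (C2 R)).

(** Squared Euclidean distance: a polynomial, hence smooth, unlike the sup norm that defines the
    balls of the topology. *)
Definition dist2 p q : R := \sum_i (q 0 i - p 0 i) ^+ 2.

Lemma smooth_on_dist2 U p : open U -> smooth_on U (dist2 p).
Proof.
move=> oU; apply: smooth_on_sum => // i.
have s1 : smooth_on U (fun q => q 0 i - p 0 i).
  by apply: smooth_onB => //; [exact: smooth_on_coord|exact: smooth_on_cst].
by apply: eq_smooth_on (smooth_onM oU s1 s1) => // q _; rewrite expr2.
Qed.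

Lemma dist2_self p : dist2 p p = 0.
Proof. by rewrite /dist2 big1 // => i _; rewrite subrr expr0n. Qed.

Lemma dist2_sub_open U p : open U -> U p ->
  exists2 e : R, 0 < e & forall q, dist2 p q <= e -> U q.
Proof.
move=> oU Up; have nU : \forall q \near p, U q by exact: open_nbhs_nbhs.
have [d /= d0 Hd] := (nbhs_ballP p _).1 nU.
exists ((d / 2) ^+ 2); first by rewrite exprn_gt0 // divr_gt0.
move=> q pq; apply: Hd; rewrite -ball_normE /=.
have d2 : 0 <= d / 2 by rewrite ltW // divr_gt0.
apply: (@le_lt_trans _ _ (d / 2)); last by rewrite ltr_pdivrMr // ltr_pMr // ltr1n.
apply: norm_le_coord => // i; rewrite !mxE -(ler_pXn2r (n := 2)) ?nnegrE //.
rewrite -normrX ger0_norm ?sqr_ge0 // -sqrrN opprB; apply: le_trans pq.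
by rewrite /dist2 (bigD1 i) //= lerDl; apply: sumr_ge0 => j _; exact: sqr_ge0.
Qed.

Lemma open_smooth_lt U f (c : R) : open U -> smooth_on U f -> open [set p | U p /\ f p < c].
Proof.
move=> oU sf; rewrite openE => p [Up fp]; rewrite /interior.
have nU : \forall q \near p, U q by exact: open_nbhs_nbhs.
exact: filterI nU (smooth_near_lt sf Up fp).
Qed.

Lemma open_smooth_gt U f (c : R) : open U -> smooth_on U f -> open [set p | U p /\ c < f p].
Proof.
move=> oU sf; rewrite openE => p [Up fp]; rewrite /interior.
have nU : \forall q \near p, U q by exact: open_nbhs_nbhs.
exact: filterI nU (smooth_near_gt sf Up fp).
Qed.

Definition bump p (e : R) q : R := flat 0 (e - dist2 p q).

Let oT : open [set: C2 R] := openT.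

Lemma smooth_on_flat k U f : open U -> smooth_on U f -> smooth_on U (fun q => flat k (f q)).
Proof.
move=> oU sf; apply: (smooth_on_comp oU (@flat_derive_closed R)) => //.
by exists k.
Qed.

Lemma smooth_on_bump U p e : open U -> smooth_on U (bump p e).
Proof.
move=> oU; apply: smooth_on_flat => //; apply: smooth_onB => //; first exact: smooth_on_cst.
exact: smooth_on_dist2.
Qed.

Lemma bump_ge0 p e q : 0 <= bump p e q.
Proof. exact: flat_ge0. Qed.

(** Off the ball the bump vanishes identically and erases the arbitrary values of [f] outside [U];
    the ball itself lies in [U]. *)
Lemma smooth_on_bumpM U p e f : open U -> smooth_on U f ->
  (forall q, dist2 p q <= e -> U q) -> smooth_on setT (fun q => bump p e q * f q).
Proof.
move=> oU sf HU; apply: smooth_on_local => q _.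
have [qe|qe] := leP (dist2 p q) e.
  exists U; first exact: HU.
  by apply: smooth_onM => //; exact: smooth_on_bump.
have oW := open_smooth_gt (c := e) oT (smooth_on_dist2 p oT).
exists [set q | setT q /\ e < dist2 p q]; first by [].
apply: eq_smooth_on (smooth_on_cst 0 oW) => // z [_ /= ez].
by rewrite /bump flat_le0 ?mul0r // subr_le0 ltW.
Qed.

Lemma smooth_on_inv U f : open U -> smooth_on U f -> (forall p, U p -> f p != 0) ->
  smooth_on U (fun p => (f p)^-1).
Proof.
move=> oU sf f0.
have H := smooth_on_comp oU (@inv_derive_closed R) (ex_intro _ 0%N erefl) sf f0.
by apply: eq_smooth_on H => // p _; rewrite expr1.
Qed.

(* Partition of unity: near S the quotient below is the weighted mean of the
   local extensions, and the flat term keeps the denominator positive. *)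
Lemma smooth_extension M S (u : C2 R -> R) : compact S -> S `<=` M -> smooth_along M u ->
  exists2 w, smooth_on setT w & forall p, S p -> local_extension M u p w.
Proof.
move=> cS SM su; have [S0|/set0P Sn0] := eqVneq S set0.
  by exists (fun=> 0); [exact: smooth_on_cst|move=> p; rewrite S0].
have /choice[F HF] : forall p, exists x : (C2 R -> R) * R, S p ->
    [/\ 0 < x.2, smooth_on setT (fun q => bump p x.2 q * x.1 q) &
      forall q, M q -> dist2 p q <= x.2 -> x.1 q = u q].
  move=> p; have [Sp|nSp] := pselect (S p); last by exists (fun=> 0, 0).
  have [v [U [oU Up sv vu]]] := su p (SM _ Sp).
  have [e e0 He] := dist2_sub_open oU Up.
  exists (v, e) => _; split=> //=; first exact: smooth_on_bumpM sv He.
  by move=> q Mq /He Uq; exact: vu.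
pose B p := [set q | setT q /\ dist2 p q < (F p).2].
have oB p : S p -> open (B p) by move=> _; apply: open_smooth_lt => //; exact: smooth_on_dist2.
have cov : S `<=` \bigcup_(p in S) B p.
  by move=> p Sp; exists p => //; split=> //=; rewrite dist2_self; have [] := HF p Sp.
move: (cS); rewrite compact_cover => /(_ _ S B oB cov)[D DS covD].
pose chi p := bump p (F p).2.
pose Sm q := \sum_(p <- finmap.enum_fset D) chi p q.
pose Tm q := \sum_(p <- finmap.enum_fset D) chi p q * (F p).1 q.
have inD p : p \in finmap.enum_fset D -> S p by move=> /DS/set_mem.
have sSm : smooth_on setT Sm by apply: smooth_on_sum => // p; exact: smooth_on_bump.
have Sm_ge0 q : 0 <= Sm q by apply: sumr_ge0 => p _; exact: bump_ge0.
have Sm_gt0 q : S q -> 0 < Sm q.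
  move=> Sq; have [p /= Dp [_ pq]] := covD _ Sq.
  rewrite /Sm (bigD1_seq p) ?finmap.fset_uniq //=.
  rewrite ltr_pwDl //; last by apply: sumr_ge0 => p' _; exact: bump_ge0.
  by apply: flat_gt0; rewrite subr_gt0.
have [q0 Sq0 Hq0] : exists2 c, c \in S & forall t, t \in S -> Sm c <= Sm t.
  apply: compact_EVT_min => //.
  by apply: continuous_subspaceT => q; exact: smooth_on_continuous sSm _.
pose m := Sm q0.
have m0 : 0 < m by apply: Sm_gt0; exact: set_mem.
pose den q := Sm q + flat 0 (m / 2 - Sm q).
have sden : smooth_on setT den.
  apply: smooth_onD => //; apply: smooth_on_flat => //; apply: smooth_onB => //.
  exact: smooth_on_cst.
have den0 q : den q != 0.
  rewrite gt_eqF // /den; have [h|h] := ltP (Sm q) (m / 2).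
    by apply: ltr_wpDl => //; apply: flat_gt0; rewrite subr_gt0.
  by apply: ltr_pwDl; [apply: lt_le_trans h; rewrite divr_gt0|exact: flat_ge0].
have sTm : smooth_on setT Tm.
  (* Nothing is known of [F p] for p outside [S]. The conditional makes every summand smooth, and
     the sum is unchanged because its indices lie in [S]. *)
  apply: eq_smooth_on (_ : smooth_on setT (fun q => \sum_(p <- finmap.enum_fset D)
     (if p \in S then chi p q * (F p).1 q else 0))) => //.
    move=> q _; apply: eq_big_seq => p /inD Sp; by rewrite mem_set.
  apply: smooth_on_sum => // p; case: (boolP (p \in S)) => [/set_mem Sp|_]; last exact: smooth_on_cst.
  by have [] := HF p Sp.
exists (fun q => Tm q * (den q)^-1).
  by apply: smooth_onM => //; apply: smooth_on_inv.
move=> p Sp; exists [set q | setT q /\ m / 2 < Sm q]; split.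
- exact: open_smooth_gt.
- split=> //; apply: (@lt_le_trans _ _ m); first by rewrite ltr_pdivrMr // ltr_pMr // ltr1n.
  by apply: Hq0; exact: mem_set.
- apply: (@smooth_on_sub _ setT) => //.
  by apply: smooth_onM => //; apply: smooth_on_inv.
- move=> q [_ /= mq] Mq.
  have -> : den q = Sm q by rewrite /den flat_le0 ?addr0 // subr_le0 ltW.
  have -> : Tm q = Sm q * u q.
    rewrite /Tm /Sm mulr_suml; apply: eq_big_seq => p' /inD Sp'.
    have [_ _ Hu] := HF p' Sp'.
    have [h|h] := leP (dist2 p' q) (F p').2; first by rewrite Hu.
    by rewrite /chi /bump flat_le0 ?mul0r // subr_le0 ltW.
  rewrite mulrC mulKf // gt_eqF //; apply: lt_trans mq.
  by rewrite divr_gt0.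
Qed.

End Extension.

(** * The potential *)

Section Coordinates.
Variable R : realType.
Local Notation Re := (@complex.Re R).
Local Notation conj := (@Num.conj _ : R[i] -> R[i]).
Implicit Types (p q : C2 R).

Definition zcoord (j : 'I_2) p : R[i] := p 0 (xdir j) +i* p 0 (ydir j).

Definition norm2 p : R := nsq (zcoord 0 p) + nsq (zcoord 1 p).

Lemma partial_coord i j p : partial i (fun q => q 0 j) p = (i == j)%:R.
Proof.
have H : (fun h : R => h^-1 *: (((fun q : C2 R => q 0 j) \o shift p) (h *: Defs.basis R i) - p 0 j))
     @ 0^' --> ((i == j)%:R : R).
  apply: cvg_trans (@cvg_cst _ ((i == j)%:R : R) _ ((0:R)^') _); apply: near_eq_cvg; near=> h.
  rewrite /= !mxE addrK eqxx /= eq_sym /GRing.scale /= mulKf //.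
  by near: h; exact: nbhs_dnbhs_neq.
exact: cvg_lim H.
Unshelve. all: by end_near. Qed.

Lemma csmooth_zcoord j : csmooth setT (zcoord j).
Proof. by split; exact: smooth_on_coord openT. Qed.

Lemma dz_zcoord i j p : dz i (zcoord j) p = (i == j)%:R.
Proof.
rewrite /dz /cpartial /zcoord /= !partial_coord /xdir /ydir.
rewrite !(inj_eq (@lshift_inj _ _)) !(inj_eq (@rshift_inj _ _)).
rewrite (eq_lrshift i j) (eq_rlshift i j).
rewrite (_ : (2 : R[i])^-1 = (2 : R)^-1%:C); last by rewrite fmorphV /= rmorph_nat.
case: (i == j); apply: eq_ReIm; rewrite ?cReM ?cImM ?cReD ?cImD ?cReN ?cImN ?cReM ?cImM /=; by field.
Qed.

Lemma dzbar_zcoord i j p : dzbar i (zcoord j) p = 0.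
Proof.
rewrite /dzbar /cpartial /zcoord /= !partial_coord /xdir /ydir.
rewrite !(inj_eq (@lshift_inj _ _)) !(inj_eq (@rshift_inj _ _)).
rewrite (eq_lrshift i j) (eq_rlshift i j).
by case: (i == j); apply: eq_ReIm; rewrite ?cReM ?cImM ?cReD ?cImD ?cReM ?cImM /=; ring.
Qed.

End Coordinates.

Section SquaredModulus.
Variables (R : realType) (U : set (C2 R)).
Hypothesis oU : open U.
Local Notation conj := (@Num.conj _ : R[i] -> R[i]).
Variable h : C2 R -> R[i].
Hypothesis sh : csmooth U h.
Implicit Types p : C2 R.

Lemma csmooth_sqmod : csmooth U (fun q => h q * conj (h q)).
Proof. exact: csmoothM oU sh (csmoothJ oU sh). Qed.

Lemma dz_sqmod j p : U p ->
  dz j (fun q => h q * conj (h q)) p = h p * conj (dzbar j h p) + conj (h p) * dz j h p.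
Proof. by move=> Up; rewrite (dzM j oU sh (csmoothJ oU sh) Up) (dzJ j oU sh Up). Qed.

Lemma dz_dzbar_sqmod j k p : U p ->
  dz j (dzbar k (fun q => h q * conj (h q))) p =
  h p * conj (dzbar j (dz k h) p) + conj (dz k h p) * dz j h p
  + (conj (h p) * dz j (dzbar k h) p + dzbar k h p * conj (dzbar j h p)).
Proof.
move=> Up; have sJ := csmoothJ oU sh.
have sP := csmooth_dz k oU sh; have sQ := csmooth_dzbar k oU sh.
rewrite (@eq_dz R U _ (fun q => h q * conj (dz k h q) + conj (h q) * dzbar k h q) j p oU Up); last first.
  by move=> q Uq; rewrite (dzbarM k oU sh sJ Uq) (dzbarJ k oU sh Uq).
rewrite (dzD j oU (csmoothM oU sh (csmoothJ oU sP)) (csmoothM oU sJ sQ) Up).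
rewrite (dzM j oU sh (csmoothJ oU sP) Up) (dzM j oU sJ sQ Up).
by rewrite (dzJ j oU sP Up) (dzJ j oU sh Up).
Qed.

End SquaredModulus.

Section Potential.
Variables (R : realType) (U : set (C2 R)).
Hypothesis oU : open U.
Local Notation Re := (@complex.Re R).
Local Notation conj := (@Num.conj _ : R[i] -> R[i]).
Variables (h : C2 R -> R[i]) (K e : R).
Hypothesis sh : csmooth U h.
Implicit Types p : C2 R.

Definition potential p : R := K * nsq (h p) + e * norm2 p.

Let S := fun p => h p * conj (h p).
Let S0 := fun p : C2 R => zcoord 0 p * conj (zcoord 0 p).
Let S1 := fun p : C2 R => zcoord 1 p * conj (zcoord 1 p).

Let toC_potential : toC potential = fun p => K%:C * S p + e%:C * (S0 p + S1 p).
Proof.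
apply/funext => p; rewrite /toC /S /S0 /S1 !nsqE -rmorphD -!rmorphM -rmorphD.
by [].
Qed.

Let sz j : csmooth U (zcoord j).
Proof. by have [s1 s2] := csmooth_zcoord R j; split; [exact: smooth_on_sub s1|exact: smooth_on_sub s2]. Qed.

Let sS : csmooth U S := csmooth_sqmod oU sh.
Let sS0 : csmooth U S0 := csmooth_sqmod oU (sz 0).
Let sS1 : csmooth U S1 := csmooth_sqmod oU (sz 1).

Let sT : csmooth U (toC potential).
Proof.
rewrite toC_potential.
exact: csmoothD oU (csmoothM oU (csmooth_cst _ oU) sS)
  (csmoothM oU (csmooth_cst _ oU) (csmoothD oU sS0 sS1)).
Qed.

Lemma smooth_on_potential : smooth_on U potential.
Proof. by have [] := sT. Qed.

Let dzZ j (c : R[i]) F p : csmooth U F -> U p -> dz j (fun q => c * F q) p = c * dz j F p.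
Proof. by move=> sF Up; rewrite (dzM j oU (csmooth_cst c oU) sF Up) dz_cst mulr0 addr0. Qed.

Let dzbarZ j (c : R[i]) F p : csmooth U F -> U p -> dzbar j (fun q => c * F q) p = c * dzbar j F p.
Proof. by move=> sF Up; rewrite (dzbarM j oU (csmooth_cst c oU) sF Up) dzbar_cst mulr0 addr0. Qed.

(** At a zero of [h] the term K |h|^2 has no first derivative. Hence K enters [tang] through the
    Hessian but is absent from [cross], and can be taken large. *)
Lemma dz_potential j p : U p -> h p = 0 -> dz j (toC potential) p = e%:C * conj (zcoord j p).
Proof.
move=> Up hp; rewrite toC_potential.
rewrite (dzD j oU (csmoothM oU (csmooth_cst _ oU) sS) (csmoothM oU (csmooth_cst _ oU) (csmoothD oU sS0 sS1)) Up).
rewrite (dzZ j _ sS Up) (dzZ j _ (csmoothD oU sS0 sS1) Up) (dzD j oU sS0 sS1 Up).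
rewrite (dz_sqmod oU sh j Up) (dz_sqmod oU (sz 0) j Up) (dz_sqmod oU (sz 1) j Up) hp.
rewrite !dz_zcoord !dzbar_zcoord [conj 0]rmorph0 !mulr0 !mul0r !add0r mulr0 add0r.
by case: j => -[|[|//]] i; rewrite /= ?(mulr1, mulr0, addr0, add0r);
  congr (_ * conj (zcoord _ _)); exact: val_inj.
Qed.

Let dz_dzbar_norm i j k p : U p ->
  dz j (dzbar k (fun q : C2 R => zcoord i q * conj (zcoord i q))) p = ((j == i) && (k == i))%:R.
Proof.
move=> Up; rewrite (dz_dzbar_sqmod oU (sz i) j k Up).
have -> : dz k (@zcoord R i) = fun=> (k == i)%:R by apply/funext => q; exact: dz_zcoord.
have -> : dzbar k (@zcoord R i) = fun=> 0 by apply/funext => q; exact: dzbar_zcoord.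
rewrite dz_zcoord dzbar_cst dz_cst rmorph0 !mulr0 mul0r add0r !addr0.
by case: (k == i); case: (j == i); rewrite ?rmorph0 ?rmorph1 ?(mulr0, mulr1, mul0r).
Qed.

Let potential_alg (a b H P Pb Q Qb x y u v : R[i]) : H = 0 -> u = v ->
  a * (H * x + Pb * P + (conj H * y + Q * Qb)) + b * u = a * (P * Pb + Q * Qb) + b * v.
Proof. by move=> -> ->; rewrite [conj 0]rmorph0; ring. Qed.

Let delta2 (j k : 'I_2) : ((j == 0) && (k == 0))%:R + ((j == 1) && (k == 1))%:R = (j == k)%:R :> R[i].
Proof. by case: j k => -[|[|//]] i [[|[|//]] i']; rewrite /= -?val_eqE /= ?addr0 ?add0r. Qed.

Lemma dz_dzbar_potential j k p : U p -> h p = 0 -> dz j (dzbar k (toC potential)) p =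
  K%:C * (dz j h p * conj (dz k h p) + dzbar k h p * conj (dzbar j h p)) + e%:C * (j == k)%:R.
Proof.
move=> Up hp; rewrite toC_potential.
have sb F (sF : csmooth U F) : csmooth U (dzbar k F) := csmooth_dzbar k oU sF.
have sM c F : csmooth U F -> csmooth U (fun q => c * F q).
  by move=> sF; exact: csmoothM oU (csmooth_cst _ oU) sF.
have sS01 := csmoothD oU sS0 sS1.
rewrite (@eq_dz R U _ (fun q => K%:C * dzbar k S q + e%:C * (dzbar k S0 q + dzbar k S1 q)) j p oU Up); last first.
  move=> q Uq; rewrite (dzbarD k oU (sM _ _ sS) (sM _ _ sS01) Uq).
  by rewrite (dzbarZ k _ sS Uq) (dzbarZ k _ sS01 Uq) (dzbarD k oU sS0 sS1 Uq).
have sb01 := csmoothD oU (sb _ sS0) (sb _ sS1).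
rewrite (dzD j oU (sM _ _ (sb _ sS)) (sM _ _ sb01) Up) (dzZ j _ (sb _ sS) Up) (dzZ j _ sb01 Up).
rewrite (dzD j oU (sb _ sS0) (sb _ sS1) Up) (dz_dzbar_sqmod oU sh j k Up).
refine (@potential_alg _ _ _ _ _ _ _ _ _ _ _ hp _).
transitivity (((j == 0) && (k == 0))%:R + ((j == 1) && (k == 1))%:R : R[i]).
  by congr (_ + _); exact: dz_dzbar_norm.
exact: delta2.
Qed.

End Potential.

(** * Positivity at strictly pseudoconvex and at flat boundary points *)

Section FlatPoints.
Variables (R : realType) (U : set (C2 R)).
Hypothesis oU : open U.
Local Notation Re := (@complex.Re R).
Local Notation conj := (@Num.conj _ : R[i] -> R[i]).
Implicit Types (r psi : C2 R -> R) (p : C2 R).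

Definition form_nonneg r psi k p := forall z0 z1 : R[i],
  0 <= Re (weight_form r psi k 0 0 p * z0 * conj z0 + weight_form r psi k 0 1 p * z0 * conj z1
    + weight_form r psi k 1 0 p * z1 * conj z0 + weight_form r psi k 1 1 p * z1 * conj z1).

(** Where the Levi form is positive and [r] is 0, the bound [lam * r] holds nearby for every [lam].
    So [eta] is chosen to beat [cross], and then [lam] negative enough for [tang]. *)
Lemma form_nonneg_strict r psi k p0 : smooth_on U r -> smooth_on U psi ->
  0 < k -> U p0 -> r p0 = 0 -> 0 < grad2 r p0 -> 0 < Re (levi r p0) ->
  \forall p \near p0, r p < 0 -> form_nonneg r psi k p.
Proof.
move=> sr sp k0 Up0 rp0 g0 l0.
have G0 : 0 < k / 2 * grad2 r p0 ^+ 2 by rewrite !mulr_gt0 ?exprn_gt0 ?invr_gt0.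
pose eta := (nsq (cross r psi k p0) + 1) / (k / 2 * grad2 r p0 ^+ 2).
have eta0 : 0 < eta by rewrite divr_gt0 // ltr_wpDl ?nsq_ge0.
pose lam := Re (tang r psi k p0) - eta - 1.
have sl : smooth_on U (fun p => Re (levi r p) - lam * r p).
  apply: smooth_onB => //; first by case: (csmooth_levi oU sr).
  exact: smooth_onM (smooth_on_cst lam oU) sr.
apply: (@weight_form_pos R U oU r psi k sr sp p0 lam eta) => //.
- have F0 : 0 < Re (levi r p0) - lam * r p0 by rewrite rp0 mulr0 subr0.
  apply: (filterS _ (smooth_near_gt sl Up0 F0)) => p.
  by rewrite subr_gt0 => /ltW.
- by rewrite /lam; lra.
- by rewrite /eta divfK ?gt_eqF // ltrDl.
Qed.

Let nsq_re (z : R[i]) : Re z ^+ 2 <= nsq z.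
Proof. by rewrite lerDl sqr_ge0. Qed.

(** Cauchy-Schwarz from the identity of Lagrange: the defect is |a0 z0 + a1 z1|^2. *)
Let lagrange (a0 a1 z0 z1 : R[i]) :
  nsq (a1 * conj z0 - a0 * conj z1) <= (nsq a0 + nsq a1) * (nsq z0 + nsq z1).
Proof.
rewrite -subr_ge0.
have -> : (nsq a0 + nsq a1) * (nsq z0 + nsq z1) - nsq (a1 * conj z0 - a0 * conj z1)
   = nsq (a0 * z0 + a1 * z1).
  case: a0 a1 z0 z1 => [a b] [c d] [e f] [g h].
  by rewrite /nsq ?cReD ?cImD ?cReN ?cImN ?cReM ?cImM ?cReJ ?cImJ /=; ring.
exact: nsq_ge0.
Qed.

(** With P and Q the derivatives of [h] in z and conj z, the Hessian of K |h|^2 on L is K (|L h|^2 +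
    |conj L h|^2); e |z|^2 contributes e g to the Hessian term and the subtracted square of its
    gradient. *)
Let tang_alg (K k e g : R) (e00 e01 e10 e11 a0 a1 x0 x1 c0 c1 y0 y1 P0 P1 Q0 Q1 z0 z1 : R[i]) :
  conj a0 = x0 -> conj a1 = x1 -> conj c0 = y0 -> conj c1 = y1 ->
  c0 = e%:C * conj z0 -> c1 = e%:C * conj z1 ->
  e00 = K%:C * (P0 * conj P0 + Q0 * conj Q0) + e%:C * 1 ->
  e01 = K%:C * (P0 * conj P1 + Q1 * conj Q0) + e%:C * 0 ->
  e10 = K%:C * (P1 * conj P0 + Q0 * conj Q1) + e%:C * 0 ->
  e11 = K%:C * (P1 * conj P1 + Q1 * conj Q1) + e%:C * 1 ->
  nsq a0 + nsq a1 = g ->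
  e00 * a1 * x1 - e01 * a1 * x0 - e10 * a0 * x1 + e11 * a0 * x0
  - (1 - k%:C) * ((a1 * c0 - a0 * c1) * (x1 * y0 - x0 * y1)) =
  (K * (nsq (a1 * P0 - a0 * P1) + nsq (x1 * Q0 - x0 * Q1)) + e * g
    - (1 - k) * (e ^+ 2 * nsq (a1 * conj z0 - a0 * conj z1)))%:C.
Proof.
move=> <- <- <- <- -> -> -> -> -> -> <-.
move: (nsqE (a1 * P0 - a0 * P1)) (nsqE (conj a1 * Q0 - conj a0 * Q1))
  (nsqE (a1 * conj z0 - a0 * conj z1)) (nsqE a0) (nsqE a1).
move: (nsq (a1 * P0 - a0 * P1)) (nsq (conj a1 * Q0 - conj a0 * Q1))
  (nsq (a1 * conj z0 - a0 * conj z1)) (nsq a0) (nsq a1) => n1 n2 n3 n4 n5 E1 E2 E3 E4 E5.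
rewrite !(rmorphD, rmorphN, rmorphM, rmorph1, rmorphXn) /= -E1 -E2 -E3 -E4 -E5
  !(conj_D, conj_M, conj_N, conj_K, conj_real).
move: K%:C k%:C e%:C (conj a0) (conj a1) (conj P0) (conj P1) (conj Q0) (conj Q1) (conj z0) (conj z1) => *.
by rewrite /=; ring.
Qed.

Let cross_alg (k e g : R) (m dd rest a0 a1 x0 x1 c0 c1 z0 z1 : R[i]) :
  m = 0 -> dd = 0 -> a0 * x0 + a1 * x1 = g%:C ->
  c0 = e%:C * conj z0 -> c1 = e%:C * conj z1 ->
  nsq (m - (1 - k%:C) * (a0 * x0 + a1 * x1) * (a1 * c0 - a0 * c1) + dd * rest) =
  ((1 - k) * g * e) ^+ 2 * nsq (a1 * conj z0 - a0 * conj z1).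
Proof.
move=> -> -> -> -> ->; rewrite mul0r addr0 sub0r.
have -> : - ((1 - k%:C) * g%:C * (a1 * (e%:C * conj z0) - a0 * (e%:C * conj z1))) =
   (- ((1 - k) * g * e))%:C * (a1 * conj z0 - a0 * conj z1).
  by rewrite !(rmorphD, rmorphN, rmorphM, rmorph1); ring.
by rewrite nsqM nsq_real sqrrN.
Qed.

(** The margin e g is spent as follows: 1/8 on the gradient of e |z|^2, 1/8 on the slack in [lam],
    1/2 on [eta], and 1/4 on making the quadratic K X^2 - X / g + e g / 4 positive. Its discriminant
    is negative exactly when K e g^3 > 1. *)
Let tang_est (K k e g B X T1 T2 m : R) : 0 < k -> k <= 1 -> 0 < e -> 0 < g ->
  e * B <= k / 8 -> 1 < K * e * g ^+ 3 -> 0 <= T1 -> X ^+ 2 <= T2 -> 0 <= m -> m <= g * B ->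
  X / g + e * g / 8 + e * g / 2 < K * (T1 + T2) + e * g - (1 - k) * (e ^+ 2 * m).
Proof.
move=> k0 k1 e0 g0 eB KH T10 T2X m0 mB.
have K0 : 0 < K.
  have := lt_trans ltr01 KH; rewrite -mulrA pmulr_lgt0 // mulr_gt0 // exprn_gt0 //.
have k1' : 1 - k <= 1 by lra.
have em : 0 <= e ^+ 2 * m by rewrite mulr_ge0 ?sqr_ge0.
have h1 : (1 - k) * (e ^+ 2 * m) <= e * g / 8.
  apply: (le_trans (ler_piMl em k1')).
  apply: (@le_trans _ _ (e * g * (e * B))).
    have -> : e * g * (e * B) = e ^+ 2 * (g * B) by ring.
    by rewrite ler_pM2l ?exprn_gt0.
  by rewrite ler_pM2l ?mulr_gt0 //; lra.
have h2 : K * X ^+ 2 <= K * (T1 + T2) by rewrite ler_pM2l //; lra.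
have h3 : 0 < K * X ^+ 2 - X / g + e * g / 4.
  have F0 : 0 < 4 * K * g ^+ 2 by rewrite !mulr_gt0 ?exprn_gt0.
  rewrite -(pmulr_rgt0 _ F0).
  have -> : 4 * K * g ^+ 2 * (K * X ^+ 2 - X / g + e * g / 4) =
     (2 * K * g * X - 1) ^+ 2 + (K * e * g ^+ 3 - 1) by field; rewrite gt_eqF.
  by rewrite ltr_wpDl ?sqr_ge0 // subr_gt0.
by lra.
Qed.

(** The left side is at most g^3 e (e B), quadratic in e, while the right side is g^3 e k / 4, so a
    small e wins. *)
Let cross_est (k e g B m : R) : 0 < k -> k <= 1 -> 0 < e -> 0 < g ->
  e * B <= k / 8 -> 0 <= m -> m <= g * B ->
  ((1 - k) * g * e) ^+ 2 * m < e * g / 2 * (k / 2 * g ^+ 2).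
Proof.
move=> k0 k1 e0 g0 eB m0 mB.
have k0' : 0 <= 1 - k by lra.
have k1' : 1 - k <= 1 by lra.
apply: (@le_lt_trans _ _ ((g * e) ^+ 2 * m)).
  rewrite -[(1 - k) * g * e]mulrA exprMn -mulrA; apply: ler_piMl.
    by rewrite mulr_ge0 ?sqr_ge0.
  by rewrite expr_le1.
apply: (@le_lt_trans _ _ (g ^+ 3 * e * (e * B))).
  have -> : g ^+ 3 * e * (e * B) = (g * e) ^+ 2 * (g * B) by ring.
  by rewrite ler_pM2l // exprn_gt0 // mulr_gt0.
have -> : e * g / 2 * (k / 2 * g ^+ 2) = g ^+ 3 * e * (k / 4) by field.
rewrite ltr_pM2l; last by rewrite mulr_gt0 ?exprn_gt0.
by lra.
Qed.

Let levi_real_alg (b00 b01 b10 b11 a0 a1 x0 x1 : R[i]) :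
  conj b00 = b00 -> conj b01 = b10 -> conj b11 = b11 -> conj a0 = x0 -> conj a1 = x1 ->
  conj (b00 * a1 * x1 - b01 * a1 * x0 - b10 * a0 * x1 + b11 * a0 * x0) =
  b00 * a1 * x1 - b01 * a1 * x0 - b10 * a0 * x1 + b11 * a0 * x0.
Proof.
move=> h0 <- h1 <- <-; rewrite !(conj_D, conj_N, conj_M, conj_K) h0 h1.
by move: (conj b01) (conj a0) (conj a1) => *; ring.
Qed.

Lemma levi_real r p : smooth_on U r -> U p -> levi r p = (Re (levi r p))%:C.
Proof.
move=> sr Up; apply: real_of_conj; rewrite leviE.
exact: levi_real_alg (hess_conj oU 0 0 sr Up) (hess_conj oU 0 1 sr Up) (hess_conj oU 1 1 sr Up)
  (dz_toC_conj r 0 p) (dz_toC_conj r 1 p).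
Qed.

Let re_conj_alg (a0 a1 x0 x1 l0 l1 m0 m1 : R[i]) : conj a0 = x0 -> conj a1 = x1 ->
  conj l0 = m0 -> conj l1 = m1 -> Re (x0 * l0 + x1 * l1) = Re (a0 * m0 + a1 * m1).
Proof. by move=> <- <- <- <-; rewrite -[LHS]cReJ !(conj_D, conj_M, conj_K). Qed.

Let dmap_normal r p : dmap r p (C2_of (Nfield r p)) = 2 * grad2 r p.
Proof.
rewrite dmap_C2_of vect_appE !mxE.
rewrite (re_conj_alg (dz_toC_conj r 0 p) (dz_toC_conj r 1 p) (dz_toC_conj r 0 p) (dz_toC_conj r 1 p)).
by rewrite grad2E.
Qed.

(** Since [levi] is real, its derivative along the real normal is twice the real part of its
    derivative along conj N, which [levi_transport] rewrites. *)
Let dmap_levi r p : smooth_on U r -> U p -> 0 < grad2 r p -> levi r p = 0 -> mixed r p = 0 ->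
  dmap (fun q => Re (levi r q)) p (C2_of (Nfield r p)) =
  2 * Re (dzbar 1 (toC r) p * dzbar 0 (mixed r) p - dzbar 0 (toC r) p * dzbar 1 (mixed r) p).
Proof.
move=> sr Up g0 l0 m0; rewrite -(levi_transport oU sr Up g0 l0 m0).
rewrite dmap_C2_of vect_appE !mxE; set f := fun q => Re (levi r q).
have E j : dzbar j (toC f) p = dzbar j (levi r) p.
  by apply: (eq_dzbar j oU Up) => q Uq; rewrite [RHS](levi_real sr Uq).
rewrite (re_conj_alg (dz_toC_conj r 0 p) (dz_toC_conj r 1 p) (dz_toC_conj f 0 p) (dz_toC_conj f 1 p)).
by rewrite (E 0) (E 1).
Qed.

(* The linear lower bound for the Levi form at a flat point involves the
   derivative of [mixed r]; the term [K * nsq (mixed r)] of the potential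
   dominates it, by completing a square. *)
Lemma form_nonneg_flat r (k K e : R) p0 : smooth_on U r ->
  (forall p, U p -> r p = 0 -> 0 <= Re (levi r p)) ->
  U p0 -> r p0 = 0 -> 0 < grad2 r p0 -> levi r p0 = 0 -> mixed r p0 = 0 ->
  0 < k -> k <= 1 -> 0 < e -> e * norm2 p0 <= k / 8 -> 1 < K * e * grad2 r p0 ^+ 3 ->
  \forall p \near p0, r p < 0 -> form_nonneg r (potential (mixed r) K e) k p.
Proof.
move=> sr l_ge0 Up0 rp0 g0 l0 m0 k0 k1 e0 eB KH.
have sm := csmooth_mixed oU sr.
have sp := smooth_on_potential oU K e sm.
pose Y := dzbar 1 (toC r) p0 * dzbar 0 (mixed r) p0 - dzbar 0 (toC r) p0 * dzbar 1 (mixed r) p0.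
pose X := Re Y; pose g := grad2 r p0.
pose M := nsq (dz 1 (toC r) p0 * conj (zcoord 0 p0) - dz 0 (toC r) p0 * conj (zcoord 1 p0)).
have M0 : 0 <= M by exact: nsq_ge0.
have MB : M <= g * norm2 p0 by exact: lagrange.
(* Along the normal, [levi] has derivative 2 X and [r] has derivative 2 g. The slope is therefore X
   / g, and e g / 8 makes the inequality of [one_sided_bound] strict. *)
apply: (@weight_form_pos R U oU r (potential (mixed r) K e) k sr sp p0 (X / g + e * g / 8) (e * g / 2)) => //.
- apply: (@one_sided_bound R U oU _ r p0 (C2_of (Nfield r p0))) => //.
  + by case: (csmooth_levi oU sr).
  + by rewrite dmap_normal mulr_gt0.
  + rewrite dmap_levi // dmap_normal -/Y -/X -/g.
    have -> : (X / g + e * g / 8) * (2 * g) = 2 * X + e * g ^+ 2 / 4 by field; rewrite gt_eqF.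
    by rewrite ltrDl !mulr_gt0 ?exprn_gt0 ?invr_gt0.
- by rewrite !mulr_gt0 ?invr_gt0.
- pose T := nsq (dz 1 (toC r) p0 * dz 0 (mixed r) p0 - dz 0 (toC r) p0 * dz 1 (mixed r) p0).
  have T0 : 0 <= T by exact: nsq_ge0.
  have H j k := dz_dzbar_potential oU K e sm j k Up0 m0.
  have C j := dz_potential oU K e sm j Up0 m0.
  rewrite /tang (tang_alg k (dz_toC_conj r 0 p0) (dz_toC_conj r 1 p0)
    (dz_toC_conj _ 0 p0) (dz_toC_conj _ 1 p0) (C 0) (C 1) (H 0 0) (H 0 1) (H 1 0) (H 1 1) (erefl _)).
  exact: (tang_est k0 k1 e0 g0 eB KH T0 (nsq_re Y) M0 MB).
- have C j := dz_potential oU K e sm j Up0 m0.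
  have d0 : (- r p0)%:C = 0 :> R[i] by rewrite rp0 oppr0.
  rewrite mixedE in m0.
  rewrite /cross (cross_alg k _ m0 d0 (grad2E r p0) (C 0) (C 1)).
  exact: (cross_est k0 k1 e0 g0 eB M0 MB).
Qed.

End FlatPoints.

(** * Defining functions and exponents *)

Section PshStep.
Variables (R : realType) (O : set (C2 R)).
Hypothesis oO : open O.
Local Notation Re := (@complex.Re R).
Variables (s : C2 R -> R) (tau c : R).
Hypotheses (ss : smooth_on O s) (s_lt0 : forall p, O p -> s p < 0).
Hypotheses (tau0 : 0 < tau) (tau1 : tau < 1) (c0 : 0 < c) (c4 : c <= 4^-1).

Let s_flat k : smooth_on O (fun p => flat k (s p + c)).
Proof. by apply: smooth_on_flat => //; exact: smooth_onD oO ss (smooth_on_cst c oO). Qed.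

Let s_gapX a : smooth_on O (fun p => gap c (s p) `^ a).
Proof.
apply: (@smooth_on_comp R _ _ O (fun p => gap c (s p)) (fun x => x `^ a) oO (@powR_derive_closed R)).
- by exists a.
- exact: smooth_onB oO (smooth_on_cst _ oO) (s_flat 0).
- by move=> p Op; exact: gap_gt0 (s_lt0 Op).
Qed.

(** With phi the outer function, the Hessian of phi(s) is phi' Hess s + phi'' |Z s|^2. After
    multiplication by - s, the hypothesis bounds the first term below by - k phi' |Z s|^2, and
    [outer_convex] lets the second absorb it. *)
Lemma psh_outer :
  (forall p, O p -> - c < s p -> forall Z, 0 <= - s p * Re (hess s Z Z p) + (1 - tau) / 8 * nsq (vect_app Z s p)) ->
  psh_on O (fun p => outer tau c (s p)).
Proof.
move=> s_form; apply: hess_ge0_psh => //.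
  exact: smooth_onN oO (s_gapX tau).
have s1 : smooth_on O (fun p => outer1 tau c (s p)).
  exact: smooth_onM oO (smooth_on_cst tau oO) (smooth_onM oO (s_gapX _) (s_flat 2)).
move=> p Op Z.
have d1 q : O q -> is_derive (s q) 1 (outer tau c) (outer1 tau c (s q)).
  by move=> Oq; exact: is_derive_outer (s_lt0 Oq).
have d2 q : O q -> is_derive (s q) 1 (outer1 tau c) (outer2 tau c (s q)).
  by move=> Oq; exact: is_derive_outer1 (s_lt0 Oq).
rewrite (hess_compE oO Z ss s1 d1 d2 Op).
have t0 := s_lt0 Op.
have [cs|sc] := ltP (- c) (s p); last first.
  have sc' : s p + c <= 0 by lra.
  by rewrite /outer1 /outer2 !flat_le0 // expr0n !(mulr0, subr0, addr0, mul0r).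
have n0 : 0 < - s p by rewrite oppr_gt0.
rewrite -(pmulr_rge0 _ n0) mulrDr.
have F := s_form p Op cs Z.
have G := outer_convex tau0 tau1 c0 c4 t0.
have H := outer1_ge0 c tau0 (s p).
have N := nsq_ge0 (vect_app Z s p).
move: (Re _) (nsq _) (outer1 _ _ _) (outer2 _ _ _) N F G H => h n o1 o2 N F G H.
have : 0 <= o1 * (- s p * h + (1 - tau) / 8 * n) by exact: mulr_ge0.
have : ((1 - tau) / 8 * o1) * n <= (- s p * o2) * n by exact: ler_wpM2r.
by lra.
Qed.

End PshStep.

Section DefiningFunctions.
Variable R : realType.
Implicit Types (Omega U : set (C2 R)) (rho psi : C2 R -> R).

(** The neighborhood is made explicit, so that [delta] and all functions derived from it share one
    [U]. *)
Definition defining_on Omega U rho :=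
  [/\ open U, closure Omega `<=` U & smooth_on U rho] /\
  [/\ Omega = [set p | U p /\ rho p < 0], bdry Omega = [set p | U p /\ rho p = 0] &
      forall p, bdry Omega p -> grad rho p != 0].

Lemma defining_on_weight Omega U rho psi : smooth_on U psi -> defining_on Omega U rho ->
  defining_on Omega U (fun p => rho p * expR (- psi p)).
Proof.
move=> sp [[oU cU sr] [EO EB G]].
have sw := smooth_on_weight oU sp.
split; first by split=> //; exact: smooth_onM.
split.
- by rewrite {1}EO; apply/seteqP; split=> p /= [Up] h; split=> //; move: h; rewrite pmulr_llt0 ?expR_gt0.
- rewrite EB; apply/seteqP; split=> p /= [Up]; first by move=> ->; rewrite mul0r.
  by move=> /eqP; rewrite mulf_eq0 (gt_eqF (expR_gt0 _)) orbF => /eqP.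
- move=> p Bp; have [Up rp] : U p /\ rho p = 0 by move: Bp; rewrite EB.
  apply: contra_neq (G p Bp) => /rowP E; apply/rowP => i; have := E i; rewrite !mxE.
  rewrite (partialM i oU sr sw Up) rp mul0r add0r => /eqP.
  by rewrite mulf_eq0 (gt_eqF (expR_gt0 _)) => /eqP.
Qed.

Lemma defining_on_gap Omega U rho c : 0 < c -> defining_on Omega U rho ->
  defining_on Omega U (fun p => - gap c (rho p)).
Proof.
move=> c0 [[oU cU sr] [EO EB G]].
have gap_le t : 0 < t -> gap c t < 0.
  by move=> t0; rewrite subr_lt0 flat0_lt ?ltrDr ?addr_gt0.
have gap00 : gap c 0 = 0 by rewrite /gap add0r subrr.
split; first split=> //.
  apply: smooth_onN => //; apply: smooth_onB => //; first exact: smooth_on_cst.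
  by apply: smooth_on_flat => //; exact: smooth_onD oU sr (smooth_on_cst _ oU).
split.
- rewrite {1}EO; apply/seteqP; split=> p /= [Up] h; split=> //.
    by rewrite oppr_lt0 gap_gt0.
  rewrite ltNge; apply/negP; rewrite le_eqVlt => /orP[/eqP E|/gap_le E]; move: h.
    by rewrite -E gap00 oppr0 ltxx.
  by rewrite oppr_lt0 => /lt_trans/(_ E); rewrite ltxx.
- rewrite EB; apply/seteqP; split=> p /= [Up]; first by move=> ->; rewrite gap00 oppr0.
  move=> /eqP; rewrite oppr_eq0; have [|/gap_le/lt_eqF->|] // := ltgtP (rho p) 0.
  by move=> /(gap_gt0 c0)/gt_eqF->.
- move=> p Bp; have [Up rp] : U p /\ rho p = 0 by move: Bp; rewrite EB.
  have P i : partial i (fun q => - gap c (rho q)) p = flat 2 (rho p + c) * partial i rho p.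
    have D := is_deriveN (is_derive_gap c (rho p)).
    have [_ E] := is_derive_comp_dmap (Defs.basis R i) oU sr Up D.
    by rewrite [LHS]E dmap_basis opprK.
  apply: contra_neq (G p Bp) => /rowP E; apply/rowP => i; have := E i; rewrite !mxE.
  rewrite P rp add0r => /eqP.
  by rewrite mulf_eq0 (gt_eqF (flat_gt0 2 c0)) => /eqP.
Qed.

End DefiningFunctions.

(** * Normalized vector fields and the gradient norm *)

Section Normalization.
Variable R : realType.
Local Notation Re := (@complex.Re R).
Local Notation conj := (@Num.conj _ : R[i] -> R[i]).
Implicit Types (f : C2 R -> R) (p : C2 R) (Z W : 'rV[R[i]]_2).

Let nsq_ReIm (x y : R) : nsq ((x / 2) +i* (- (y / 2))) = (x ^+ 2 + y ^+ 2) / 4.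
Proof. by rewrite /nsq /=; field. Qed.

Let sum4 (a b c d : R) : a ^+ 2 + b ^+ 2 + (c ^+ 2 + d ^+ 2) =
  4 * ((a ^+ 2 + c ^+ 2) / 4 + (b ^+ 2 + d ^+ 2) / 4).
Proof. by field. Qed.

Lemma sum_partial_sqr f p : \sum_i partial i f p ^+ 2 = 4 * grad2 f p.
Proof.
rewrite big_split_ord !sum_ord2 /grad2 !dz_toC_coord !nsq_ReIm; exact: sum4.
Qed.

Lemma grad2_ge0 f p : 0 <= grad2 f p.
Proof. by rewrite addr_ge0 ?nsq_ge0. Qed.

Lemma grad2_gt0 f p : grad f p != 0 -> 0 < grad2 f p.
Proof.
move=> Df; rewrite lt_neqAle grad2_ge0 andbT; apply: contra_neq Df => g0.
have /eqP := sum_partial_sqr f p; rewrite -g0 mulr0 psumr_eq0 => [/allP H|i _]; last exact: sqr_ge0.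
apply/rowP => i; have := H i (mem_index_enum i); rewrite sqrf_eq0 !mxE => /eqP; exact.
Qed.

(** The factor 2 relates real and Wirtinger derivatives; it is the origin of the 2 in delta exp(2
    u). *)
Lemma eucl_norm_grad f p : eucl_norm (grad f p) = 2 * Num.sqrt (grad2 f p).
Proof.
rewrite /eucl_norm (eq_bigr (fun i => partial i f p ^+ 2)) => [|i _]; last by rewrite mxE.
rewrite sum_partial_sqr (_ : 4 = 2 ^+ 2 :> R); last by ring.
by rewrite sqrtrM ?sqr_ge0 // sqrtr_sqr ger0_norm.
Qed.

Let sqrtC_nsq (a b : R[i]) :
  sqrtC (`|a| ^+ 2 + `|b| ^+ 2) = (Num.sqrt (nsq a + nsq b))%:C.
Proof.
have h : 0 <= nsq a + nsq b by rewrite addr_ge0 ?nsq_ge0.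
have -> : `|a| ^+ 2 + `|b| ^+ 2 = (Num.sqrt (nsq a + nsq b))%:C ^+ 2.
  by rewrite !normCK !nsqE -rmorphD -rmorphXn /= sqr_sqrtr.
by apply: sqrCK; rewrite lecE /= eqxx sqrtr_ge0.
Qed.

Lemma dnormE f p : dnorm f p = (Num.sqrt (grad2 f p))%:C.
Proof. exact: sqrtC_nsq. Qed.

Let rowZ (a : R[i]) Z j : (a *: Z) 0 j = a * Z 0 j.
Proof. by rewrite mxE. Qed.

Let hess_scale (a b : R[i]) (h00 h01 h10 h11 z0 z1 w0 w1 : R[i]) :
  h00 * (a * z0) * conj (b * w0) + h01 * (a * z0) * conj (b * w1)
  + (h10 * (a * z1) * conj (b * w0) + h11 * (a * z1) * conj (b * w1)) =
  a * conj b * (h00 * z0 * conj w0 + h01 * z0 * conj w1 + (h10 * z1 * conj w0 + h11 * z1 * conj w1)).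
Proof. by rewrite !conj_M; move: (conj b) (conj w0) (conj w1) => *; ring. Qed.

Lemma hessZ f (a b : R[i]) Z W p : hess f (a *: Z) (b *: W) p = a * conj b * hess f Z W p.
Proof. by rewrite !hessE !rowZ; exact: hess_scale. Qed.

Let inv_dnorm_sqr f p : (dnorm f p)^-1 * conj (dnorm f p)^-1 = ((grad2 f p)^-1)%:C.
Proof.
rewrite dnormE -fmorphV conj_real -rmorphM -expr2 exprVn sqr_sqrtr ?grad2_ge0 //.
Qed.

Lemma levi_formE f p : levi_form f p = ((grad2 f p)^-1)%:C * levi f p.
Proof. by rewrite /levi_form /Lvect hessZ inv_dnorm_sqr. Qed.

Lemma hess_Lvect_Nvect f p :
  hess f (Lvect f p) (Nvect f p) p = ((grad2 f p)^-1)%:C * mixed f p.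
Proof. by rewrite /Lvect /Nvect hessZ inv_dnorm_sqr. Qed.

Let vect_scale (a z0 z1 c0 c1 : R[i]) : a * z0 * c0 + a * - z1 * c1 = a * (z0 * c0 - z1 * c1).
Proof. by ring. Qed.

Lemma vect_app_Lvect f u p : vect_app (Lvect f p) u p =
  (dnorm f p)^-1 * (dz 1 (toC f) p * dz 0 (toC u) p - dz 0 (toC f) p * dz 1 (toC u) p).
Proof. rewrite vect_appE !rowZ !mxE; exact: vect_scale. Qed.

End Normalization.

(** * Change of the defining function on the boundary *)

Section WeightOnBoundary.
Variables (R : realType) (U : set (C2 R)).
Hypothesis oU : open U.
Variables (r psi : C2 R -> R).
Hypotheses (sr : smooth_on U r) (sp : smooth_on U psi).
Local Notation s := (fun p => r p * expR (- psi p)).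
Implicit Types p : C2 R.

Let levi_weight_alg (w q b00 b01 b10 b11 a0 a1 x0 x1 c0 c1 y0 y1 e00 e01 e10 e11
    B00 B01 B10 B11 A0 A1 X0 X1 : R[i]) : q = 0 ->
  B00 = w * (b00 - a0 * y0 - c0 * x0 - q * e00 + q * c0 * y0) ->
  B01 = w * (b01 - a0 * y1 - c0 * x1 - q * e01 + q * c0 * y1) ->
  B10 = w * (b10 - a1 * y0 - c1 * x0 - q * e10 + q * c1 * y0) ->
  B11 = w * (b11 - a1 * y1 - c1 * x1 - q * e11 + q * c1 * y1) ->
  A0 = w * (a0 - q * c0) -> A1 = w * (a1 - q * c1) ->
  X0 = w * (x0 - q * y0) -> X1 = w * (x1 - q * y1) ->
  B00 * A1 * X1 - B01 * A1 * X0 - B10 * A0 * X1 + B11 * A0 * X0 =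
  w ^+ 3 * (b00 * a1 * x1 - b01 * a1 * x0 - b10 * a0 * x1 + b11 * a0 * x0).
Proof. by move=> -> -> -> -> -> -> -> -> ->; ring. Qed.

(** The new terms of the Hessian are products with a first derivative of [r] or carry a factor [r].
    On the pair L, L they vanish, as L r = 0. One factor of the weight comes from the Hessian and
    two from the unnormalized fields. *)
Lemma levi_weight p : U p -> r p = 0 ->
  levi s p = (expR (- psi p))%:C ^+ 3 * levi r p.
Proof.
move=> Up rp; have q0 : (r p)%:C = 0 :> R[i] by rewrite rp.
have B j k := dz_dzbar_weight oU sr sp j k Up.
have A j := dz_weight oU sr sp j Up; have X j := dzbar_weight oU sr sp j Up.
rewrite !leviE.
exact: (levi_weight_alg q0 (B 0 0) (B 0 1) (B 1 0) (B 1 1) (A 0) (A 1) (X 0) (X 1)).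
Qed.

Let mixed_weight_alg (w q g b00 b01 b10 b11 a0 a1 x0 x1 c0 c1 y0 y1 e00 e01 e10 e11
    B00 B01 B10 B11 A0 A1 : R[i]) : q = 0 -> a0 * x0 + a1 * x1 = g ->
  B00 = w * (b00 - a0 * y0 - c0 * x0 - q * e00 + q * c0 * y0) ->
  B01 = w * (b01 - a0 * y1 - c0 * x1 - q * e01 + q * c0 * y1) ->
  B10 = w * (b10 - a1 * y0 - c1 * x0 - q * e10 + q * c1 * y0) ->
  B11 = w * (b11 - a1 * y1 - c1 * x1 - q * e11 + q * c1 * y1) ->
  A0 = w * (a0 - q * c0) -> A1 = w * (a1 - q * c1) ->
  B00 * A1 * A0 + B01 * A1 * A1 - B10 * A0 * A0 - B11 * A0 * A1 =
  w ^+ 3 * (b00 * a1 * a0 + b01 * a1 * a1 - b10 * a0 * a0 - b11 * a0 * a1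
    - g * (a1 * c0 - a0 * c1)).
Proof. by move=> -> <- -> -> -> -> -> ->; ring. Qed.

(** Here one product survives: L psi times the derivative of [r] along conj N, which is
    [grad2 r]. *)
Lemma mixed_weight p : U p -> r p = 0 ->
  mixed s p = (expR (- psi p))%:C ^+ 3 * (mixed r p
    - (grad2 r p)%:C * (dz 1 (toC r) p * dz 0 (toC psi) p - dz 0 (toC r) p * dz 1 (toC psi) p)).
Proof.
move=> Up rp; have q0 : (r p)%:C = 0 :> R[i] by rewrite rp.
have B j k := dz_dzbar_weight oU sr sp j k Up; have A j := dz_weight oU sr sp j Up.
rewrite !mixedE.
exact: (mixed_weight_alg q0 (grad2E r p) (B 0 0) (B 0 1) (B 1 0) (B 1 1) (A 0) (A 1)).
Qed.

End WeightOnBoundary.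

(** * From flat points to exponents *)

Section Exponents.
Variables (R : realType) (Omega : set (C2 R)).
Hypothesis domOmega : bounded_domain Omega.
Local Notation Re := (@complex.Re R).
Implicit Types (A U V : set (C2 R)) (f r w : C2 R -> R) (p : C2 R).

Let oO : open Omega. Proof. by case: domOmega. Qed.

Let closureP p : closure Omega p -> Omega p \/ bdry Omega p.
Proof.
move=> cp; have [|nO] := pselect (Omega p); [by left|right; split=> //].
by move/interior_subset.
Qed.

Let compact_closure : compact (closure Omega).
Proof.
have [_ _ _ [M [Mreal HM]]] := domOmega.
apply: bounded_closed_compact; last exact: closed_closure.
exists M; split=> // x Mx p cp; apply/ler_addgt0Pr => e e0.
have [q [Oq]] := cp _ (nbhsx_ballx p e e0); rewrite -ball_normE /= => pq.
rewrite -(subrK q p) addrC; apply: le_trans (ler_normD _ _) _.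
by apply: lerD; [exact: HM Mx _ Oq|exact: ltW].
Qed.

Let compact_bdry : compact (bdry Omega).
Proof.
apply: (subclosed_compact _ compact_closure); last by move=> p [].
by apply: closedI; [exact: closed_closure|exact/open_closedC/open_interior].
Qed.

Let compact_lower A U f : compact A -> A `<=` U -> smooth_on U f -> (forall p, A p -> 0 < f p) ->
  exists2 m : R, 0 < m & forall p, A p -> m <= f p.
Proof.
move=> cA AU sf f0; have [A0|/set0P An0] := eqVneq A set0.
  by exists 1 => // p; rewrite A0.
have cf : {within A, continuous f}.
  by apply: continuous_in_subspaceT => q /set_mem /AU; exact: smooth_on_continuous.
have [c /set_mem Ac Hc] := compact_EVT_min An0 cA cf.
by exists (f c); [exact: f0|move=> p /mem_set; exact: Hc].
Qed.

Let compact_upper A U f : compact A -> A `<=` U -> smooth_on U f ->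
  exists2 B : R, 0 <= B & forall p, A p -> f p <= B.
Proof.
move=> cA AU sf; have [A0|/set0P An0] := eqVneq A set0.
  by exists 0 => // p; rewrite A0.
have cf : {within A, continuous f}.
  by apply: continuous_in_subspaceT => q /set_mem /AU; exact: smooth_on_continuous.
have [c /set_mem Ac Hc] := compact_EVT_max An0 cA cf.
exists (Num.max 0 (f c)); first by rewrite le_max lexx.
by move=> p /mem_set /Hc h; rewrite le_max h orbT.
Qed.

Let smooth_on_grad2 U r : open U -> smooth_on U r -> smooth_on U (grad2 r).
Proof.
move=> oU sr; have sF := csmooth_toC oU sr.
have [a0 a1] := csmooth_dz 0 oU sF; have [b0 b1] := csmooth_dz 1 oU sF.
have sq f : smooth_on U f -> smooth_on U (fun p => f p ^+ 2).
  by move=> sf; apply: eq_smooth_on (smooth_onM oU sf sf) => // p _; rewrite expr2.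
exact: smooth_onD oU (smooth_onD oU (sq _ a0) (sq _ a1)) (smooth_onD oU (sq _ b0) (sq _ b1)).
Qed.

Let smooth_on_norm2 U : open U -> smooth_on U (@norm2 R).
Proof.
move=> oU; have sq j : smooth_on U (fun p : C2 R => p 0 j ^+ 2).
  by apply: eq_smooth_on (smooth_onM oU (smooth_on_coord j oU) (smooth_on_coord j oU)) => // p _; rewrite expr2.
exact: smooth_onD oU (smooth_onD oU (sq _) (sq _)) (smooth_onD oU (sq _) (sq _)).
Qed.

Let bdryU U r p : defining_on Omega U r -> bdry Omega p -> [/\ U p, r p = 0 & 0 < grad2 r p].
Proof.
move=> [_ [_ EB G]] Bp; have /grad2_gt0 g0 := G p Bp.
by move: Bp; rewrite EB => -[Up rp].
Qed.

(** Compactness of the boundary makes the constants uniform, so that one weight serves all boundary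
    points. *)
Let near_boundary U r k : defining_on Omega U r ->
  (forall p, bdry Omega p -> 0 <= Re (levi r p)) ->
  (forall p, bdry Omega p -> levi r p = 0 -> mixed r p = 0) ->
  0 < k -> k <= 1 ->
  exists2 psi, smooth_on U psi & forall p0, bdry Omega p0 ->
    \forall p \near p0, r p < 0 -> form_nonneg r psi k p.
Proof.
move=> D l_ge0 lm0 k0 k1; have [[oU _ sr] [_ EB _]] := D.
have BU : bdry Omega `<=` U by move=> p /(bdryU D)[].
have [m m0 Hm] := compact_lower compact_bdry BU (smooth_on_grad2 oU sr)
  (fun p Bp => let: And3 _ _ h := bdryU D Bp in h).
have [B B0 HB] := compact_upper compact_bdry BU (smooth_on_norm2 oU).
(* This gives e |z|^2 <= k / 8 on the boundary; the summand 1 keeps the denominator positive if B =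
   0. *)
pose e := k / 8 / (B + 1).
have B1 : 0 < B + 1 by rewrite ltr_wpDl.
have e0 : 0 < e by rewrite !divr_gt0.
(* With [grad2 r] at least m on the boundary, K e g^3 is at least 2, above the threshold 1 of
   [form_nonneg_flat]. *)
pose K := 2 / (e * m ^+ 3).
have sp := smooth_on_potential oU K e (csmooth_mixed oU sr).
exists (potential (mixed r) K e); first exact: sp.
move=> p0 Bp; have [Up rp g0] := bdryU D Bp.
have lr := levi_real oU sr Up.
have [l0|l0] := eqVneq (Re (levi r p0)) 0; last first.
  apply: (form_nonneg_strict oU sr sp k0) => //.
  by rewrite lt_neqAle eq_sym l0 l_ge0.
rewrite l0 in lr.
apply: (form_nonneg_flat oU sr) => //; first 1 last.
- exact: lm0.
- apply: (@le_trans _ _ (e * (B + 1))); last by rewrite /e divfK ?gt_eqF.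
  by rewrite ler_pM2l // ler_wpDr // HB.
- have -> : K * e * grad2 r p0 ^+ 3 = 2 * (grad2 r p0 ^+ 3 / m ^+ 3).
    by rewrite /K; field; rewrite !gt_eqF.
  apply: (@lt_le_trans _ _ 2); first by rewrite ltr1n.
  rewrite ler_pMr // ler_pdivlMr ?exprn_gt0 // mul1r.
  by rewrite lerXn2r ?nnegrE ?Hm // ltW.
- by move=> p Up' rp'; apply: l_ge0; rewrite EB.
Qed.

Lemma DF_exponent_of_flat U r tau : defining_on Omega U r ->
  (forall p, bdry Omega p -> 0 <= Re (levi r p)) ->
  (forall p, bdry Omega p -> levi r p = 0 -> mixed r p = 0) ->
  0 < tau < 1 -> DF_exponent Omega tau.
Proof.
move=> D l_ge0 lm0 /andP[tau0 tau1]; have [[oU cU sr] [EO EB _]] := D.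
pose k := (1 - tau) / 8.
have k0 : 0 < k by rewrite divr_gt0 // subr_gt0.
have k1 : k <= 1 by rewrite /k; lra.
have [psi sp near_form] := near_boundary D l_ge0 lm0 k0 k1.
pose s p := r p * expR (- psi p).
have Ds : defining_on Omega U s := defining_on_weight sp D.
have [[_ _ ss] [EOs _ _]] := Ds.
have OU : Omega `<=` U by move=> p /subset_closure/cU.
have s_lt0 p : Omega p -> s p < 0 by rewrite EOs => -[].
(* The boundary lies in [W], which is open; so [closure Omega] minus [W] is a compact subset of
   [Omega], on which - s has a positive minimum. *)
pose W := interior [set p | r p < 0 -> form_nonneg r psi k p].
have cC : compact (closure Omega `&` ~` W).
  apply: (subclosed_compact _ compact_closure); last by move=> p [].
  by apply: closedI; [exact: closed_closure|exact/open_closedC/open_interior].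
have CU : closure Omega `&` ~` W `<=` U by move=> p [/cU].
have [m m0 Hm] : exists2 m : R, 0 < m & forall p, (closure Omega `&` ~` W) p -> m <= - s p.
  apply: (compact_lower cC CU (smooth_onN oU ss)) => p [/closureP[Op _|Bp []]].
    by rewrite oppr_gt0 s_lt0.
  exact: near_form.
(* Below m, so that s > - c forces a point of [Omega] into [W]; at most 1 / 4 for the sake of
   [flat_convexity]. *)
pose c := Num.min m 4^-1.
have c0 : 0 < c by rewrite lt_min m0 invr_gt0 ltr0n.
have c4 : c <= 4^-1 by rewrite ge_min lexx orbT.
split; first by rewrite tau0.
exists (fun p => - gap c (s p)); split; first by exists U; exact: defining_on_gap.
have -> : (fun p => - ((- - gap c (s p)) `^ tau)) = fun p => outer tau c (s p).
  by apply/funext => p; rewrite opprK.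
apply: (psh_outer oO (smooth_on_sub OU ss) s_lt0) => // p Op cs Z.
have Wp : W p.
  apply: contrapT => nW; have := Hm p (conj (subset_closure Op) nW).
  have : c <= m by rewrite ge_min lexx.
  by move: cs; lra.
have rp : r p < 0 by move: Op; rewrite EO => -[].
have := interior_subset Wp rp (Z 0 0) (Z 0 1).
have := weight_formE oU sr sp k Z (OU _ Op).
rewrite -/(s p) => <- h; apply: mulr_ge0 h.
by rewrite sqr_ge0.
Qed.

Lemma levi_flatE U delta p : defining_on Omega U delta -> bdry Omega p ->
  (levi_form delta p = 0) <-> (Re (levi delta p) = 0).
Proof.
move=> D Bp; have [[oU _ sd] _] := D; have [Up dp g0] := bdryU D Bp.
rewrite levi_formE (levi_real oU sd Up) -rmorphM; split.
- move=> /(congr1 Re) /= /eqP; rewrite mulf_eq0 invr_eq0 (gt_eqF g0) => /eqP; exact.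
- by move=> /= ->; rewrite mulr0.
Qed.

Lemma levi_ge0 U r p : levi_pseudoconvex Omega -> defining_on Omega U r ->
  bdry Omega p -> 0 <= Re (levi r p).
Proof.
move=> pc D Bp; have [Up rp g0] := bdryU D Bp.
have : 0 <= levi_form r p by apply: pc => //; exists U.
rewrite levi_formE lecE Re_real => /andP[_].
by rewrite pmulr_rge0 // invr_gt0.
Qed.

(** Pseudoconvexity turns the flat set into the boundary minus the open set where [levi] is
    positive. Compactness is what the finite cover in [smooth_extension] requires. *)
Lemma compact_levi_flat U delta : levi_pseudoconvex Omega -> defining_on Omega U delta ->
  compact (levi_flat Omega delta).
Proof.
move=> pc D; have [[oU _ sd] _] := D.
have [sl _] := csmooth_levi oU sd.
have oP : open [set p | U p /\ 0 < Re (levi delta p)] by exact: open_smooth_gt.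
have -> : levi_flat Omega delta = bdry Omega `&` ~` [set p | U p /\ 0 < Re (levi delta p)].
  apply/seteqP; split=> p /= [Bp].
    by move=> /(levi_flatE D Bp) l0; split=> // -[_]; rewrite l0 ltxx.
  move=> nl; split=> //; apply/(levi_flatE D Bp)/eqP.
  have [Up _ _] := bdryU D Bp.
  rewrite eq_le (levi_ge0 pc D Bp) andbT leNgt; apply/negP => l0; exact: nl.
apply: (subclosed_compact _ compact_bdry); last by move=> p [].
apply: closedI; last exact: open_closedC.
by apply: closedI; [exact: closed_closure|exact/open_closedC/open_interior].
Qed.

Let mixed_alg (g : R) (m a0 a1 c0 c1 d0 d1 : R[i]) : 0 < g ->
  d0 = (-2)%:C * c0 -> d1 = (-2)%:C * c1 ->
  (Num.sqrt g)%:C^-1 * (a1 * c0 - a0 * c1) = - ((g^-1)%:C * m / (2 * Num.sqrt g)%:C) ->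
  m - g%:C * (a1 * d0 - a0 * d1) = 0.
Proof.
move=> g0 -> ->; set q := Num.sqrt g.
have q0 : 0 < q by rewrite sqrtr_gt0.
have -> : g = q ^+ 2 by rewrite sqr_sqrtr // ltW.
have qn : q%:C != 0 :> R[i] by rewrite fmorph_eq0 gt_eqF.
(* Clears the powers of q on the right: two from the inverse of g, one from the gradient norm. *)
move=> /(congr1 (fun x => q%:C ^+ 3 * x)).
have -> : q%:C ^+ 3 * (q%:C^-1 * (a1 * c0 - a0 * c1)) = q%:C ^+ 2 * (a1 * c0 - a0 * c1) by field.
have -> : q%:C ^+ 3 * - (((q ^+ 2)^-1)%:C * m / (2 * q)%:C) = - (m / 2).
  by rewrite fmorphV rmorphXn rmorphM rmorph_nat; field.
move=> E; rewrite rmorphXn rmorphN rmorph_nat.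
transitivity (m + 2 * (q%:C ^+ 2 * (a1 * c0 - a0 * c1))); first by ring.
by rewrite E; field.
Qed.

(** The solution [u] lives on a piece of the boundary, while a weight must be smooth on [U]. The
    extension [w] is near each flat point also a local extension of [u], so the equation may be
    evaluated on [w]. *)
Lemma flat_defining_function U V delta u : levi_pseudoconvex Omega -> defining_on Omega U delta ->
  levi_flat Omega delta `<=` V -> smooth_along (bdry Omega `&` V) u ->
  (forall p, levi_flat Omega delta p ->
     vect_app_along (bdry Omega `&` V) (Lvect delta p) u p
       (- (hess delta (Lvect delta p) (Nvect delta p) p
           / (eucl_norm (grad delta p))%:C))) ->
  exists2 r, defining_on Omega U r &
    forall p, bdry Omega p -> levi r p = 0 -> mixed r p = 0.
Proof.
move=> pc D FV su eqLu; have [[oU _ sd] _] := D.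
have FM : levi_flat Omega delta `<=` bdry Omega `&` V.
  by move=> p Fp; split; [case: Fp|exact: FV].
have [w sw Hw] := smooth_extension (compact_levi_flat pc D) FM su.
have swU : smooth_on U w by exact: smooth_on_sub sw.
(* In unnormalized terms the equation reads L w = - mixed / (2 g). Then g L psi = mixed at flat
   points, which is the term subtracted in [mixed_weight]. *)
pose psi p := -2 * w p.
have sp : smooth_on U psi by exact: smooth_onM (smooth_on_cst _ oU) swU.
exists (fun p => delta p * expR (- psi p)); first exact: defining_on_weight.
move=> p Bp; have [Up dp g0] := bdryU D Bp.
rewrite (levi_weight oU sd sp Up dp) (mixed_weight oU sd sp Up dp) => /eqP.
have E0 : (expR (- psi p))%:C ^+ 3 != 0 :> R[i] by rewrite expf_neq0 // fmorph_eq0 gt_eqF ?expR_gt0.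
rewrite mulf_eq0 (negPf E0) /= => /eqP l0.
have Fp : levi_flat Omega delta p by split=> //; apply/(levi_flatE D Bp); rewrite l0.
have := eqLu p Fp w (Hw p Fp).
rewrite vect_app_Lvect hess_Lvect_Nvect eucl_norm_grad dnormE => H.
have dpsi j : dz j (toC psi) p = (-2)%:C * dz j (toC w) p.
  apply: (dz_comp oU j swU Up (phi := fun x => -2 * x)).
  have Dl := is_deriveM (is_derive_cst (-2 : R) (w p) 1) (is_derive_id (w p) (1 : R)).
  by apply: (is_derive_eq Dl); rewrite /GRing.scale /= mulr0 addr0 mulr1.
by rewrite (mixed_alg g0 (dpsi 0) (dpsi 1) H) mulr0.
Qed.

End Exponents.

Theorem proposition3 (R : realType) (Omega : set (C2 R)) (delta : C2 R -> R)
  (domOmega : bounded_domain Omega)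
  (smOmega : smooth_bdry Omega)
  (pcOmega : levi_pseudoconvex Omega)
  (defdelta : defining_function Omega delta)
  (V : set (C2 R)) (u : C2 R -> R)
  (openV : open V)
  (nbhdV : levi_flat Omega delta `<=` V)
  (smu : smooth_along (bdry Omega `&` V) u)
  (eqLu : forall p, levi_flat Omega delta p ->
     vect_app_along (bdry Omega `&` V) (Lvect delta p) u p
       (- (hess delta (Lvect delta p) (Nvect delta p) p
           / (eucl_norm (grad delta p))%:C))) :
  DF_index Omega = 1.
Proof.
have [U D] := defdelta.
have [r Dr Hr] := flat_defining_function domOmega pcOmega D nbhdV smu eqLu.
have exponent tau : 0 < tau < 1 -> DF_exponent Omega tau.
  by apply: (DF_exponent_of_flat domOmega Dr) => // p; exact: levi_ge0 pcOmega Dr.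
(* One exponent makes the set nonempty, so that [sup] is a true supremum and not its default
   value. *)
have half : DF_exponent Omega 2^-1.
  by apply: exponent; rewrite invr_gt0 ltr0n invf_lt1 ?ltr0n // ltr1n.
have ub1 : ubound [set tau | DF_exponent Omega tau] 1.
  by move=> tau [/andP[_ /ltW]].
have hs : has_sup [set tau | DF_exponent Omega tau] by split; [exists 2^-1|exists 1].
apply/eqP; rewrite eq_le; apply/andP; split.
  by apply: ge_sup => //; case: hs.
rewrite leNgt; apply/negP => lt1.
have ub tau : DF_exponent Omega tau -> tau <= DF_index Omega.
  by move=> ?; apply: ub_le_sup => //; exists 1.
(* An index below 1 would be exceeded by its midpoint with 1, again an exponent; the bound 1 / 2
   ensures that the midpoint is positive. *)
have h := ub _ half.
have /exponent/ub : 0 < (1 + DF_index Omega) / 2 < 1 by apply/andP; split; lra.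
by lra.
Qed.
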